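(* In the setting described in the context (in particular $\det(E_n-X(T))\ne 0$), consider the system for $(\hat z,p)$ $$-\frac{d\hat z(t)}{dt}=A^*(t)\hat z(t)+l_0(t)-\sum_{j=1}^M \chi_{\Omega_j}(t)H^*_j(t)D_j(t)H_j(t)p(t),\quad t\in (0,T),\ t\neq t_i,$$ $$\hat z(t_i+0)-\hat z(t_i)=H^*_iD_iH_ip(t_i),\quad i=1,\ldots,N,\quad \hat z(T)=\hat z(0),$$ $$\frac{dp(t)}{dt}=A(t)p(t)+\tilde Q(t)\hat z(t),\quad t\in (0,T),\ t\neq t_i,$$ $$p(t_i+0)-p(t_i)=0,\quad i=1,\ldots,N,\quad p(0)=p(T),$$ and the system for $(\hat p,\hat x)$ determined by the observations $y_i$, $y_j(\cdot)$ $$-\frac{d\hat p(t)}{dt}=A^*(t)\hat p(t)-\sum_{j=1}^M \chi_{\Omega_j}(t)H^*_j(t)D_j(t)[H_j(t)\hat x(t)-y_j(t)],\quad t\in (0,T),\ t\neq t_i,$$ $$\hat p(t_i+0)-\hat p(t_i)=H^*_iD_i[H_i\hat x(t_i)-y_i],\quad i=1,\ldots,N,\quad \hat p(T)=\hat p(0),$$ $$\frac{d\hat x(t)}{dt}=A(t)\hat x(t)+\tilde Q(t)\hat p(t)+B(t)f_0(t),\quad t\in (0,T),\ t\neq t_i,$$ $$\hat x(t_i+0)-\hat x(t_i)=0,\quad i=1,\ldots,N,\quad \hat x(0)=\hat x(T).$$ Then both systems are uniquely solvable (the second one, whose data are random, being understood to hold with probability $1$), and the minimax estimate $\widehat{\widehat{l(x)}}$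 of $l(x)=\int_0^T(x(t),l_0(t))_n\,dt$ has the form $$\widehat{\widehat{l(x)}}=\sum_{i=1}^N(y_i,\hat u_i)_m+\sum_{j=1}^M \int_{\Omega_j}(y_j(t),\hat u_j(t))_l\,dt+\hat c=l(\hat x),$$ where $$\hat{u}_i=D_iH_ip(t_i),\ i=1,\ldots,N,\qquad \hat u_j(t)=D_j(t)H_j(t)p(t),\ j=1,\ldots,M,\qquad \hat c=\int_{0}^{T}(f_0(t),B^*(t)\hat z(t))_{r}\,dt .$$ The minimax estimation error is $$\sigma=[l(p)]^{1/2}=\Bigl[\int_0^T(p(t),l_0(t))_n\,dt\Bigr]^{1/2}.$$
   Context: **Notation.** $(\cdot,\cdot)_k$ is the inner product of $\mathbb C^k$ (linear in the first argument); $\Lambda^*$ is the conjugate transpose of a matrix $\Lambda$; $E_n$ is the $n\times n$ identity matrix; $\mathrm{Sp}$ is the trace; $\chi_\Omega$ is the characteristic function of $\Omega$; $\mathbb E$ is expectation. Objects with an argument $t$ (such as $H_j(t),D_j(t),u_j(\cdot),\xi_j(\cdot),y_j(\cdot)$, $j=1,\dots,M$) are different from the objects without argument ($H_i,D_i,u_i,\xi_i,y_i$, $i=1,\dots,N$), even when the indices coincide. **State equation.** $A(t)$ ($n\times n$) and $B(t)$ ($n\times r$) are complex matrix functions with continuous $T$-periodic entries. $X(t)$ is the fundamental matrix of $x'=A(t)x$ with $X(0)=E_n$, and it is assumed that $\det(E_n-X(T))\neq 0$. For $f\in (L^2(0,T))^r$ the state $x$ is the unique absolutely continuous solution on $[0,T]$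 of $x'(t)=A(t)x(t)+B(t)f(t)$ for a.e. $t\in(0,T)$, $x(0)=x(T)$. **Solutions with jumps.** Points $0=t_0<t_1<\dots<t_N<t_{N+1}=T$ are fixed. Solutions of equations prescribed for $t\in(0,T)$, $t\ne t_i$, with jump conditions at $t_i$ are functions that are absolutely continuous on each $(t_{i-1},t_i)$ with finite one-sided limits at its ends (so absolutely continuous on the closed subinterval after extension by continuity), continuous from the left at $t_1,\dots,t_N$, satisfying the differential equation a.e.; values at $0$ and $T$ are the one-sided limits from inside $(0,T)$. **Observations.** $\Omega_1,\dots,\Omega_M$ are subintervals of $[0,T]$. One observes $$y_i=H_ix(t_i)+\xi_i\ (i=1,\dots,N),\qquad y_j(t)=H_j(t)x(t)+\xi_j(t),\ t\in\Omega_j\ (j=1,\dots,M),$$ where $H_i$ are $m\times n$ matrices and $H_j(t)$ are $l\times n$ matrices with entries continuous and bounded on $\Omega_j$. The function $f$ and the noise $\xi=(\xi_1,\dots,\xi_N,\xi_1(\cdot),\dots,\xi_M(\cdot))$ are unknown with $f\in G_1$, $\xi\in G_2$. **Set $G_1$.** $$G_1=\Bigl\{\tilde f\in (L^2(0,T))^r:\int_0^T(Q(t)(\tilde f(t)-f_0(t)),\tilde f(t)-f_0(t))_r\,dt\le 1\Bigr\},$$ where $f_0\in(L^2(0,T))^r$ is given and $Q(t)$ is a Hermitian positive definite $r\times r$ matrix function, measurable and essentially bounded together with $Q^{-1}(t)$. Put $\tilde Q(t)=B(t)Q^{-1}(t)B^*(t)$. **Set $G_2$.** The set of random elements $\tilde\xi=(\tilde\xi_1,\dots,\tilde\xi_N,\tilde\xi_1(\cdot),\dots,\tilde\xi_M(\cdot))$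 (the underlying probability space being arbitrary), with $\tilde\xi_i$ random vectors in $\mathbb C^m$ and $\tilde\xi_j(\cdot)$ jointly measurable random functions with values in $\mathbb C^l$ on $\Omega_j$, such that: means are zero; second moments $\mathbb E|\tilde\xi_i|^2$ and $\mathbb E\|\tilde\xi_j(\cdot)\|^2_{(L^2(\Omega_j))^l}$ are finite; each vector $\tilde\xi_i$ is uncorrelated with each function $\tilde\xi_j(\cdot)$ (no such requirement is made among the $\tilde\xi_i$ themselves or among the $\tilde\xi_j(\cdot)$ themselves); and, with $\tilde R_i=\mathbb E\tilde\xi_i\tilde\xi_i^*$ and $\tilde R_j(t,s)=\mathbb E\tilde\xi_j(t)\tilde\xi_j^*(s)$, $$\sum_{i=1}^N\mathrm{Sp}[D_i\tilde R_i]\le1,\qquad \sum_{j=1}^M\int_{\Omega_j}\mathrm{Sp}[D_j(t)\tilde R_j(t,t)]\,dt\le 1.$$ Here $D_i$ are Hermitian positive definite $m\times m$ matrices and $D_j(t)$ are Hermitian positive definite $l\times l$ matrix functions on $\Omega_j$, measurable and essentially bounded together with $D_j^{-1}(t)$. **Minimax estimate.** $l_0\in(L^2(0,T))^n$ is given, and for a function $x$ one sets $l(x)=\int_0^T(x(t),l_0(t))_n\,dt$. Let $H=(\mathbb C^m)^N\times(L^2(\Omega_1))^l\times\dots\times(L^2(\Omega_M))^l$. For $u=(u_1,\dots,u_N,u_1(\cdot),\dots,u_M(\cdot))\in H$ and $c\in\mathbb C$ put $$\sigma(u,c)=\sup_{\tilde f\in G_1,\ \tilde\xi\in G_2}\mathbb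 E\,|l(\tilde x)-\widehat{l(\tilde x)}|^2,\qquad \widehat{l(\tilde x)}=\sum_{i=1}^N(\tilde y_i,u_i)_m+\sum_{j=1}^M\int_{\Omega_j}(\tilde y_j(t),u_j(t))_l\,dt+c,$$ where $\tilde x$ is the periodic state corresponding to $f=\tilde f$, $\tilde y_i=H_i\tilde x(t_i)+\tilde\xi_i$, $\tilde y_j(t)=H_j(t)\tilde x(t)+\tilde\xi_j(t)$. The minimax estimate of $l(x)$ is $$\widehat{\widehat{l(x)}}=\sum_{i=1}^N(y_i,\hat u_i)_m+\sum_{j=1}^M\int_{\Omega_j}(y_j(t),\hat u_j(t))_l\,dt+\hat c,$$ where $(\hat u,\hat c)\in H\times\mathbb C$ satisfies $\sigma(\hat u,\hat c)=\inf_{u\in H,\,c\in\mathbb C}\sigma(u,c)$; the minimax estimation error is $\sigma:=\{\sigma(\hat u,\hat c)\}^{1/2}$. *)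

(* Defs.v *)
From HB Require Import structures.
From mathcomp Require Import all_boot all_order all_algebra.
From mathcomp Require Import all_classical all_reals all_analysis.
From mathcomp Require Import complex.

Set Implicit Arguments.
Unset Strict Implicit.
Unset Printing Implicit Defensive.
Import Order.TTheory GRing.Theory Num.Theory.
Import numFieldNormedType.Exports.
Import ComplexField.Normc.

Local Open Scope classical_set_scope.
Local Open Scope ring_scope.
Local Open Scope sesquilinear_scope.

(* [R[i]] carries no topology or measurable structure in the libraries, so the
   analytic notions for functions with values in complex matrices are taken on
   the real and imaginary parts of the entries. *)
Section ComplexMatrixFunctions.
Context {R : realType}.
Notation C := R[i].
Notation leb := (@lebesgue_measure R).

Definition entrywise {T : Type} {p q : nat} (P : (T -> R) -> Prop)
    (f : T -> 'M[C]_(p, q)) : Prop :=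
  forall a b, P (fun t => complex.Re (f t a b)) /\
              P (fun t => complex.Im (f t a b)).

Definition mx_cvg {p q : nat} (f : R -> 'M[C]_(p, q)) (F : set_system R)
    (L : 'M[C]_(p, q)) : Prop :=
  forall a b,
    ((fun t => complex.Re (f t a b)) @ F --> complex.Re (L a b)) /\
    ((fun t => complex.Im (f t a b)) @ F --> complex.Im (L a b)).

Definition mx_is_derive {p q : nat} (f : R -> 'M[C]_(p, q)) (t : R)
    (L : 'M[C]_(p, q)) : Prop :=
  forall a b,
    is_derive t 1 (fun s => complex.Re (f s a b)) (complex.Re (L a b)) /\
    is_derive t 1 (fun s => complex.Im (f s a b)) (complex.Im (L a b)).

Definition cint {d : measure_display} {T : measurableType d}
    (mu : {measure set T -> \bar R}) (D : set T) (f : T -> C) : C :=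
  Complex (\int[mu]_(x in D) complex.Re (f x))
          (\int[mu]_(x in D) complex.Im (f x)).

Definition mx_expectation {d : measure_display} {W : measurableType d}
    (P : probability W R) {p q : nat} (X : W -> 'M[C]_(p, q)) : 'M[C]_(p, q) :=
  \matrix_(a, b) Complex (fine 'E_P[fun w => complex.Re (X w a b)]%E)
                         (fine 'E_P[fun w => complex.Im (X w a b)]%E).

Definition dot {k : nat} (x y : 'cV[C]_k) : C := \sum_a x a 0 * (y a 0)^*.

Definition vnorm2 {k : nat} (x : 'cV[C]_k) : R := \sum_a normc (x a 0) ^+ 2.

Definition posdefmx {k : nat} (S : 'M[C]_k) : Prop :=
  S^t* = S /\ forall v : 'cV[C]_k, v != 0 -> 0 < dot (S *m v) v.

Definition L2 {k : nat} (D : set R) (f : R -> 'cV[C]_k) : Prop :=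
  entrywise (measurable_fun D) f /\
  (\int[leb]_(t in D) (vnorm2 (f t))%:E < +oo)%E.

Definition Linfty {p q : nat} (D : set R) (f : R -> 'M[C]_(p, q)) : Prop :=
  entrywise (measurable_fun D) f /\
  exists K : R, {ae leb, forall t, D t -> forall a b, normc (f t a b) <= K}.

(* Absolute continuity on an interval [D]: the [(s i).1, (s i).2] are the ends
   of finitely many non-overlapping subintervals of [D]. *)
Definition abs_continuous (D : set R) (g : R -> R) : Prop :=
  forall e : R, 0 < e -> exists2 d : R, 0 < d &
    forall (k : nat) (s : 'I_k -> R * R),
      (forall i, [/\ D (s i).1, D (s i).2 & (s i).1 <= (s i).2]) ->
      (forall i j, i != j -> (s i).2 <= (s j).1 \/ (s j).2 <= (s i).1) ->
      \sum_i ((s i).2 - (s i).1) < d ->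
      \sum_i `|g (s i).2 - g (s i).1| < e.

End ComplexMatrixFunctions.

(* Discrete families are indexed from 0: index [i : 'I_N] refers to the jump
   point [knot i.+1], and [knot 0 = 0], [knot N.+1 = period].  The suffixes [d]
   and [c] tell the data at the jump points (H_i, D_i) from the data on the
   observation intervals (H_j(t), D_j(t)). *)
Record setting (R : realType) (n r m l N M : nat) := Setting {
  period : R;
  knot : nat -> R;
  A : R -> 'M[R[i]]_n;
  B : R -> 'M[R[i]]_(n, r);
  Hd : 'I_N -> 'M[R[i]]_(m, n);
  Omega : 'I_M -> set R;
  Hc : 'I_M -> R -> 'M[R[i]]_(l, n);
  Q : R -> 'M[R[i]]_r;
  f0 : R -> 'cV[R[i]]_r;
  Dd : 'I_N -> 'M[R[i]]_m;
  Dc : 'I_M -> R -> 'M[R[i]]_l;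
  l0 : R -> 'cV[R[i]]_n
}.

Section Problem.
Context {R : realType} {n r m l N M : nat}.
Variable S : setting R n r m l N M.
Notation C := R[i].
Notation leb := (@lebesgue_measure R).
Notation T := (period S).
Notation tk := (knot S).
Notation I0T := (`]0, T[%classic : set R).

Record standing : Prop := Standing {
  knot_first : tk 0 = 0;
  knot_last : tk N.+1 = T;
  knot_lt : forall k : nat, (k <= N)%N -> tk k < tk k.+1;
  A_continuous : entrywise (fun g => continuous g) (A S);
  A_periodic : forall t, A S (t + T) = A S t;
  B_continuous : entrywise (fun g => continuous g) (B S);
  B_periodic : forall t, B S (t + T) = B S t;
  Omega_interval : forall j, is_interval (Omega S j);
  Omega_sub : forall j, Omega S j `<=` `[0, T];
  Hc_continuous : forall j,
    entrywise (fun g : R -> R => {within Omega S j, continuous g}) (Hc S j);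
  Hc_bounded : forall j, exists K : R,
    forall t, Omega S j t -> forall a b, normc (Hc S j t a b) <= K;
  Q_posdef : forall t, I0T t -> posdefmx (Q S t);
  Q_Linfty : Linfty I0T (Q S);
  Qinv_Linfty : Linfty I0T (fun t => invmx (Q S t));
  f0_L2 : L2 I0T (f0 S);
  Dd_posdef : forall i, posdefmx (Dd S i);
  Dc_posdef : forall j t, Omega S j t -> posdefmx (Dc S j t);
  Dc_Linfty : forall j, Linfty (Omega S j) (Dc S j);
  Dcinv_Linfty : forall j, Linfty (Omega S j) (fun t => invmx (Dc S j t));
  l0_L2 : L2 I0T (l0 S)
}.

Definition fundamental_matrix (X : R -> 'M[C]_n) : Prop :=
  X 0 = 1%:M /\ forall t, mx_is_derive X t (A S t *m X t).

Definition Qtilde (t : R) : 'M[C]_n := B S t *m invmx (Q S t) *m (B S t)^t*.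

Definition is_state (f : R -> 'cV[C]_r) (x : R -> 'cV[C]_n) : Prop :=
  [/\ entrywise (abs_continuous `[0, T]) x,
      {ae leb, forall t, I0T t -> mx_is_derive x t (A S t *m x t + B S t *m f t)}
    & x 0 = x T].

Definition ell (x : R -> 'cV[C]_n) : C :=
  cint leb I0T (fun t => dot (x t) (l0 S t)).

(* Families (v_1, .., v_N, v_1(.), .., v_M(.)): observations, noise
   realizations and the weights u all have this shape. *)
Definition obs_family : Type :=
  (('I_N -> 'cV[C]_m) * ('I_M -> R -> 'cV[C]_l))%type.

Definition in_H (u : obs_family) : Prop := forall j, L2 (Omega S j) (u.2 j).

Definition eq_H (u v : obs_family) : Prop :=
  u.1 =1 v.1 /\ forall j, {ae leb, forall t, Omega S j t -> u.2 j t = v.2 j t}.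

Definition observe (x : R -> 'cV[C]_n) (xi : obs_family) : obs_family :=
  (fun i => Hd S i *m x (tk i.+1) + xi.1 i,
   fun j t => Hc S j t *m x t + xi.2 j t).

Definition in_G1 (f : R -> 'cV[C]_r) : Prop :=
  L2 I0T f /\
  cint leb I0T (fun t => dot (Q S t *m (f t - f0 S t)) (f t - f0 S t)) <= 1.

(* Quantities such as R_j(t,t) are defined for almost every t only, hence the
   "almost everywhere" in the conditions on the mean and covariance functions. *)
Record in_G2 {d : measure_display} {W : measurableType d}
    (P : probability W R) (xi : W -> obs_family) : Prop := InG2 {
  noise_d_measurable : forall i,
    entrywise (measurable_fun [set: W]) (fun w => (xi w).1 i);
  noise_c_measurable : forall j,
    entrywise (measurable_fun ([set: W] `*` Omega S j))
      (fun wt : W * R => (xi wt.1).2 j wt.2);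
  noise_d_moment2 : forall i, ('E_P[fun w => vnorm2 ((xi w).1 i)] < +oo)%E;
  noise_c_moment2 : forall j,
    (\int[P]_w \int[leb]_(t in Omega S j) (vnorm2 ((xi w).2 j t))%:E < +oo)%E;
  noise_d_mean : forall i, mx_expectation P (fun w => (xi w).1 i) = 0;
  noise_c_mean : forall j, {ae leb, forall t, Omega S j t ->
    mx_expectation P (fun w => (xi w).2 j t) = 0};
  noise_uncorrelated : forall i j, {ae leb, forall t, Omega S j t ->
    mx_expectation P (fun w => (xi w).1 i *m ((xi w).2 j t)^t*) = 0};
  noise_d_trace :
    \sum_i \tr (Dd S i *m
      mx_expectation P (fun w => (xi w).1 i *m ((xi w).1 i)^t*)) <= 1;
  noise_c_trace :
    \sum_j cint leb (Omega S j) (fun t => \tr (Dc S j t *m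
      mx_expectation P (fun w => (xi w).2 j t *m ((xi w).2 j t)^t*))) <= 1
}.

Definition estimate (y u : obs_family) (c : C) : C :=
  \sum_i dot (y.1 i) (u.1 i) +
  \sum_j cint leb (Omega S j) (fun t => dot (y.2 j t) (u.2 j t)) + c.

(* The state of a given f is a determined function because
   det (1 - X(T)) != 0; the probability space ranges over all spaces. *)
Definition sigma (u : obs_family) (c : C) : \bar R :=
  ereal_sup [set v | exists (f : R -> 'cV[C]_r) (x : R -> 'cV[C]_n)
      (d : measure_display) (W : measurableType d) (P : probability W R)
      (xi : W -> obs_family),
    [/\ in_G1 f, is_state f x, in_G2 P xi &
        v = 'E_P[fun w =>
               (normc (ell x - estimate (observe x (xi w)) u c) ^+ 2)%R]%E]].

Definition is_minimax (u : obs_family) (c : C) : Prop :=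
  in_H u /\
  sigma u c = ereal_inf [set v | exists (u' : obs_family) (c' : C),
                                   in_H u' /\ v = sigma u' c'].

Definition estimation_error (u : obs_family) (c : C) : \bar R := sqrte (sigma u c).

(* z' = F a.e. on (0,T), z(t_i + 0) - z(t_i) = J i and z(T) = z(0), for z
   piecewise absolutely continuous with finite one-sided limits, continuous
   from the left at t_1, .., t_N; z(0) and z(T) are the limits from inside. *)
Definition periodic_jump_solution (F : R -> 'cV[C]_n) (J : 'I_N -> 'cV[C]_n)
    (z : R -> 'cV[C]_n) : Prop :=
  [/\ forall k : nat, (k <= N)%N ->
        entrywise (abs_continuous `]tk k, tk k.+1[) z /\
        mx_cvg z (tk k.+1)^'- (z (tk k.+1)),
      mx_cvg z 0^'+ (z 0),
      {ae leb, forall t, I0T t -> mx_is_derive z t (F t)},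
      forall i : 'I_N, mx_cvg z (tk i.+1)^'+ (z (tk i.+1) + J i)
    & z T = z 0].

Definition chi (j : 'I_M) (t : R) : C := \1_(Omega S j) t.

Definition system_zp (z p : R -> 'cV[C]_n) : Prop :=
  periodic_jump_solution
    (fun t => - ((A S t)^t* *m z t + l0 S t
      - \sum_j chi j t *: ((Hc S j t)^t* *m Dc S j t *m Hc S j t *m p t)))
    (fun i => (Hd S i)^t* *m Dd S i *m Hd S i *m p (tk i.+1)) z /\
  periodic_jump_solution
    (fun t => A S t *m p t + Qtilde t *m z t) (fun=> 0) p.

Definition system_px (y : obs_family) (p x : R -> 'cV[C]_n) : Prop :=
  periodic_jump_solution
    (fun t => - ((A S t)^t* *m p t
      - \sum_j chi j t *:
          ((Hc S j t)^t* *m Dc S j t *m (Hc S j t *m x t - y.2 j t))))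
    (fun i => (Hd S i)^t* *m Dd S i *m (Hd S i *m x (tk i.+1) - y.1 i)) p /\
  periodic_jump_solution
    (fun t => A S t *m x t + Qtilde t *m p t + B S t *m f0 S t) (fun=> 0) x.

Definition uniquely_solvable
    (sys : (R -> 'cV[C]_n) -> (R -> 'cV[C]_n) -> Prop) : Prop :=
  (exists z p, sys z p) /\
  forall z p z' p', sys z p -> sys z' p' ->
    forall t, 0 <= t <= T -> z t = z' t /\ p t = p' t.

Definition u_hat (p : R -> 'cV[C]_n) : obs_family :=
  (fun i => Dd S i *m Hd S i *m p (tk i.+1),
   fun j t => Dc S j t *m Hc S j t *m p t).

Definition c_hat (z : R -> 'cV[C]_n) : C :=
  cint leb I0T (fun t => dot (f0 S t) ((B S t)^t* *m z t)).

End Problem.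

(* Main.v *)
Require Import Defs.
From HB Require Import structures.
From mathcomp Require Import all_boot all_order all_algebra.
From mathcomp Require Import all_classical all_reals all_analysis.
From mathcomp Require Import complex measurable_realfun.
From mathcomp Require Import ring lra.

Set Implicit Arguments.
Unset Strict Implicit.
Unset Printing Implicit Defensive.
Import Order.TTheory GRing.Theory Num.Theory.
Import numFieldNormedType.Exports.
Local Open Scope classical_set_scope.
Local Open Scope ring_scope.

(** Fix weights [u] and let [z] be the periodic adjoint state that they generate together with [l0]
    ([adjoint_of]). Integrating the derivative of the product of a state [x] with [z] over one
    period ([green], [pairing]) expresses [ell x] through the exact observations of [x] paired with
    [u], plus the integral of [f] against the adjoint of [B] applied to [z] ([ell_duality]).
    Subtracting the estimate leaves a deterministic bias depending on [f] and [c], minus the noise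
    paired with [u]. The noise is centred and its discrete and continuous parts are uncorrelated, so
    the mean square error is a sum of three terms ([estimate_error]), one for each of the three
    constraints.

    Each term is maximised separately. Cauchy-Schwarz in the metrics of [Q], [Dd] and [Dc] gives
    upper bounds ([sigma_le]). The bounds are attained by an extremal [f] and by noise consisting of
    fixed extremal patterns multiplied by two independent random signs ([sigma_ge]). With
    [c = c_hat S z] the worst error is therefore the quadratic functional
    [qform S z + dform_d S u + dform_c S u], and any other [c] adds at least the square of its
    distance to [c_hat S z].

    The system for (z, p) is the Euler equation of this functional: [p] is a state driven by
    [Qtilde z], and the optimal weights are the weighted observations of [p]. Expanding around them,
    the mixed terms cancel by duality ([quadratic_gap]). What remains is at least the squared
    distance of [u] from [u_hat], which proves optimality and uniqueness of the weights and of [c].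
    Pairing [p] with [z] evaluates the minimum as [ell S p] ([ell_p]). Pairing the two systems
    crosswise, with the symmetry of [Qtilde] and of the noise weights, shows that the optimal
    estimate equals [ell] of the solution [x'] of the second system ([estimate_ell]).

    Both systems are one linear periodic problem with jumps, of size [n + n], with different free
    terms. Initial value problems are Volterra equations solved by Picard iteration
    ([volterra_exists]). Periodicity and consistency at the knots are then finitely many linear
    conditions on as many parameters, so existence follows from uniqueness of the homogeneous
    problem ([fredholm_alternative]). For the latter, Green's formula gives a vanishing sum of
    nonnegative energies, hence [Qtilde z = 0] almost everywhere. Invertibility of [1%:M - X T] then
    forces first [p] and next [z] to vanish ([zp_homogeneous]).

    Throughout, differential equations holding almost everywhere are replaced by integral equations
    ([int_sol], [csol]), which rests on the fundamental theorem of calculus for absolutely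
    continuous functions ([abs_continuous_FTC]). *)

(** * Stability properties of absolute continuity *)

Section AbsoluteContinuity.
Context {R : realType}.
Notation leb := (@lebesgue_measure R).
Implicit Types (a b e : R) (D : set R) (f g : R -> R).

Lemma abs_continuousS D D' g : D' `<=` D ->
  abs_continuous D g -> abs_continuous D' g.
Proof.
move=> sub acg e /acg[d d0 H]; exists d => // k s sD sd ss.
by apply: H => // i; have [? ? ?] := sD i; split => //; apply: sub.
Qed.

Lemma eq_abs_continuous D f g : {in D, f =1 g} ->
  abs_continuous D f -> abs_continuous D g.
Proof.
move=> fg acf e /acf[d d0 H]; exists d => // k s sD sd ss.
rewrite (eq_bigr (fun i => `|f (s i).2 - f (s i).1|)); first exact: H.
by move=> i _; have [? ? ?] := sD i; rewrite !fg ?inE.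
Qed.

(** Taking both moduli at [e / (2 * K)] bounds the two sums of increments separately. Sums,
    differences and products of bounded functions then need only one estimate of a single
    increment. *)
Lemma abs_continuous_lip2 D (f g h : R -> R) (K : R) : 0 < K ->
  abs_continuous D f -> abs_continuous D g ->
  (forall x y, D x -> D y -> `|h y - h x| <= K * (`|f y - f x| + `|g y - g x|)) ->
  abs_continuous D h.
Proof.
move=> K0 acf acg hfg e e0.
have e2 : 0 < e / (2 * K) by rewrite divr_gt0// mulr_gt0.
have [d1 d10 H1] := acf _ e2; have [d2 d20 H2] := acg _ e2.
exists (Num.min d1 d2); first by rewrite lt_min d10 d20.
move=> k s sD sd; rewrite lt_min => /andP[s1 s2].
have {}H1 := H1 _ _ sD sd s1; have {}H2 := H2 _ _ sD sd s2.
have -> : e = K * (e / (2 * K) + e / (2 * K)) by field; rewrite gt_eqF.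
apply: le_lt_trans (_ : K * (\sum_i `|f (s i).2 - f (s i).1| + \sum_i `|g (s i).2 - g (s i).1|) < _).
  rewrite -big_split mulr_sumr /=; apply: ler_sum => i _.
  by have [? ? ?] := sD i; exact: hfg.
by rewrite ltr_pM2l// ltrD.
Qed.

Lemma abs_continuous_lipschitz D h (K : R) : 0 < K ->
  (forall x y, D x -> D y -> `|h y - h x| <= K * `|y - x|) -> abs_continuous D h.
Proof.
move=> K0 hK e e0; exists (e / K); first exact: divr_gt0.
move=> k s sD sd; rewrite -(ltr_pM2l K0) mulrCA divff ?gt_eqF// mulr1.
apply: le_lt_trans; rewrite mulr_sumr; apply: ler_sum => i _.
by have [? ? le] := sD i; rewrite (le_trans (hK _ _ _ _))// ger0_norm// subr_ge0.
Qed.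

Lemma abs_continuousD D f g : abs_continuous D f -> abs_continuous D g ->
  abs_continuous D (fun t => f t + g t).
Proof.
move=> acf acg; apply: (abs_continuous_lip2 ltr01 acf acg) => x y Dx Dy.
by rewrite mul1r opprD addrACA ler_normD.
Qed.

Lemma abs_continuousB D f g : abs_continuous D f -> abs_continuous D g ->
  abs_continuous D (fun t => f t - g t).
Proof.
move=> acf acg; apply: (abs_continuous_lip2 ltr01 acf acg) => x y Dx Dy.
rewrite mul1r (_ : _ - _ = (f y - f x) - (g y - g x)); last by ring.
exact: ler_normB.
Qed.

Lemma abs_continuousM D f g (K : R) :
  (forall x, D x -> `|f x| <= K) -> (forall x, D x -> `|g x| <= K) ->
  abs_continuous D f -> abs_continuous D g ->
  abs_continuous D (fun t => f t * g t).
Proof.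
move=> fK gK acf acg; apply: (abs_continuous_lip2 (K := `|K| + 1) _ acf acg).
  by rewrite ltr_wpDl.
move=> x y Dx Dy.
rewrite (_ : _ - _ = (f y - f x) * g y + (g y - g x) * f x); last by ring.
rewrite (le_trans (ler_normD _ _))// !normrM mulrDr ![_ * `|_ - _|]mulrC.
have KK z : z <= K -> z <= `|K| + 1.
  by move=> zK; rewrite (le_trans zK)// (le_trans (ler_norm K))// lerDl.
by rewrite lerD// ler_wpM2l// KK ?fK ?gK.
Qed.

Lemma abs_continuous_unif D g : is_interval D -> abs_continuous D g ->
  forall e, 0 < e -> exists2 d, 0 < d &
    forall x y, D x -> D y -> `|y - x| < d -> `|g y - g x| < e.
Proof.
move=> iD acg e /acg[d d0 H]; exists d => // x y Dx Dy.
wlog xy : x y Dx Dy / x <= y.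
  move=> W; have [xy|/ltW yx] := leP x y; first exact: W.
  by rewrite distrC (distrC (g y)); exact: W.
rewrite ger0_norm ?subr_ge0// => yxd.
have := H 1 (fun=> (x, y)); rewrite !big_ord1 /=; apply => //.
by move=> i j; rewrite !ord1.
Qed.

Lemma unif_within_continuous D g :
  (forall e, 0 < e -> exists2 d, 0 < d &
    forall x y, D x -> D y -> `|y - x| < d -> `|g y - g x| < e) ->
  {within D, continuous g}.
Proof.
move=> H; apply/subspace_continuousP => x Dx.
apply/cvgrPdist_lt => e e0; have [d d0 {}H] := H e e0.
rewrite !near_withinE; near=> y => Dy.
rewrite distrC; apply: H => //; rewrite distrC; near: y.
Unshelve. all: by end_near. Qed.

Lemma abs_continuous_within D g : is_interval D -> abs_continuous D g ->
  {within D, continuous g}.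
Proof. by move=> iD acg; apply/unif_within_continuous/abs_continuous_unif. Qed.

Lemma within_continuous_bounded a b g : {within `[a, b], continuous g} ->
  exists K : R, forall t, a <= t <= b -> `|g t| <= K.
Proof.
move=> cg; have /compact_bounded[K [_ Kg]] :=
  continuous_compact cg (@segment_compact _ a b).
exists (K + 1) => t tab; apply: Kg; first by rewrite ltrDl.
by exists t => //=; rewrite in_itv.
Qed.

End AbsoluteContinuity.

(** * Absolutely continuous functions with derivative zero almost everywhere *)

Section AbsoluteContinuityCriteria.
Context {R : realType}.
Notation leb := (@lebesgue_measure R).
Implicit Types (a b e : R) (D : set R) (f g : R -> R).
Lemma is_derive_slope g (t L : R) : is_derive t 1 g L ->
  forall e, 0 < e -> exists2 r, 0 < r &
    forall s, `|s - t| < r -> `|g s - g t - L * (s - t)| <= e * `|s - t|.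
Proof.
move=> dg e e0.
have cvgL : h^-1 *: ((g \o shift t) (h *: 1) - g t) @[h --> 0^'] --> L.
  by rewrite -(derive_val (is_derive := dg)); apply: ex_derive.
have /cvgrPdist_le /(_ e e0) := cvgL.
rewrite near_withinE => /nbhs_ballP[r /= r0 H]; exists r => // s str.
have [->|st] := eqVneq s t; first by rewrite !subrr mulr0 subr0 normr0 mulr0.
have h0 : s - t != 0 by rewrite subr_eq0.
have := H (s - t); rewrite /ball /= sub0r normrN => /(_ str h0).
rewrite [_ *: 1]mulr1 subrK => H1.
rewrite (_ : g s - g t - L * (s - t) =
  - ((L - (s - t)^-1 *: (g s - g t)) * (s - t))).
  by rewrite normrN normrM ler_wpM2r.
by rewrite [_ *: _]/(_ * _) mulrBl mulrAC mulVf// mul1r opprB.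
Qed.

(** Outer regularity of Lebesgue measure, applied to a measurable null set containing [N]. *)
Lemma negligible_open_cover (N : set R) e : leb.-negligible N -> 0 < e ->
  exists U : set R, [/\ open U, N `<=` U & (leb U < e%:E)%E].
Proof.
move=> [A [mA A0 NA]] e0.
have [|U [oU AU Ue]] := lebesgue_regularity_outer mA _ e0; first by rewrite [X in (X < _)%E]A0 ltry.
exists U; split => //; first exact: subset_trans AU.
have mU : measurable U by exact: measurable_realfun.open_measurable.
rewrite -(setDUK AU) measureU//; last 2 first.
  exact: measurableD.
  by rewrite setDIK.
by rewrite [X in (X + _)%E]A0 add0e.
Qed.

(* Real induction along [a, b]: the increment of [g] is controlled by the small
   derivative off a null set and by the absolute continuity over subintervals
   of a small open set covering that null set. *)
Lemma abs_continuous_derive0 a b g : a <= b -> abs_continuous `[a, b] g ->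
  {ae leb, forall t, a < t < b -> is_derive t 1 g 0} -> g b = g a.
Proof.
move=> ab acg dg.
suff H e : 0 < e -> `|g b - g a| <= e * (b - a) + e.
  apply/eqP; rewrite -subr_eq0 -normr_le0; apply/ler_addgt0Pr => e e0.
  have p : 0 < b - a + 1 by rewrite ltr_wpDl// subr_ge0.
  have := H (e / (b - a + 1)) (divr_gt0 e0 p).
  by rewrite -{2}[e / _]mulr1 -mulrDr divfK ?gt_eqF// add0r.
move=> e0; have [d d0 acd] := acg e e0.
(* The two endpoints join the exceptional set, so that a point outside [N] is interior and has
   derivative 0. *)
pose N := ~` [set t | a < t < b -> is_derive t 1 g 0] `|` ([set a] `|` [set b]).
have nN : leb.-negligible N.
  apply: negligibleU; first exact: dg.
  by apply: negligibleU; apply/negligibleP => //; exact: lebesgue_measure_set1.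
have [U [oU NU Ud]] := negligible_open_cover nN d0.
have mU : measurable U by exact: measurable_realfun.open_measurable.
(* [m x] is the length of [U] up to [x]. It is a budget, always below [d], for the subintervals that
   cover points of [N]. *)
pose m x := fine (leb (U `&` `]a, x])).
have fm x : leb (U `&` `]a, x]) \is a fin_num.
  rewrite ge0_fin_numE//; apply: le_lt_trans (lt_trans Ud (ltry d)).
  by apply: le_measure; rewrite ?inE//; exact: measurableI.
have md x : m x < d.
  rewrite -lte_fin fineK//; apply: le_lt_trans Ud.
  by apply: le_measure; rewrite ?inE//; exact: measurableI.
have m_le x y : x <= y -> m x <= m y.
  move=> xy; apply: fine_le => //; apply: le_measure; rewrite ?inE.
  - exact: measurableI.
  - exact: measurableI.
  - by apply: setIS => z /=; rewrite !in_itv/= => /andP[-> /le_trans ->].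
have m_add x y : a <= x -> x <= y -> `[x, y] `<=` U -> m y = m x + (y - x).
  move=> ax xy xyU.
  have E : U `&` `]a, y] = (U `&` `]a, x]) `|` `]x, y].
    apply/seteqP; split => z /=; rewrite !in_itv/=.
      move=> [Uz /andP[az zy]]; have [zx|xz] := leP z x.
        by left; split => //; rewrite az.
      by right; rewrite zy.
    move=> [[Uz /andP[-> /= zx]]|/andP[xz zy]].
      by split => //; apply: le_trans xy.
    by rewrite (le_lt_trans ax xz) zy; split => //; apply: xyU; rewrite /= in_itv/= ltW.
  rewrite /m E measureU//=; last 2 first.
    exact: measurableI.
    apply/seteqP; split => z //=; rewrite !in_itv/=.
    by move=> [[_ /andP[_ zx]] /andP[xz _]]; move: (lt_le_trans xz zx); rewrite ltxx.
  rewrite fineD//; last by rewrite lebesgue_measure_itv; case: ifP.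
  congr (_ + _); rewrite lebesgue_measure_itv/= lte_fin.
  by have [//|yx|->] := ltgtP x y; rewrite ?subrr//; move: xy; rewrite leNgt yx.
(* Invariant: up to [x] the increment of [g] costs at most slope [e] plus the increments over
   finitely many non-overlapping subintervals whose total length fits the budget [m x]. *)
pose P x := exists (k : nat) (s : 'I_k -> R * R),
  [/\ forall i, [/\ a <= (s i).1, (s i).2 <= x & (s i).1 <= (s i).2],
      forall i j, i != j -> (s i).2 <= (s j).1 \/ (s j).2 <= (s i).1,
      \sum_i ((s i).2 - (s i).1) <= m x &
      `|g x - g a| <= e * (x - a) + \sum_i `|g (s i).2 - g (s i).1|].
have Pa : P a.
  exists 0, (fun=> (a, a)); split; try by case.
    by rewrite big_ord0 /m fine_ge0.
  by rewrite big_ord0 !subrr normr0 mulr0 addr0.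
have Pb : P b -> `|g b - g a| <= e * (b - a) + e.
  move=> [k [s [s1 s2 s3 s4]]]; rewrite (le_trans s4)// lerD2l ltW// acd//.
    move=> i; have [as1 s2b s12] := s1 i.
    by split => //=; rewrite in_itv/= ?as1 ?s2b ?(le_trans s12)// (le_trans as1).
  exact: le_lt_trans s3 (md b).
(* [P] passes over a neighbourhood of every [t]: around a point of [N] the interval [x, y] lies in
   [U] and is added to the list; around any other point the slope estimate pays for it. *)
have step t : a <= t <= b -> exists2 r, 0 < r & forall x y, a <= x -> y <= b ->
    x <= t -> t <= y -> t - r < x -> y < t + r -> P x -> P y.
  move=> /andP[at_ tb]; have [tN|tN] := pselect (N t).
    have /nbhs_ballP[r /= r0 rU] := open_nbhs_nbhs (conj oU (NU _ tN)).
    exists r => // x y ax yb xt ty trx ytr [k [s [s1 s2 s3 s4]]].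
    have xy := le_trans xt ty.
    have xyU : `[x, y] `<=` U.
      move=> z /=; rewrite in_itv/= => /andP[xz zy]; apply: rU.
      by rewrite /ball/= ltr_distlC; apply/andP; split; lra.
    pose s' (i : 'I_k.+1) := if unlift ord0 i is Some j then s j else (x, y).
    exists k.+1, s'; split.
    - move=> i; rewrite /s'; case: unliftP => [j|] _ //=.
      by have [? s2x ?] := s1 j; split => //; exact: le_trans xy.
    - move=> i j; rewrite /s'.
      case: unliftP => [i'|] -> ; case: unliftP => [j'|] -> //=.
      + by rewrite (inj_eq lift_inj); exact: s2.
      + by move=> _; left; have [] := s1 i'.
      + by move=> _; right; have [] := s1 j'.
    - rewrite big_ord_recl /s' unlift_none /= (m_add x y)// addrC lerD2r.
      by under eq_bigr do rewrite liftK.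
    - rewrite big_ord_recl /s' unlift_none /=; under eq_bigr do rewrite liftK.
      rewrite (_ : g y - g a = (g y - g x) + (g x - g a)); last by ring.
      rewrite (le_trans (ler_normD _ _))// addrCA lerD2l (le_trans s4)//.
      by rewrite lerD2r ler_pM2l// lerD2r.
  have [ta tb' dt] : [/\ a < t, t < b & is_derive t 1 g 0].
    have ta : t != a by apply/eqP => E; apply: tN; right; left.
    have tb' : t != b by apply/eqP => E; apply: tN; right; right.
    have ta' : a < t by rewrite lt_neqAle eq_sym ta.
    have tb'' : t < b by rewrite lt_neqAle tb'.
    split => //; apply: contrapT => nd; apply: tN; left => /= H; apply: nd.
    by apply: H; rewrite ta'.
  have [r r0 H] := is_derive_slope dt e0.
  exists r => // x y ax yb xt ty trx ytr [k [s [s1 s2 s3 s4]]].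
  have xy := le_trans xt ty.
  exists k, s; split => //.
  - by move=> i; have [? s2x ?] := s1 i; split => //; exact: le_trans xy.
  - by rewrite (le_trans s3)// m_le.
  - have := H x; have := H y; rewrite !mul0r !subr0.
    have -> : `|y - t| = y - t by rewrite ger0_norm ?subr_ge0.
    have -> : `|x - t| = t - x by rewrite ler0_norm ?opprB ?subr_le0.
    move=> Hy Hx.
    rewrite (_ : g y - g a = (g y - g t) - (g x - g t) + (g x - g a)); last by ring.
    rewrite (le_trans (ler_normD _ _))//.
    apply: le_trans (_ : (e * (y - t) + e * (t - x)) + (e * (x - a) + \sum_i `|g (s i).2 - g (s i).1|) <= _).
      rewrite lerD// (le_trans (ler_normB _ _))// lerD//.
        by apply: Hy; lra.
      by apply: Hx; lra.
    by rewrite addrA lerD2r -!mulrDr ler_pM2l//; lra.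
apply: Pb.
(* The step at the supremum [c] of this set leads strictly beyond [c] unless it stops at [b]. *)
pose S := [set x | [/\ a <= x, x <= b & P x]].
have Sa : S a by split.
have hS : has_sup S by split; [exists a | exists b => x [_ xb _]].
pose c := sup S.
have ac : a <= c by exact: sup_upper_bound hS _ Sa.
have cb : c <= b by apply: ge_sup => [|x [_ xb _]]; [exists a|].
have [|r r0 Hr] := step c; first by rewrite ac cb.
have [x [ax xb Px] cx] := sup_adherent r0 hS.
have xc : x <= c by exact: sup_upper_bound hS _ (And3 ax xb Px).
pose y := Num.min b (c + r / 2).
have cy : c <= y by rewrite /y le_min cb/=; lra.
have yb : y <= b by rewrite /y ge_min lexx.
have yr : y < c + r by rewrite /y gt_min; apply/orP; right; lra.
have Py : P y by apply: (Hr x y).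
have yc : y <= c by apply: sup_upper_bound hS _ (And3 (le_trans ac cy) yb Py).
suff <- : y = b by [].
have [bc|cb'] := leP b (c + r / 2); first by rewrite /y (min_l bc).
by move: yc; rewrite /y (min_r (ltW cb')); lra.
Qed.
End AbsoluteContinuityCriteria.

(** * The fundamental theorem of calculus for absolutely continuous functions *)

Section AC3.
Context {R : realType}.
Notation leb := (@lebesgue_measure R).
Implicit Types (a b e : R) (D : set R) (f g : R -> R).
Lemma aeS d (T : measurableType d) (mu : {measure set T -> \bar R})
    (P Q : T -> Prop) : (forall x, P x -> Q x) ->
  {ae mu, forall x, P x} -> {ae mu, forall x, Q x}.
Proof. exact: (@filterS _ _ (ae_filter_ringOfSetsType mu)). Qed.

Lemma aeS2 d (T : measurableType d) (mu : {measure set T -> \bar R})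
    (P1 P2 Q : T -> Prop) : (forall x, P1 x -> P2 x -> Q x) ->
  {ae mu, forall x, P1 x} -> {ae mu, forall x, P2 x} -> {ae mu, forall x, Q x}.
Proof. exact: (@filterS2 _ _ (ae_filter_ringOfSetsType mu)). Qed.

Definition prim a (f : R -> R) (x : R) : R := \int[leb]_(s in `[a, x]) f s.

Lemma prim_id a f : prim a f a = 0.
Proof. by rewrite /prim set_itv1 Rintegral_set1. Qed.

Lemma integrable_itvS a b c d f : a <= c -> d <= b ->
  leb.-integrable `[a, b] (EFin \o f) -> leb.-integrable `[c, d] (EFin \o f).
Proof.
move=> ac db; apply: integrableS => // x /=; rewrite !in_itv/= => /andP[cx xd].
by rewrite (le_trans ac cx) (le_trans xd db).
Qed.

Lemma primB a b f c d : leb.-integrable `[a, b] (EFin \o f) ->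
  a <= c -> c <= d -> d <= b -> prim a f d - prim a f c = \int[leb]_(s in `]c, d]) f s.
Proof.
move=> intf ac cd db.
by rewrite /prim Rintegral_itvB ?bnd_simp//; exact: integrable_itvS intf.
Qed.

Lemma prim_shift a b f c d : leb.-integrable `[a, b] (EFin \o f) ->
  a <= c -> c <= d -> d <= b -> prim a f d = prim a f c + prim c f d.
Proof.
move=> intf ac cd db.
rewrite -[prim a f d](subrK (prim a f c)) (primB intf)// addrC; congr (_ + _).
have intf' := integrable_itvS ac db intf.
have := primB intf' (lexx c) cd (lexx d).
by rewrite prim_id subr0.
Qed.

(** Lebesgue's differentiation theorem for [f] extended by zero; near an interior point both
    functions have the same primitive from [a]. *)
Lemma prim_derive a b f : a <= b -> leb.-integrable `[a, b] (EFin \o f) ->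
  {ae leb, forall t, a < t < b -> is_derive t 1 (prim a f) (f t)}.
Proof.
move=> ab intf; pose fab := f \_ `[a, b].
have intfab : leb.-integrable setT (EFin \o fab).
  by rewrite -restrict_EFin; apply/integrable_restrict => //=; rewrite setTI.
have := lebesgue_differentiation (open_integrable_locally openT intfab).
apply: aeS => t lt /andP[at_ tb].
have iab : leb.-integrable `[a, b] (EFin \o fab) by exact: integrableS intfab.
have at1 : (BLeft a < BRight t)%E by rewrite lte_fin.
have [/= dF F'] := FTC1_lebesgue_pt tb iab at1 lt.
have -> : f t = fab t by rewrite /fab patchE mem_set//= in_itv/= !ltW.
rewrite -F' derive1E.
apply: (@near_eq_is_derive _ _ _ (fun y : R => \int[leb]_(s in `[a, y]) fab s)); last exact: DeriveDef.
near=> y; apply: eq_Rintegral => s; rewrite inE /= in_itv/= => /andP[as_ sy].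
rewrite /fab patchE mem_set//= in_itv/= as_ (le_trans sy)// ltW//.
near: y; exact: lt_nbhsl.
Unshelve. all: by end_near. Qed.

(** The integral of [|f|] over a set is small with the measure of the set. The half-open versions
    [B i] of the test intervals are disjoint, so their union has measure below [d] and the
    increments add up to at most one integral. *)
Lemma abs_continuous_prim a b f : leb.-integrable `[a, b] (EFin \o f) ->
  abs_continuous `[a, b] (prim a f).
Proof.
move=> intf; pose fab := f \_ `[a, b].
have intfab : leb.-integrable setT (EFin \o fab).
  by rewrite -restrict_EFin; apply/integrable_restrict => //=; rewrite setTI.
move=> e e0; have [d [d0 H]] := integral_normr_continuous intfab e0.
exists d => // k s sD sd ss.
pose B i := `](s i).1, (s i).2]%classic : set R.
have tB : trivIset [set` index_enum 'I_k] B.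
  move=> i j _ _ [z [/=]]; rewrite /B/= !in_itv/= => /andP[iz zi] /andP[jz zj].
  apply/eqP/negP => /negP ij.
  have [ij'|ji'] := sd _ _ ij.
    by move: (lt_le_trans jz (le_trans zi ij')); rewrite ltxx.
  by move: (lt_le_trans iz (le_trans zj ji')); rewrite ltxx.
have mB i : measurable (B i) by exact: measurable_itv.
pose A := \big[setU/set0]_(i < k) B i.
have mA : measurable A by exact: bigsetU_measurable.
have leA : (leb A < d%:E)%E.
  rewrite -[leb A]mul1e -integral_cst//= /A.
  rewrite [X in (X < _)%E]ge0_integral_bigsetU//; last exact: index_enum_uniq.
  apply: le_lt_trans (_ : \sum_(i < k) ((s i).2 - (s i).1)%:E < _)%E; last by rewrite sumEFin lte_fin.
  apply: lee_sum => i _; rewrite integral_cst; last exact: mB.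
  rewrite mul1e.
  apply: le_trans (_ : leb `](s i).1, (s i).2] <= _)%E => //.
  rewrite lebesgue_measure_itv/= lte_fin.
  by have [_ _ le] := sD i; case: ifP => // _; rewrite lee_fin subr_ge0.
apply: le_lt_trans (H _ mA leA).
have nint D : measurable D -> leb.-integrable D (EFin \o (fun x => `|fab x|)).
  move=> mD; apply: integrableS (integrable_norm intfab) => //.
rewrite /Rintegral [X in fine X]integral_bigsetU_EFin//=; last 2 first.
  exact: index_enum_uniq.
  by case/integrableP : (nint _ mA).
rewrite -sum_fine; last first.
  move=> i _; apply: integrable_fin_num; first exact: mB.
  by have := nint _ (mB i).
apply: ler_sum => i _; have [] := sD i; rewrite /= !in_itv/= => /andP[ai ib] /andP[ai' ib'] le.
rewrite (primB intf)//.
rewrite (_ : Rintegral _ _ _ = \int[leb]_(t in B i) fab t).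
  apply: le_normr_Rintegral; first exact: mB.
  by apply: integrableS intfab => //; exact: mB.
apply: eq_Rintegral => z; rewrite inE/= in_itv/= => /andP[iz zi].
by rewrite /fab patchE mem_set//= in_itv/= (le_trans ai (ltW iz)) (le_trans zi).
Qed.

(** The difference of [g] and the primitive of [f] is absolutely continuous with derivative zero
    almost everywhere, hence constant. *)
Lemma abs_continuous_FTC a b g f : a <= b -> abs_continuous `[a, b] g ->
  leb.-integrable `[a, b] (EFin \o f) ->
  {ae leb, forall t, a < t < b -> is_derive t 1 g (f t)} ->
  g b = g a + prim a f b.
Proof.
move=> ab acg intf dg.
have := abs_continuous_derive0 ab (abs_continuousB acg (abs_continuous_prim intf)).
rewrite prim_id subr0 => <-; first by rewrite subrK.
apply: aeS2 dg (prim_derive ab intf) => t H1 H2 tab.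
by rewrite -(subrr (f t)); apply: is_deriveB; [exact: H1|exact: H2].
Qed.
End AC3.

(** * One-sided limits and extension to the closed interval *)

Section AC4.
Context {R : realType}.
Notation leb := (@lebesgue_measure R).
Implicit Types (a b e : R) (D : set R) (f g : R -> R).
Lemma cvg_at_right_epsP f a l : f x @[x --> a^'+] --> l <->
  forall e, 0 < e -> exists2 r, 0 < r & forall s, a < s < a + r -> `|l - f s| < e.
Proof.
split=> [/cvgrPdist_lt fl e /fl|fl].
  rewrite near_withinE => /nbhs_ballP[r /= r0 H]; exists r => // s /andP[as_ sr].
  apply: H => //=; rewrite /ball/= ltr_distlC; apply/andP; split; lra.
apply/cvgrPdist_lt => e /fl[r r0 H]; rewrite near_withinE; apply/nbhs_ballP.
exists r => // s /=; rewrite /ball/= ltr_distlC => /andP[_ sr] as_.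
by apply: H; rewrite as_.
Qed.

Lemma cvg_at_left_epsP f a l : f x @[x --> a^'-] --> l <->
  forall e, 0 < e -> exists2 r, 0 < r & forall s, a - r < s < a -> `|l - f s| < e.
Proof.
split=> [/cvgrPdist_lt fl e /fl|fl].
  rewrite near_withinE => /nbhs_ballP[r /= r0 H]; exists r => // s /andP[rs sa].
  apply: H => //=; rewrite /ball/= ltr_distlC; apply/andP; split; lra.
apply/cvgrPdist_lt => e /fl[r r0 H]; rewrite near_withinE; apply/nbhs_ballP.
exists r => // s /=; rewrite /ball/= ltr_distlC => /andP[rs _] sa.
by apply: H; rewrite sa rs.
Qed.

Lemma cvg_bigsum (T I : Type) (F : set_system T) (FF : Filter F) (r : seq I)
    (f : I -> T -> R) (l : I -> R) : (forall i, f i x @[x --> F] --> l i) ->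
  \sum_(i <- r) f i x @[x --> F] --> \sum_(i <- r) l i.
Proof.
move=> fl; elim: r => [|i r IH].
  by under eq_fun do rewrite big_nil; rewrite big_nil; exact: cvg_cst.
by under eq_fun do rewrite big_cons; rewrite big_cons; exact: cvgD.
Qed.

Definition itv_ext a b (ga gb : R) g (t : R) : R :=
  if t <= a then ga else if b <= t then gb else g t.

(** Points of [[a, b]] are pushed into []a, b[] by clamping them to [[a + h, b - h]]. Clamping is
    monotone and does not increase lengths, so the modulus known on the open interval applies for
    every small [h], and [h] tends to 0. *)
Lemma abs_continuous_ext a b ga gb g : a < b -> abs_continuous `]a, b[ g ->
  g x @[x --> a^'+] --> ga -> g x @[x --> b^'-] --> gb ->
  abs_continuous `[a, b] (itv_ext a b ga gb g).
Proof.
move=> ab acg gar gbl e e0.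
have [d d0 H] := acg _ (divr_gt0 e0 (ltr0n _ 2)).
exists d => // k s sD sd ss.
pose cl (h t : R) := Num.max (a + h) (Num.min (b - h) t).
have cl_lim t : a <= t <= b -> g (cl h t) @[h --> 0^'+] --> itv_ext a b ga gb g t.
  move=> /andP[at_ tb]; apply/cvg_at_right_epsP => e' e'0.
  pose r0 := (b - a) / 2; have r00 : 0 < r0 by rewrite divr_gt0// subr_gt0.
  rewrite /itv_ext; have [ta|at1] := leP t a.
    have [r r1 Hr] := (cvg_at_right_epsP _ _ _).1 gar _ e'0.
    exists (Num.min r r0); first by rewrite lt_min r1 r00.
    move=> h; rewrite add0r lt_min /r0 => /and3P[h0 hr hr0].
    have -> : cl h t = a + h.
      by rewrite /cl max_l// ge_min; apply/orP; right; lra.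
    by apply: Hr; apply/andP; split; lra.
  have [bt|tb1] := leP b t.
    have [r r1 Hr] := (cvg_at_left_epsP _ _ _).1 gbl _ e'0.
    exists (Num.min r r0); first by rewrite lt_min r1 r00.
    move=> h; rewrite add0r lt_min /r0 => /and3P[h0 hr hr0].
    have -> : cl h t = b - h.
      rewrite /cl (_ : Num.min _ _ = b - h); last by rewrite min_l//; lra.
      by rewrite max_r//; lra.
    by apply: Hr; apply/andP; split; lra.
  exists (Num.min (t - a) (b - t)); first by rewrite lt_min !subr_gt0 at1.
  move=> h; rewrite add0r lt_min => /and3P[h0 h1 h2].
  rewrite /cl (_ : Num.min _ _ = t); last by rewrite min_r//; lra.
  by rewrite max_r ?subrr ?normr0//; lra.
(* A limit in [h] preserves only the non-strict bound, which is why the modulus was taken at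
   [e / 2]. *)
suff : \sum_i `|itv_ext a b ga gb g (s i).2 - itv_ext a b ga gb g (s i).1| <= e / 2.
  by move/le_lt_trans; apply; lra.
apply: (@cvgr_to_le R (0^'+) _ _ (fun h => \sum_i `|g (cl h (s i).2) - g (cl h (s i).1)|)).
  apply: cvg_bigsum => i; apply: cvg_norm; have [] := sD i.
  by rewrite /= !in_itv/= => i1 i2 _; apply: cvgB; exact: cl_lim.
have cl_in h t : 0 < h -> h < (b - a) / 2 -> a < cl h t < b.
  move=> h0 hr; rewrite /cl lt_max gt_max gt_min; apply/andP; split.
    by apply/orP; left; lra.
  by apply/andP; split; [lra|apply/orP; left; lra].
have cl_mono h x y : 0 < h -> h < (b - a) / 2 -> x <= y ->
    0 <= cl h y - cl h x <= y - x.
  move=> h0 hr xy; rewrite /cl.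
  have [|] := leP (b - h) x; have [|] := leP (b - h) y; try lra.
  - move=> b1 b2; rewrite max_r; last by lra.
    by have [|] := leP (a + h) x; move=> ?; apply/andP; split; lra.
  - move=> b1 b2; have [|] := leP (a + h) x; have [|] := leP (a + h) y => ? ?;
    by apply/andP; split; lra.
near=> h; apply/ltW; have h0 : 0 < h by near: h; exact: nbhs_right_gt.
have hr : h < (b - a) / 2.
  by near: h; apply: nbhs_right_lt; rewrite divr_gt0// subr_gt0.
apply: (H k (fun i => (cl h (s i).1, cl h (s i).2))).
- move=> i; have [_ _ le] := sD i.
  by split; rewrite /= ?in_itv/= ?cl_in// -subr_ge0; case/andP: (cl_mono h _ _ h0 hr le).
- move=> i j /sd [] le; [left|right];
  by rewrite /= -subr_ge0; case/andP: (cl_mono h _ _ h0 hr le).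
- apply: le_lt_trans ss; apply: ler_sum => i _; have [_ _ le] := sD i.
  by case/andP: (cl_mono h _ _ h0 hr le).
Unshelve. all: by end_near. Qed.

Lemma itv_ext_oo a b ga gb g t : a < t -> t < b -> itv_ext a b ga gb g t = g t.
Proof. by move=> at_ tb; rewrite /itv_ext leNgt at_ /= leNgt tb. Qed.

(** The starting value is the right limit [ga], which differs from [g a] where a solution jumps; at
    [b] the function is continuous from the left, so [t = b] is included. *)
Lemma abs_continuous_oo_FTC a b ga g f : a < b -> abs_continuous `]a, b[ g ->
  g x @[x --> a^'+] --> ga -> g x @[x --> b^'-] --> g b ->
  leb.-integrable `[a, b] (EFin \o f) ->
  {ae leb, forall t, a < t < b -> is_derive t 1 g (f t)} ->
  forall t, a < t <= b -> g t = ga + prim a f t.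
Proof.
move=> ab acg gar gbl intf dg t /andP[at_ tb].
have acx := abs_continuous_ext ab acg gar gbl.
have := @abs_continuous_FTC R a t (itv_ext a b ga (g b) g) f (ltW at_).
have -> : itv_ext a b ga (g b) g a = ga by rewrite /itv_ext lexx.
have -> : itv_ext a b ga (g b) g t = g t.
  rewrite /itv_ext leNgt at_/=; case: ifP => // bt.
  by congr g; apply/eqP; rewrite eq_le bt.
apply.
- apply: abs_continuousS acx => x /=; rewrite !in_itv/= => /andP[-> xt].
  exact: le_trans tb.
- exact: integrable_itvS intf.
- apply: aeS dg => x H /andP[ax xt]; have xb := lt_le_trans xt tb.
  apply: (@near_eq_is_derive _ _ _ g); last by apply: H; rewrite ax.
  near=> y; rewrite itv_ext_oo//; near: y; [exact: lt_nbhsr|exact: lt_nbhsl].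
Unshelve. all: by end_near. Qed.
End AC4.

(** * Scalar equations with jumps in integral form *)

Section ScalarJump.
Context {R : realType} (N : nat) (tk : nat -> R) (T : R).
Hypotheses (tk0 : tk 0 = 0) (tkT : tk N.+1 = T).
Hypothesis tk_lt : forall k : nat, (k <= N)%N -> tk k < tk k.+1.
Notation leb := (@lebesgue_measure R).
Implicit Types (F z x h g : R -> R) (J : 'I_N -> R).

Lemma knot_le j k : (j <= k)%N -> (k <= N.+1)%N -> tk j <= tk k.
Proof.
elim: k => [|k IH]; first by rewrite leqn0 => /eqP ->.
rewrite leq_eqVlt => /predU1P[->//|jk kN].
by rewrite (le_trans (IH jk (ltnW kN)))// ltW// tk_lt.
Qed.

Lemma knot_ge0 k : (k <= N.+1)%N -> 0 <= tk k.
Proof. by move=> kN; rewrite -tk0 knot_le. Qed.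

Lemma knot_leT k : (k <= N.+1)%N -> tk k <= T.
Proof. by move=> kN; rewrite -tkT knot_le. Qed.

Lemma knot_inT (i : 'I_N) : 0 <= tk i.+1 <= T.
Proof. by rewrite knot_ge0 ?knot_leT// ltnS ltnW. Qed.

Lemma period_gt0 : 0 < T.
Proof. by rewrite -tk0 -tkT (lt_le_trans (tk_lt (leq0n N)))// knot_le. Qed.

Lemma knot_piece t : 0 < t <= T -> exists2 k, (k <= N)%N & tk k < t <= tk k.+1.
Proof.
move=> /andP[t0 tT]; have : t <= tk N.+1 by rewrite tkT.
elim: (N) => [|k IH] tk1.
  by exists 0; rewrite // tk0 t0.
have [tk2|tk2] := leP t (tk k.+1).
  by have [j jk jt] := IH tk2; exists j => //; exact: leqW.
by exists k.+1; rewrite ?tk2.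
Qed.

(** Only the knots strictly before [t] count: this makes the step function continuous from the left,
    like the solutions. *)
Definition Jsum (V : nmodType) (J : 'I_N -> V) (t : R) : V :=
  \sum_(i < N | tk i.+1 < t) J i.

Lemma Jsum_piece (V : nmodType) (J : 'I_N -> V) k t : (k <= N)%N ->
  tk k < t <= tk k.+1 -> Jsum J t = \sum_(i < N | (i < k)%N) J i.
Proof.
move=> kN /andP[kt tk1]; apply: eq_bigl => i.
have [ik|ki] := ltnP i k.
  by rewrite (le_lt_trans _ kt)// knot_le// (leq_trans kN).
by apply/negbTE; rewrite -leNgt (le_trans tk1)// knot_le// ltnS ltnW.
Qed.

Lemma Jsum0 (V : nmodType) (J : 'I_N -> V) : Jsum J 0 = 0.
Proof.
rewrite /Jsum big_pred0// => i; apply/negbTE.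
by rewrite -leNgt knot_ge0// ltnS ltnW.
Qed.

Definition jump_sol F J z : Prop :=
  [/\ forall k : nat, (k <= N)%N -> abs_continuous `]tk k, tk k.+1[ z /\
        z t @[t --> (tk k.+1)^'-] --> z (tk k.+1),
      z t @[t --> 0^'+] --> z 0,
      {ae leb, forall t, 0 < t < T -> is_derive t 1 z (F t)}
    & forall i : 'I_N, z t @[t --> (tk i.+1)^'+] --> z (tk i.+1) + J i].

(** A single identity on the closed interval carries the equation, the jumps and the one-sided
    continuity conditions. *)
Definition int_sol F J z : Prop :=
  forall t, 0 <= t <= T -> z t = z 0 + Jsum J t + prim 0 F t.

Lemma sum_ordS_lt (V : nmodType) (J : 'I_N -> V) k (kN : (k < N)%N) :
  \sum_(i < N | (i < k.+1)%N) J i = \sum_(i < N | (i < k)%N) J i + J (Ordinal kN).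
Proof.
rewrite [LHS](bigD1 (Ordinal kN))//= addrC; congr (_ + _); apply: eq_bigl => i.
by rewrite ltnS -(inj_eq val_inj)/= ltn_neqAle andbC.
Qed.

(** Between two knots the fundamental theorem applies with the right limit at the left knot as
    starting value; induction over the pieces accumulates the jumps. *)
Lemma jump_sol_int F J z : leb.-integrable `[0, T] (EFin \o F) ->
  jump_sol F J z -> int_sol F J z.
Proof.
move=> intF [zk z0 dz zJ] t /andP[t0 tT].
have [->|tn0] := eqVneq t 0; first by rewrite Jsum0 prim_id !addr0.
have {}t0 : 0 < t by rewrite lt_neqAle eq_sym tn0.
suff H k : (k <= N)%N -> forall t, tk k < t <= tk k.+1 ->
    z t = z 0 + \sum_(i < N | (i < k)%N) J i + prim 0 F t.
  have [|k kN tk1] := @knot_piece t; first by rewrite t0.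
  by rewrite (Jsum_piece _ kN)// (H k).
have piece j (zc : R) : (j <= N)%N -> z s @[s --> (tk j)^'+] --> zc ->
    forall t, tk j < t <= tk j.+1 -> z t = zc + prim (tk j) F t.
  move=> jN zcl; have [acz zl] := zk _ jN.
  apply: (abs_continuous_oo_FTC (tk_lt jN)) => //.
    by apply: integrable_itvS intF; [rewrite knot_ge0// ltnW|rewrite knot_leT].
  apply: aeS dz => s H /andP[js sj]; apply: H.
  rewrite (le_lt_trans _ js) ?knot_ge0 ?(leqW jN)//=.
  by rewrite (lt_le_trans sj)// knot_leT.
have pshift j s : (j <= N)%N -> tk j < s <= tk j.+1 ->
    prim 0 F s = prim 0 F (tk j) + prim (tk j) F s.
  move=> jN /andP[js sj]; apply: (prim_shift intF); rewrite ?knot_ge0 ?(leqW jN)//.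
    exact: ltW.
  by rewrite (le_trans sj)// knot_leT.
elim: k => [|k IH] kN s sk.
  rewrite big_pred0// addr0 (pshift 0)// tk0 prim_id add0r -tk0.
  by apply: piece => //; rewrite tk0.
have /piece -> // := zJ (Ordinal kN).
rewrite (sum_ordS_lt J kN) (pshift k.+1)//= (IH (ltnW kN)) ?lexx ?andbT ?tk_lt 1?ltnW//.
ring.
Qed.

(** On each piece [Jsum] is constant, so [z] is a constant plus a primitive there; the knots form a
    null set. *)
Lemma int_sol_jump F J z : leb.-integrable `[0, T] (EFin \o F) ->
  int_sol F J z -> jump_sol F J z.
Proof.
move=> intF zE.
have acP := abs_continuous_prim intF.
have T0 := period_gt0.
have pc u : 0 <= u <= T -> forall e, 0 < e -> exists2 r, 0 < r &
    forall s, 0 <= s <= T -> `|s - u| < r -> `|prim 0 F u - prim 0 F s| < e.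
  move=> uT e e0; have [r r0 H] := abs_continuous_unif (@interval_is_interval _ `[0, T]) acP e0.
  by exists r => // s sT su; rewrite distrC; apply: H; rewrite //= in_itv.
have zk k t : (k <= N)%N -> tk k < t <= tk k.+1 ->
    z t = z 0 + \sum_(i < N | (i < k)%N) J i + prim 0 F t.
  move=> kN /[dup] tk1 /andP[kt tk2]; rewrite zE ?(Jsum_piece _ kN)//.
  rewrite (le_trans tk2) ?knot_leT// andbT.
  by rewrite (le_trans _ (ltW kt))// knot_ge0// leqW.
have rlim k : (k <= N)%N -> z s @[s --> (tk k)^'+] -->
    z 0 + \sum_(i < N | (i < k)%N) J i + prim 0 F (tk k).
  move=> kN; apply/cvg_at_right_epsP => e e0.
  have kT : 0 <= tk k <= T by rewrite knot_ge0 ?knot_leT// leqW.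
  have [r r0 H] := pc _ kT _ e0.
  exists (Num.min r (tk k.+1 - tk k)); first by rewrite lt_min r0 subr_gt0 tk_lt.
  move=> s; rewrite -ltrBlDl lt_min => /and3P[ks sr sk].
  rewrite (zk k s)//; last by rewrite ks /=; lra.
  rewrite opprD addrACA subrr add0r; apply: H; last by rewrite gtr0_norm ?subr_gt0.
  have := knot_leT (k := k.+1) kN; have := knot_ge0 (leqW kN) => *.
  by apply/andP; split; lra.
split.
- move=> k kN; split.
    apply: (@eq_abs_continuous _ _ (fun t => (z 0 + \sum_(i < N | (i < k)%N) J i) + prim 0 F t)).
      move=> t; rewrite inE/= in_itv/= => /andP[kt tk1].
      by rewrite (zk k t)// kt ltW.
    apply: abs_continuousD.
      by apply: (abs_continuous_lipschitz ltr01) => x y _ _; rewrite subrr normr0 mul1r.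
    apply: abs_continuousS acP => t /=; rewrite !in_itv/= => /andP[kt tk1].
    have := knot_leT (k := k.+1) kN; have := knot_ge0 (leqW kN) => *.
    by apply/andP; split; lra.
  apply/cvg_at_left_epsP => e e0.
  have kT : 0 <= tk k.+1 <= T by rewrite knot_ge0 ?knot_leT.
  have [r r0 H] := pc _ kT _ e0.
  exists (Num.min r (tk k.+1 - tk k)); first by rewrite lt_min r0 subr_gt0 tk_lt.
  have := tk_lt kN => kk.
  move=> s; rewrite ltrBlDr -ltrBlDl lt_min => /andP[/andP[rs ks] sk].
  rewrite (zk k s kN); last by apply/andP; split; lra.
  rewrite (zk k (tk k.+1) kN); last by rewrite kk lexx.
  rewrite opprD addrACA subrr add0r; apply: H; last by rewrite ltr0_norm ?subr_lt0 ?opprB.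
  have := knot_leT (k := k.+1) kN; have := knot_ge0 (leqW kN) => *.
  by apply/andP; split; lra.
- have := rlim 0 (leq0n _); rewrite tk0 big_pred0// prim_id !addr0; exact.
- have nk : {ae leb, forall t, ~ (exists2 k, (k <= N.+1)%N & t = tk k)}.
    suff : leb.-negligible (\bigcup_k [set tk k]).
      by apply: negligibleS => t /contrapT[k kN ->]; exists k.
    apply: negligible_bigcup => k; apply/negligibleP => //.
    exact: lebesgue_measure_set1.
  apply: aeS2 nk (prim_derive (ltW T0) intF) => t nt dt /[dup] tT /andP[t0 t1].
  have [|k kN /andP[kt]] := @knot_piece t; first by rewrite t0 ltW.
  rewrite le_eqVlt => /predU1P[tE|tk1]; first by case: nt; exists k.+1.
  apply: (@near_eq_is_derive _ _ _ (fun t => (z 0 + \sum_(i < N | (i < k)%N) J i) + prim 0 F t)).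
    near=> s; rewrite (zk k s)//; apply/andP; split; last apply: ltW; near: s.
      exact: lt_nbhsr.
    exact: lt_nbhsl.
  by rewrite -[F t]add0r; apply: is_deriveD; exact: dt.
- move=> i; have := rlim i.+1 (ltn_ord i).
  rewrite (sum_ordS_lt _ (ltn_ord i)).
  rewrite (zk i (tk i.+1)) ?lexx ?andbT ?tk_lt 1?ltnW// ?ltn_ord//.
  congr (_ --> _); rewrite -!addrA; congr (_ + (_ + _)); rewrite addrC; congr (_ + J _).
  exact: val_inj.
Unshelve. all: by end_near. Qed.

(** Each piece extends continuously to a closed interval and is bounded there. The right-hand sides
    of the systems contain the unknowns, and it is this boundedness that makes them integrable. *)
Lemma jump_sol_bounded F J z : jump_sol F J z ->
  measurable_fun `[0, T] z /\ exists K : R, forall t, 0 <= t <= T -> `|z t| <= K.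
Proof.
move=> [zk z0 _ zJ].
have piece j (zc : R) : (j <= N)%N -> z s @[s --> (tk j)^'+] --> zc ->
    exists K, forall t, tk j < t <= tk j.+1 -> `|z t| <= K.
  move=> jN zcl; have [acz zl] := zk _ jN.
  have acx := abs_continuous_ext (tk_lt jN) acz zcl zl.
  have [K HK] := within_continuous_bounded (abs_continuous_within (@interval_is_interval _ `[_, _]) acx).
  exists K => t /andP[jt tj]; have := HK t; rewrite (ltW jt) tj => /(_ isT).
  rewrite /itv_ext (leNgt t (tk j)) jt /=; case: ifP => // tj'.
  by have -> // : t = tk j.+1; apply/eqP; rewrite eq_le tj.
suff H k : (k <= N.+1)%N -> measurable_fun `[0, tk k] z /\
    exists K : R, forall t, 0 <= t <= tk k -> `|z t| <= K.
  by rewrite -tkT; exact: H.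
elim: k => [|k IH] kN.
  rewrite tk0 set_itv1; split; first exact: measurable_fun_set1.
  by exists `|z 0| => t; rewrite -eq_le => /eqP <-.
have [mz [K HK]] := IH (ltnW kN).
have kk := tk_lt (kN : (k <= N)%N).
split.
  have -> : `[0, tk k.+1]%classic = `[0, tk k] `|` `]tk k, tk k.+1[ `|` [set tk k.+1].
    have k0 := knot_ge0 (ltnW kN).
    apply/seteqP; split => t /=; rewrite !in_itv/=.
      move=> /andP[t0 tk1]; have [tk2|tk2] := leP t (tk k); first by left; left; rewrite t0.
      move: tk1; rewrite le_eqVlt => /predU1P[->|tk1]; first by right.
      by left; right; rewrite tk1.
    move=> [[/andP[-> /= tk1]|/andP[tk1 tk2]]|->]; last by rewrite lexx (le_trans k0)// ltW.
      by rewrite (le_trans tk1)// ltW.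
    by rewrite (le_trans k0 (ltW tk1)) ltW.
  apply/measurable_funU => //; first exact: measurableU.
  split; last exact: measurable_fun_set1.
  apply/measurable_funU => //; split => //.
  have [acz _] := zk _ (kN : (k <= N)%N).
  apply: measurable_realfun.subspace_continuous_measurable_fun => //.
  exact: abs_continuous_within (@interval_is_interval _ `]_, _[) acz.
have [K' HK'] : exists K, forall t, tk k < t <= tk k.+1 -> `|z t| <= K.
  case: (k) kN => [|k'] kN; first by apply: (piece _ (z 0)); rewrite ?tk0.
  exact: piece _ (zJ (Ordinal (kN : (k' < N)%N))).
exists (Num.max K K') => t /andP[t0 tk1]; rewrite le_max.
have [tk2|tk2] := leP t (tk k); first by rewrite HK// t0.
by rewrite HK' ?orbT// tk2.
Qed.

End ScalarJump.

(** * Integrability and integrals of real functions *)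

Section IntegralTools.
Context {R : realType} {d : measure_display} {T : measurableType d}.
Variables (mu : {measure set T -> \bar R}) (D : set T).
Hypothesis mD : measurable D.
Implicit Types f g : T -> R.
Notation intg f := (mu.-integrable D (EFin \o f)).

Lemma integrable_meas f : intg f -> measurable_fun D f.
Proof. by case/integrableP => /measurable_EFinP. Qed.

Lemma integrable_ae_le f g : measurable_fun D f -> intg g ->
  {ae mu, forall x, D x -> `|f x| <= g x} -> intg f.
Proof.
move=> mf ig fg; have mg := integrable_meas ig.
apply/integrableP; split; first exact/measurable_EFinP.
case/integrableP : (ig) => _; apply: le_lt_trans.
apply: ae_ge0_le_integral => //.
- by do 2 apply: measurableT_comp => //.
- by do 2 apply: measurableT_comp => //.
- apply: aeS fg => x fg Dx; rewrite /= lee_fin (le_trans (fg Dx))//.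
  exact: ler_norm.
Qed.

Lemma ae_le_normr_Rintegral f g : measurable_fun D f -> intg g ->
  (forall x, D x -> 0 <= g x) ->
  {ae mu, forall x, D x -> `|f x| <= g x} ->
  `|\int[mu]_(x in D) f x| <= \int[mu]_(x in D) g x.
Proof.
move=> mf ig g0 fg; have ifi := integrable_ae_le mf ig fg.
apply: le_trans (le_normr_Rintegral mD ifi) _.
apply: fine_le.
- by apply: integrable_fin_num => //; exact: integrable_norm.
- exact: integrable_fin_num.
apply: ae_ge0_le_integral => //.
- by do 2 apply: measurableT_comp => //.
- by case/integrableP : ig.
Qed.

Lemma ae_eq_Rintegral f g : measurable_fun D f -> measurable_fun D g ->
  {ae mu, forall x, D x -> f x = g x} ->
  \int[mu]_(x in D) f x = \int[mu]_(x in D) g x.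
Proof.
move=> mf mg fg; congr fine; apply: ae_eq_integral => //.
- exact/measurable_EFinP.
- exact/measurable_EFinP.
- by apply: aeS fg => x fg Dx; rewrite fg.
Qed.

Lemma ae_eq_integrable f g : measurable_fun D g ->
  {ae mu, forall x, D x -> f x = g x} -> intg f -> intg g.
Proof.
move=> mg fg /integrable_norm ig; apply: integrable_ae_le mg ig _.
by apply: aeS fg => x fg Dx /=; rewrite fg.
Qed.

Lemma integrable_bddM f g (K : R) : intg f -> measurable_fun D g ->
  (forall x, D x -> `|g x| <= K) -> intg (fun x => f x * g x).
Proof.
move=> fi mg gK.
apply: (@integrable_ae_le _ (fun x => K * `|f x|)).
- by apply: measurable_funM => //; exact: integrable_meas.
- by apply: (integrableZl mD K (integrable_norm fi)).
- by apply: aeW => x Dx; rewrite normrM mulrC ler_wpM2r// gK.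
Qed.

Lemma integrable_bdd g (K : R) : (mu D < +oo)%E -> measurable_fun D g ->
  (forall x, D x -> `|g x| <= K) -> intg g.
Proof.
move=> fD mg gK; apply: measurable_bounded_integrable => //.
exists K; split; first exact: num_real.
by move=> y Ky x Dx /=; apply: le_trans (gK _ Dx) (ltW Ky).
Qed.

Lemma integrable_sumR (I : Type) (r : seq I) (P : pred I) (f : I -> T -> R) :
  (forall i, P i -> intg (f i)) -> intg (fun x => \sum_(i <- r | P i) f i x).
Proof.
move=> fi; rewrite (_ : _ \o _ = (fun x => \sum_(i <- r | P i) (f i x)%:E)%E).
  exact: integrable_sum.
by apply/funext => x /=; rewrite sumEFin.
Qed.

Lemma Rintegral_sum (I : Type) (r : seq I) (P : pred I) (f : I -> T -> R) :
  (forall i, P i -> intg (f i)) ->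
  \int[mu]_(x in D) (\sum_(i <- r | P i) f i x) =
  \sum_(i <- r | P i) \int[mu]_(x in D) f i x.
Proof.
move=> fi; elim: r => [|i r IH].
  rewrite big_nil; under eq_Rintegral do rewrite big_nil.
  by rewrite /Rintegral integral0.
rewrite big_cons -IH; under eq_Rintegral do rewrite big_cons.
by case: ifP => // Pi; rewrite RintegralD//; [exact: fi|exact: integrable_sumR].
Qed.

Lemma RintegralN f : intg f -> \int[mu]_(x in D) (- f x) = - \int[mu]_(x in D) f x.
Proof.
move=> fi; rewrite -mulN1r -RintegralZl//.
by under [in RHS]eq_Rintegral do rewrite mulN1r.
Qed.

Lemma integrableRZl (k : R) f : intg f -> intg (fun x => k * f x).
Proof. exact: integrableZl. Qed.

Lemma integrableRZr (k : R) f : intg f -> intg (fun x => f x * k).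
Proof. exact: integrableZr. Qed.

Lemma integrableRD f g : intg f -> intg g -> intg (fun x => f x + g x).
Proof. exact: integrableD. Qed.

Lemma integrableRN f : intg f -> intg (fun x => - f x).
Proof. exact: integrableN. Qed.

End IntegralTools.

(** * Integration by parts in the presence of jumps *)

Section ScalarIBP.
Context {R : realType} (N : nat) (tk : nat -> R) (T : R).
Hypotheses (tk0 : tk 0 = 0) (tkT : tk N.+1 = T).
Hypothesis tk_lt : forall k : nat, (k <= N)%N -> tk k < tk k.+1.
Notation leb := (@lebesgue_measure R).
Implicit Types (x h g z : R -> R) (J : 'I_N -> R).

Lemma int_sol_bounded h J z : leb.-integrable `[0, T] (EFin \o h) ->
  int_sol tk T h J z ->
  measurable_fun `[0, T] z /\ exists K : R, forall t, 0 <= t <= T -> `|z t| <= K.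
Proof.
move=> ih /(int_sol_jump tk0 tkT tk_lt ih); exact: jump_sol_bounded.
Qed.

(** Split [z] into its absolutely continuous part [z1] and the step function [Jsum]. The product
    rule treats [x * z1]; the integral of [h] against the step function is the sum of the increments
    of [x] from each knot to [T] times the jumps ([JE]). *)
Lemma int_sol_ibp h g J x z :
  leb.-integrable `[0, T] (EFin \o h) -> leb.-integrable `[0, T] (EFin \o g) ->
  int_sol tk T h (fun _ : 'I_N => 0) x -> int_sol tk T g J z ->
  x T * z T - x 0 * z 0 =
    prim 0 (fun t => h t * z t + x t * g t) T + \sum_(i < N) x (tk i.+1) * J i.
Proof.
move=> ih ig xE zE; have T0 := period_gt0 tk0 tkT tk_lt.
have mT : measurable (`[0, T]%classic : set (measurableTypeR R)) by exact: measurable_itv.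
have {}xE t : 0 <= t <= T -> x t = x 0 + prim 0 h t.
  by move=> tT; rewrite xE// /Jsum big1 ?addr0.
pose z1 t := z 0 + prim 0 g t.
have zE' t : 0 <= t <= T -> z t = z1 t + Jsum tk J t.
  by move=> tT; rewrite zE// /z1 addrAC.
have cst_ac c : abs_continuous `[0, T] (fun=> c : R).
  by apply: (abs_continuous_lipschitz ltr01) => ? ? _ _; rewrite subrr normr0 mul1r.
have acx : abs_continuous `[0, T] x.
  apply: (@eq_abs_continuous _ _ (fun t => x 0 + prim 0 h t)).
    by move=> t; rewrite inE/= in_itv/= => tT; rewrite [RHS]xE.
  by apply: abs_continuousD => //; exact: abs_continuous_prim.
have acz : abs_continuous `[0, T] z1.
  by apply: abs_continuousD => //; exact: abs_continuous_prim.
have iT : is_interval (`[0, T]%classic : set R) by exact: interval_is_interval.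
have wx := abs_continuous_within iT acx; have wz := abs_continuous_within iT acz.
have mx : measurable_fun `[0, T] x by exact: subspace_continuous_measurable_fun.
have mz : measurable_fun `[0, T] z1 by exact: subspace_continuous_measurable_fun.
have [K1 xK] := within_continuous_bounded wx.
have [K2 zK] := within_continuous_bounded wz.
have ihz : leb.-integrable `[0, T] (EFin \o (fun t => h t * z1 t)).
  refine (@integrable_bddM R _ _ leb _ mT h z1 K2 ih mz _) => t.
  by rewrite /= in_itv; exact: zK.
have ixg : leb.-integrable `[0, T] (EFin \o (fun t => g t * x t)).
  refine (@integrable_bddM R _ _ leb _ mT g x K1 ig mx _) => t.
  by rewrite /= in_itv; exact: xK.
have ibp1 : x T * z1 T = x 0 * z1 0 + prim 0 (fun t => h t * z1 t + g t * x t) T.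
  apply: (@abs_continuous_FTC R 0 T (fun t => x t * z1 t)).
  - exact: ltW.
  - apply: (abs_continuousM (K := Num.max K1 K2)) => // t; rewrite /= in_itv/= => tT.
      by rewrite le_max xK.
    by rewrite le_max zK// orbT.
  - exact: (integrableRD mT ihz ixg).
  - apply: aeS2 (prim_derive (ltW T0) ih) (prim_derive (ltW T0) ig) => t H1 H2 tT.
    have dx : is_derive t 1 x (h t).
      apply: (@near_eq_is_derive _ _ _ (fun t => x 0 + prim 0 h t)).
        case/andP: tT => t0 t1.
        near=> s; rewrite (xE s)//; apply/andP; split; apply/ltW; near: s;
        [exact: lt_nbhsr|exact: lt_nbhsl].
      by rewrite -[h t]add0r; apply: is_deriveD; exact: H1.
    have dz : is_derive t 1 z1 (g t).
      by rewrite -[g t]add0r; apply: is_deriveD; exact: H2.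
    apply: is_derive_eq (is_deriveM dx dz) _.
    by rewrite /GRing.scale/= addrC [g t * _]mulrC [h t * _]mulrC.
have TT : 0 <= T <= T by rewrite lexx ltW.
have OT : (0 : R) <= 0 <= T by rewrite lexx ltW.
have iJ i : leb.-integrable `[0, T] (EFin \o (h \_ `]tk i.+1, T])).
  rewrite -restrict_EFin; apply/integrable_restrict => //=.
  apply: integrableS ih => //; first exact: measurableI.
have JE : prim 0 (fun t => h t * Jsum tk J t) T =
    \sum_(i < N) (x T - x (tk i.+1)) * J i.
  rewrite (_ : prim _ _ _ = \int[leb]_(t in `[0, T]) \sum_(i < N) (h \_ `]tk i.+1, T]) t * J i); last first.
    apply: eq_Rintegral => t; rewrite inE/= in_itv/= => /andP[t0 tT].
    rewrite /Jsum mulr_sumr big_mkcond/=; apply: eq_bigr => i _.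
    by rewrite patchE mem_setE in_itv/= tT andbT; case: ifP; rewrite ?mul0r.
  rewrite Rintegral_sum//; last by move=> i _; exact: (integrableRZr mT (J i) (iJ i)).
  apply: eq_bigr => i _; rewrite RintegralZr//; congr (_ * _).
  have /andP[t0 tT] := knot_inT tk0 tkT tk_lt i.
  rewrite -Rintegral_mkcondr setIidr; last first.
    by move=> s /=; rewrite !in_itv/= => /andP[is_ ->]; rewrite (le_trans t0) ?ltW.
  rewrite -(primB ih t0 tT (lexx T)) (xE T)// (xE (tk i.+1)) ?t0//.
  by ring.
have -> : prim 0 (fun t => h t * z t + x t * g t) T =
   prim 0 (fun t => h t * z1 t + g t * x t) T + prim 0 (fun t => h t * Jsum tk J t) T.
  rewrite /prim -RintegralD//.
  - apply: eq_Rintegral => t; rewrite inE/= in_itv/= => tT.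
    by rewrite zE'//; ring.
  - exact: (integrableRD mT ihz ixg).
  - rewrite (_ : _ \o _ = EFin \o (fun t => \sum_(i < N | tk i.+1 < t) h t * J i)); last first.
      by apply/funext => t /=; rewrite /Jsum mulr_sumr.
    apply: (@eq_integrable _ _ _ _ _ mT (EFin \o (fun t => \sum_(i < N) (h \_ `]tk i.+1, T]) t * J i))).
      move=> t; rewrite inE/= in_itv/= => /andP[t0 tT]; congr EFin.
      rewrite [RHS]big_mkcond/=; apply: eq_bigr => i _.
      by rewrite patchE mem_setE in_itv/= tT andbT; case: ifP; rewrite ?mul0r.
    by apply: integrable_sumR => // i _; exact: (integrableRZr mT (J i) (iJ i)).
have -> : prim 0 (fun t => h t * z1 t + g t * x t) T = x T * z1 T - x 0 * z1 0.
  by rewrite ibp1 addrAC subrr add0r.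
rewrite JE zE'// (zE' 0)// Jsum0// addr0.
have -> : Jsum tk J T = \sum_i J i.
  apply: eq_bigl => i; apply: lt_le_trans (tk_lt (ltn_ord i)) _.
  exact: (knot_leT tkT tk_lt (ltn_ord i : (i.+1 < N.+1)%N)).
have SE : \sum_(i < N) (x T - x (tk i.+1)) * J i + \sum_(i < N) x (tk i.+1) * J i =
    x T * \sum_i J i.
  by rewrite -big_split mulr_sumr; apply: eq_bigr => i _ /=; ring.
by rewrite -[RHS]addrA SE; ring.
Unshelve. all: by end_near. Qed.

End ScalarIBP.

(** * Linear Volterra systems by Picard iteration *)

Section Volterra.
Context {R : realType} (I : finType) (T : R) (K : I -> I -> R -> R) (C : R).
Notation leb := (@lebesgue_measure R).
Hypothesis T0 : 0 < T.
Hypothesis C0 : 0 < C.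
Hypothesis mK : forall a b, measurable_fun `[0, T] (K a b).
Hypothesis KC : {ae leb, forall t, 0 <= t <= T -> forall a b, `|K a b t| <= C}.
Implicit Types (w : I -> R -> R).

(** The space in which solutions are sought. The bound holds at every point because the fixed-point
    estimates below are pointwise. *)
Definition bounded_meas (w : R -> R) : Prop :=
  measurable_fun `[0, T] w /\ exists M : R, forall t, 0 <= t <= T -> `|w t| <= M.

Let ker w a (s : R) := \sum_b K a b s * w b s.
Let op w a t := prim 0 (ker w a) t.
(** Rate of the exponential weight [E], large enough for [op] to halve the norm weighted by [E]; the
    successor keeps it positive for empty [I]. *)
Let lam : R := 2 * C * (#|I|.+1)%:R.
Let E t := expR (lam * t).

Let mT : measurable (`[0, T]%classic : set (measurableTypeR R)).
Proof. exact: measurable_itv. Qed.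

Let mS t : measurable (`[0, t]%classic : set (measurableTypeR R)).
Proof. exact: measurable_itv. Qed.

Let fT t : (leb `[0%R, t] < +oo)%E.
Proof. by rewrite lebesgue_measure_itv; case: ifP => //; rewrite ltry. Qed.

Let lam0 : 0 < lam. Proof. by rewrite !mulr_gt0. Qed.

Let sub_itv t : t <= T -> (`[0, t] `<=` `[0, T])%classic.
Proof. by move=> tT x /=; rewrite !in_itv/= => /andP[-> /le_trans ->]. Qed.

Lemma bounded_measD (w1 w2 : R -> R) : bounded_meas w1 -> bounded_meas w2 ->
  bounded_meas (fun t => w1 t + w2 t).
Proof.
move=> [m1 [M1 H1]] [m2 [M2 H2]]; split; first exact: measurable_funD.
by exists (M1 + M2) => t tT; rewrite (le_trans (ler_normD _ _))// lerD ?H1 ?H2.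
Qed.

Lemma bounded_measN (w1 : R -> R) : bounded_meas w1 -> bounded_meas (fun t => - w1 t).
Proof.
move=> [m1 [M1 H1]]; split; first exact: measurableT_comp.
by exists M1 => t tT; rewrite normrN H1.
Qed.

Lemma prim_bounded_meas f : leb.-integrable `[0, T] (EFin \o f) ->
  bounded_meas (prim 0 f).
Proof.
move=> fi; have acf := abs_continuous_prim fi.
have iT : is_interval (`[0, T]%classic : set R) by exact: interval_is_interval.
have wf := abs_continuous_within iT acf; split.
  exact: subspace_continuous_measurable_fun.
exact: within_continuous_bounded.
Qed.

Let ker_meas w a t : t <= T -> (forall b, bounded_meas (w b)) ->
  measurable_fun `[0, t] (ker w a).
Proof.
move=> tT bw; apply: measurable_sum => b; apply: measurable_funM.
  exact: measurable_funS (sub_itv tT) (mK a b).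
exact: measurable_funS (sub_itv tT) (bw b).1.
Qed.

Let ker_le w a (M : R -> R) : (forall b t, 0 <= t <= T -> `|w b t| <= M t) ->
  {ae leb, forall t, 0 <= t <= T -> `|ker w a t| <= (C * #|I|%:R) * M t}.
Proof.
move=> wM; apply: aeS KC => t Kt tT; rewrite /ker.
rewrite (le_trans (ler_norm_sum _ _ _))// mulrAC mulr_natr -sumr_const.
by apply: ler_sum => b _; rewrite normrM ler_pM ?Kt ?wM.
Qed.

Let ker_int w a t : t <= T -> (forall b, bounded_meas (w b)) ->
  leb.-integrable `[0, t] (EFin \o ker w a).
Proof.
move=> tT bw.
have [M HM] : exists M : R, forall b s, 0 <= s <= T -> `|w b s| <= M.
  have [M HM] := choice (fun b => (bw b).2).
  exists (\sum_b `|M b|) => b s sT.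
  rewrite (le_trans (HM b s sT))// (le_trans (ler_norm _))//.
  by rewrite (bigD1 b)//= lerDl sumr_ge0.
have iM : leb.-integrable `[0, t] (EFin \o (fun=> (C * #|I|%:R) * M)).
  exact: (@integrable_bdd R _ _ leb _ (mS t) (fun=> C * #|I|%:R * M)
    `|C * #|I|%:R * M| (fT t) (measurable_cst _) (fun _ _ => lexx _)).
refine (integrable_ae_le (mS t) (ker_meas a tT bw) iM _).
by apply: aeS (ker_le a HM) => s H /= /[!in_itv]/= /andP[s0 st]; rewrite H// s0 (le_trans st).
Qed.

Let op_bm w a : (forall b, bounded_meas (w b)) -> bounded_meas (op w a).
Proof. by move=> bw; apply/prim_bounded_meas/ker_int. Qed.

Let E_cont t : {within `[0, t], continuous (fun s => lam * E s)}.
Proof.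
apply: derivable_within_continuous => s _; apply: ex_derive.
Qed.

Let int_E t : 0 < t -> prim 0 (fun s => lam * E s) t = E t - 1.
Proof.
move=> t0; rewrite /prim /Rintegral.
have dE (s : R) : is_derive s (1 : R) E (lam * E s).
  by apply: is_derive_eq; rewrite /GRing.scale/= mulr1 mulrC.
have cE x : {for x, continuous E}.
  by apply: differentiable_continuous; apply/derivable1_diffP; by case: (dE x).
rewrite (@continuous_FTC2 R _ E)//.
- by rewrite /= {2}/E mulr0 expR0.
- split.
  + by move=> s _; case: (dE s).
  + by apply: cvg_at_right_filter; exact: cE.
  + by apply: cvg_at_left_filter; exact: cE.
- by move=> s _; rewrite derive1E; case: (dE s).
Qed.

(** The kernel costs at most a factor [C * #|I|], not more than half of [lam], and the integral of
    [lam * E] over [0, t] is [E t - 1]. A factor one half remains, for every length [T]. *)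
Let op_le w a M : 0 <= M -> (forall b, bounded_meas (w b)) ->
  (forall b t, 0 <= t <= T -> `|w b t| <= M * E t) ->
  forall t, 0 <= t <= T -> `|op w a t| <= M / 2 * E t.
Proof.
move=> M0 bw wM t /andP[t0 tT].
move: t0; rewrite le_eqVlt => /predU1P[<-|t0].
  by rewrite /op prim_id normr0 mulr_ge0 ?divr_ge0// expR_ge0.
have iE : leb.-integrable `[0, t] (EFin \o (fun s => M / 2 * (lam * E s))).
  have := @continuous_compact_integrable R _ _ (@segment_compact R 0 t) (@E_cont t).
  exact: (integrableRZl (mS t)).
apply: le_trans (_ : \int[leb]_(s in `[0, t]) (M / 2 * (lam * E s)) <= _).
  refine (ae_le_normr_Rintegral (mS t) (ker_meas a tT bw) iE _ _).
    by move=> s _; apply: mulr_ge0; [lra|apply: mulr_ge0; [exact: ltW|exact: expR_ge0]].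
  apply: aeS (ker_le a wM) => s H /= /[!in_itv]/= /andP[s0 st].
  rewrite (le_trans (H _))// ?s0 ?(le_trans st)//.
  rewrite mulrA [leRHS]mulrA ler_wpM2r ?expR_ge0// /lam.
  rewrite (_ : M / 2 * _ = C * #|I|.+1%:R * M); last by field.
  by rewrite ler_wpM2r// ler_pM2l// ler_nat.
rewrite RintegralZl//; last first.
  exact: continuous_compact_integrable (@segment_compact R 0 t) (@E_cont t).
rewrite -/(prim 0 (fun s => lam * E s) t) int_E//.
by rewrite ler_wpM2l ?divr_ge0// gerBl.
Qed.

Let E_ge1 t : 0 <= t <= T -> 1 <= E t.
Proof. by move=> /andP[t0 _]; rewrite -expR0 ler_expR mulr_ge0// ltW. Qed.

Let E_leT t : 0 <= t <= T -> E t <= E T.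
Proof. by move=> /andP[t0 tT]; rewrite ler_expR ler_pM2l. Qed.

Let bm_unif w : (forall b, bounded_meas (w b)) -> exists2 M : R, 0 <= M &
  forall b s, 0 <= s <= T -> `|w b s| <= M * E s.
Proof.
move=> bw; have [M HM] := choice (fun b => (bw b).2).
exists (\sum_b `|M b|) => [|b s sT]; first exact: sumr_ge0.
rewrite (le_trans (HM b s sT))// (le_trans (ler_norm _))//.
apply: le_trans (_ : \sum_b `|M b| <= _).
  by rewrite (bigD1 b)//= lerDl sumr_ge0.
by rewrite ler_peMr ?E_ge1// sumr_ge0.
Qed.

Let opB w1 w2 a t : 0 <= t <= T -> (forall b, bounded_meas (w1 b)) ->
  (forall b, bounded_meas (w2 b)) ->
  op w1 a t - op w2 a t = op (fun b s => w1 b s - w2 b s) a t.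
Proof.
move=> /andP[_ tT] b1 b2.
rewrite /op /prim -RintegralB//; [|exact: ker_int|exact: ker_int].
apply: eq_Rintegral => s _; rewrite /ker -sumrB.
by apply: eq_bigr => b _; rewrite mulrBr.
Qed.

Let geo_eq0 (x M : R) : (forall n, `|x| <= M / 2 ^+ n) -> x = 0.
Proof.
move=> H; apply/eqP; rewrite -normr_le0; apply/ler_addgt0Pr => e e0; rewrite add0r.
have M0 : 0 <= M by have := H 0; rewrite expr0 divr1; exact: le_trans.
have [n nM] : exists n : nat, M / e < n%:R.
  by exists (Num.truncn (M / e)).+1; exact: truncnS_gt.
rewrite (le_trans (H n))// ler_pdivrMr ?exprn_gt0//.
rewrite ltr_pdivrMr// mulrC in nM; rewrite (le_trans (ltW nM))// ler_pM2l//.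
by rewrite -natrX ler_nat ltnW// ltn_expl.
Qed.

(** Every substitution of [w] into its own equation halves the weighted bound. *)
Lemma volterra_unique w : (forall b, bounded_meas (w b)) ->
  (forall a t, 0 <= t <= T -> w a t = prim 0 (fun s => \sum_b K a b s * w b s) t) ->
  forall a t, 0 <= t <= T -> w a t = 0.
Proof.
move=> bw wE a t tT; have [M M0 HM] := bm_unif bw.
suff H n b s : 0 <= s <= T -> `|w b s| <= M / 2 ^+ n * E s.
  apply: (@geo_eq0 _ (M * E t)) => n.
  by rewrite (le_trans (H n a t tT))// mulrAC.
elim: n b s => [|n IH] b s sT; first by rewrite expr0 divr1 HM.
rewrite wE// (_ : M / _ = M / 2 ^+ n / 2); last by rewrite exprSr invfM mulrA.
by apply: op_le => //; apply: divr_ge0; [done|exact: exprn_ge0].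
Qed.

(** Successive Picard iterates differ by geometrically decreasing amounts, so they converge
    uniformly to a bounded measurable limit. *)
Lemma volterra_exists (b : I -> R -> R) : (forall a, bounded_meas (b a)) ->
  exists w : I -> R -> R, (forall a, bounded_meas (w a)) /\
  forall a t, 0 <= t <= T ->
    w a t = b a t + prim 0 (fun s => \sum_c K a c s * w c s) t.
Proof.
move=> bb.
pose W := fix W n : I -> R -> R :=
  if n is n'.+1 then fun a t => b a t + op (W n') a t else b.
have bW n : forall a, bounded_meas (W n a).
  by elim: n => [//|n IH] a; apply: bounded_measD => //; exact: op_bm.
have bWB n m c : bounded_meas (fun s => W n c s - W m c s).
  by apply: bounded_measD => //; exact: bounded_measN.
have [M M0 HM] := bm_unif (bWB 1%N 0).
have dW n : forall a t, 0 <= t <= T -> `|W n.+1 a t - W n a t| <= M / 2 ^+ n * E t.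
  elim: n => [|n IH] a t tT; first by rewrite expr0 divr1 HM.
  rewrite [W n.+2 a t]/= [W n.+1 a t in X in _ - X]/= opprD addrACA subrr add0r opB//; last exact: (bW n.+1).
  rewrite (_ : M / _ = M / 2 ^+ n / 2); last by rewrite exprSr invfM mulrA.
  apply: op_le => //; last exact: (bWB n.+1 n).
  by apply: divr_ge0; [done|exact: exprn_ge0].
(* The geometric sum is written as a difference of two tails, which makes the induction on [k] an
   exact identity. *)
have dWm n k a t : 0 <= t <= T ->
    `|W (n + k)%N a t - W n a t| <= (2 * M / 2 ^+ n - 2 * M / 2 ^+ (n + k)) * E t.
  move=> tT; elim: k => [|k IH]; first by rewrite addn0 !subrr normr0 mul0r.
  rewrite -(subrKA (W (n + k)%N a t)) (le_trans (ler_normD _ _))//.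
  rewrite addnS (le_trans (lerD (dW _ _ _ tT) IH))// -mulrDl ler_wpM2r ?expR_ge0//.
  rewrite exprSr le_eqVlt; apply/orP; left; apply/eqP.
  by field; rewrite !expf_neq0.
have dWE n m a t : (n <= m)%N -> 0 <= t <= T -> `|W m a t - W n a t| <= 2 * M * E T / 2 ^+ n.
  move=> nm tT; rewrite -(subnKC nm) (le_trans (dWm _ _ _ _ tT))//.
  rewrite [leRHS]mulrAC; apply: ler_pM; rewrite ?expR_ge0 ?E_leT//.
    rewrite subr_ge0 ler_wpM2l ?mulr_ge0// lef_pV2 ?posrE ?exprn_gt0//.
    by rewrite ler_weXn2l ?ler1n// leq_addr.
  by rewrite gerBl; apply: divr_ge0; [exact: mulr_ge0|exact: exprn_ge0].
have cW a t : 0 <= t <= T -> cvg (W n a t @[n --> \oo]).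
  move=> tT; apply/cauchy_cvgP/cauchy_exP => e e0.
  have P0 : 0 <= 2 * M * E T by rewrite !mulr_ge0// expR_ge0.
  pose n := (Num.truncn (2 * M * E T / e)).+1.
  exists (W n a t); exists n => // m /= nm; rewrite /ball/= distrC.
  apply: le_lt_trans (dWE n m a t nm tT) _.
  rewrite ltr_pdivrMr ?exprn_gt0// -ltr_pdivrMl// mulrC.
  apply: lt_le_trans (truncnS_gt _) _.
  by rewrite -natrX ler_nat ltnW// ltn_expl.
pose w a t := lim (W n a t @[n --> \oo]).
have wW n a t : 0 <= t <= T -> `|w a t - W n a t| <= 2 * M * E T / 2 ^+ n.
  move=> tT; apply: (@cvgr_to_le nat \oo _ _ (fun m => `|W m a t - W n a t|)).
    by apply: cvg_norm; apply: cvgB; [exact: cW|exact: cvg_cst].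
  by exists n => // m /= nm; exact: dWE.
have bw a : bounded_meas (w a).
  split.
    apply: (@measurable_fun_cvg _ _ _ _ (fun n t => W n a t)) => [n|t]; first exact: (bW n a).1.
    by rewrite /= in_itv; exact: cW.
  have [_ [B HB]] := bW 0 a; exists (B + 2 * M * E T) => t tT.
  rewrite -(subrK (W 0%N a t) (w a t)) addrC (le_trans (ler_normD _ _))//.
  by rewrite lerD ?HB//; have := wW 0%N a t tT; rewrite expr0 divr1.
exists w; split => // a t tT; apply/eqP; rewrite -subr_eq0; apply/eqP.
apply: (@geo_eq0 _ (2 * M * E T + 2 * M * E T * E T)) => n.
(* The residual of the limit is compared with iterate [n]; both differences are of order [2 ^- n],
   for every [n]. *)
have -> : w a t - (b a t + op w a t) =
   (w a t - W n.+1 a t) - op (fun c s => w c s - W n c s) a t.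
  by rewrite -opB// [W n.+1 a t]/=; ring.
rewrite (le_trans (ler_normB _ _))// mulrDl lerD//.
  rewrite (le_trans (wW _ _ _ tT))// ler_wpM2l ?mulr_ge0 ?expR_ge0//.
  by rewrite lef_pV2 ?posrE ?exprn_gt0// ler_weXn2l ?ler1n.
have P0 : 0 <= 2 * M * E T / 2 ^+ n by rewrite !mulr_ge0 ?expR_ge0// invr_ge0 exprn_ge0.
apply: le_trans (op_le a P0 _ _ tT) _.
- by move=> c; apply: bounded_measD => //; exact: bounded_measN.
- by move=> c s sT; rewrite (le_trans (wW n c s sT))// ler_peMr// E_ge1.
- by rewrite [leRHS]mulrAC; apply: ler_pM; rewrite ?expR_ge0 ?E_leT//; lra.
Qed.

End Volterra.

Local Open Scope sesquilinear_scope.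

(** * Real and imaginary parts of complex numbers *)

Section ComplexParts.
Context {R : realType}.
Notation C := R[i].
Implicit Types x y : C.

Lemma complex_ext x y : complex.Re x = complex.Re y ->
  complex.Im x = complex.Im y -> x = y.
Proof. by case: x => a b; case: y => c d /= -> ->. Qed.

Lemma cReD x y : complex.Re (x + y) = complex.Re x + complex.Re y.
Proof. by case: x; case: y. Qed.

Lemma cImD x y : complex.Im (x + y) = complex.Im x + complex.Im y.
Proof. by case: x; case: y. Qed.

Lemma cReN x : complex.Re (- x) = - complex.Re x.
Proof. by case: x. Qed.

Lemma cImN x : complex.Im (- x) = - complex.Im x.
Proof. by case: x. Qed.

Lemma cReB x y : complex.Re (x - y) = complex.Re x - complex.Re y.
Proof. by rewrite cReD cReN. Qed.

Lemma cImB x y : complex.Im (x - y) = complex.Im x - complex.Im y.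
Proof. by rewrite cImD cImN. Qed.

Lemma cReM x y : complex.Re (x * y) =
  complex.Re x * complex.Re y - complex.Im x * complex.Im y.
Proof. by case: x; case: y. Qed.

Lemma cImM x y : complex.Im (x * y) =
  complex.Re x * complex.Im y + complex.Im x * complex.Re y.
Proof. by case: x; case: y. Qed.

Lemma cRe_conj x : complex.Re (x^*) = complex.Re x.
Proof. by case: x. Qed.

Lemma cIm_conj x : complex.Im (x^*) = - complex.Im x.
Proof. by case: x. Qed.

Lemma cRe_sum (I : Type) (r : seq I) (P : pred I) (F : I -> C) :
  complex.Re (\sum_(i <- r | P i) F i) = \sum_(i <- r | P i) complex.Re (F i).
Proof. by apply: (big_morph (@complex.Re R)) => //; exact: cReD. Qed.

Lemma cIm_sum (I : Type) (r : seq I) (P : pred I) (F : I -> C) :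
  complex.Im (\sum_(i <- r | P i) F i) = \sum_(i <- r | P i) complex.Im (F i).
Proof. by apply: (big_morph (@complex.Im R)) => //; exact: cImD. Qed.

Lemma normc2 x : Normc.normc x ^+ 2 = complex.Re x ^+ 2 + complex.Im x ^+ 2.
Proof. by case: x => a b; rewrite /= sqr_sqrtr// addr_ge0 ?sqr_ge0. Qed.

Lemma Re_le_normc x : `|complex.Re x| <= Normc.normc x.
Proof.
case: x => a b /=; rewrite -sqrtr_sqr ler_sqrt ?lerDl ?sqr_ge0//.
by rewrite addr_ge0 ?sqr_ge0.
Qed.

Lemma Im_le_normc x : `|complex.Im x| <= Normc.normc x.
Proof.
case: x => a b /=; rewrite -sqrtr_sqr ler_sqrt ?lerDr ?sqr_ge0//.
by rewrite addr_ge0 ?sqr_ge0.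
Qed.

End ComplexParts.

(** * Classes of real functions lifted to complex-valued functions and matrices *)

Section FunctionClasses.
Context {R : realType} {d : measure_display} {T : measurableType d}.
Variables (mu : {measure set T -> \bar R}) (D : set T).
Notation C := R[i].

(** Closure under matrix operations is proved once for an abstract class of real functions and then
    used for measurable, bounded, square integrable and integrable functions; [class_mul] records
    the class in which a product lands. *)
Definition class_module (P : (T -> R) -> Prop) : Prop :=
  [/\ P (fun=> 0), (forall f g, P f -> P g -> P (fun x => f x + g x)) &
      forall f, P f -> P (fun x => - f x)].

Definition class_mul (P1 P2 P3 : (T -> R) -> Prop) : Prop :=
  forall f g, P1 f -> P2 g -> P3 (fun x => f x * g x).

Definition cclass (P : (T -> R) -> Prop) (f : T -> C) : Prop :=
  P (fun x => complex.Re (f x)) /\ P (fun x => complex.Im (f x)).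

Definition ess_bounded (f : T -> R) : Prop :=
  measurable_fun D f /\ exists K : R, {ae mu, forall x, D x -> `|f x| <= K}.

Definition integrableR (f : T -> R) : Prop := mu.-integrable D (EFin \o f).

Definition sq_integrable (f : T -> R) : Prop :=
  measurable_fun D f /\ mu.-integrable D (EFin \o (fun x => f x ^+ 2)).

Section Closure.
Variables P P1 P2 P3 : (T -> R) -> Prop.
Hypothesis mP : class_module P.
Hypothesis mP3 : class_module P3.
Hypothesis P123 : class_mul P1 P2 P3.

Lemma class_sum (I : Type) (r : seq I) (Q : pred I) (f : I -> T -> R) :
  (forall i, Q i -> P (f i)) -> P (fun x => \sum_(i <- r | Q i) f i x).
Proof.
case: mP => P0 PD _ Pf; elim: r => [|i r IH].
  by under eq_fun do rewrite big_nil.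
by case Qi: (Q i); under eq_fun do rewrite big_cons Qi; rewrite //; apply: PD => //; exact: Pf.
Qed.

Lemma cclass0 : cclass P (fun=> 0).
Proof. by case: mP. Qed.

Lemma cclassD f g : cclass P f -> cclass P g -> cclass P (fun x => f x + g x).
Proof.
case: mP => _ PD _ [f1 f2] [g1 g2]; split.
  by under eq_fun do rewrite cReD; exact: PD.
by under eq_fun do rewrite cImD; exact: PD.
Qed.

Lemma cclassN f : cclass P f -> cclass P (fun x => - f x).
Proof.
case: mP => _ _ PN [f1 f2]; split.
  by under eq_fun do rewrite cReN; exact: PN.
by under eq_fun do rewrite cImN; exact: PN.
Qed.

Lemma cclassB f g : cclass P f -> cclass P g -> cclass P (fun x => f x - g x).
Proof. by move=> cf cg; apply: cclassD => //; exact: cclassN. Qed.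

Lemma cclass_conj f : cclass P f -> cclass P (fun x => (f x)^*).
Proof.
case: mP => _ _ PN [f1 f2]; split.
  by under eq_fun do rewrite cRe_conj.
by under eq_fun do rewrite cIm_conj; exact: PN.
Qed.

Lemma cclass_sum (I : Type) (r : seq I) (Q : pred I) (f : I -> T -> C) :
  (forall i, Q i -> cclass P (f i)) -> cclass P (fun x => \sum_(i <- r | Q i) f i x).
Proof.
move=> Pf; split.
  by under eq_fun do rewrite cRe_sum; apply: class_sum => i /Pf[].
by under eq_fun do rewrite cIm_sum; apply: class_sum => i /Pf[].
Qed.

Lemma cclassM f g : cclass P1 f -> cclass P2 g -> cclass P3 (fun x => f x * g x).
Proof.
case: mP3 => _ PD PN [f1 f2] [g1 g2]; split.
  under eq_fun do rewrite cReM; apply: PD; first exact: P123.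
  by apply: PN; exact: P123.
by under eq_fun do rewrite cImM; apply: PD; exact: P123.
Qed.

Lemma cclass_eq f g : f =1 g -> cclass P f -> cclass P g.
Proof. by move/funext ->. Qed.

Lemma entrywiseP p q (F : T -> 'M[C]_(p, q)) :
  entrywise P F <-> forall a b, cclass P (fun x => F x a b).
Proof. by split => H a b; exact: H. Qed.

Lemma entrywise_eq p q (F G : T -> 'M[C]_(p, q)) : F =1 G ->
  entrywise P F -> entrywise P G.
Proof. by move/funext ->. Qed.

Lemma entrywise0 p q : entrywise P (fun=> 0 : 'M[C]_(p, q)).
Proof.
apply/entrywiseP => a b; apply: cclass_eq cclass0 => x.
by rewrite mxE.
Qed.

Lemma entrywiseD p q (F G : T -> 'M[C]_(p, q)) : entrywise P F -> entrywise P G ->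
  entrywise P (fun x => F x + G x).
Proof.
move=> cF cG; apply/entrywiseP => a b.
by apply: cclass_eq (cclassD (cF a b) (cG a b)) => x; rewrite mxE.
Qed.

Lemma entrywiseN p q (F : T -> 'M[C]_(p, q)) : entrywise P F ->
  entrywise P (fun x => - F x).
Proof.
move=> cF; apply/entrywiseP => a b.
by apply: cclass_eq (cclassN (cF a b)) => x; rewrite mxE.
Qed.

Lemma entrywiseB p q (F G : T -> 'M[C]_(p, q)) : entrywise P F -> entrywise P G ->
  entrywise P (fun x => F x - G x).
Proof. by move=> cF cG; apply: entrywiseD => //; exact: entrywiseN. Qed.

Lemma entrywise_sum p q (I : Type) (r : seq I) (Q : pred I)
    (F : I -> T -> 'M[C]_(p, q)) : (forall i, Q i -> entrywise P (F i)) ->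
  entrywise P (fun x => \sum_(i <- r | Q i) F i x).
Proof.
move=> cF; apply/entrywiseP => a b.
apply: cclass_eq (cclass_sum r (Q := Q) (f := fun i x => F i x a b) _) => [x|i Qi].
  by rewrite summxE.
exact: cF.
Qed.

Lemma entrywise_adj p q (F : T -> 'M[C]_(p, q)) : entrywise P F ->
  entrywise P (fun x => (F x)^t*).
Proof.
move=> cF; apply/entrywiseP => a b.
by apply: cclass_eq (cclass_conj (cF b a)) => x; rewrite !mxE.
Qed.

Lemma entrywise_block p1 p2 q1 q2 (F1 : T -> 'M[C]_(p1, q1)) (F2 : T -> 'M[C]_(p1, q2))
    (F3 : T -> 'M[C]_(p2, q1)) (F4 : T -> 'M[C]_(p2, q2)) :
  entrywise P F1 -> entrywise P F2 -> entrywise P F3 -> entrywise P F4 ->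
  entrywise P (fun x => block_mx (F1 x) (F2 x) (F3 x) (F4 x)).
Proof.
move=> c1 c2 c3 c4; apply/entrywiseP => a b.
case: (split_ordP a) => a' ->; case: (split_ordP b) => b' ->.
- by apply: cclass_eq (c1 a' b') => x; rewrite block_mxEul.
- by apply: cclass_eq (c2 a' b') => x; rewrite block_mxEur.
- by apply: cclass_eq (c3 a' b') => x; rewrite block_mxEdl.
- by apply: cclass_eq (c4 a' b') => x; rewrite block_mxEdr.
Qed.

Lemma entrywise_col p1 p2 q (F1 : T -> 'M[C]_(p1, q)) (F2 : T -> 'M[C]_(p2, q)) :
  entrywise P F1 -> entrywise P F2 -> entrywise P (fun x => col_mx (F1 x) (F2 x)).
Proof.
move=> c1 c2; apply/entrywiseP => a b; case: (split_ordP a) => a' ->.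
- by apply: cclass_eq (c1 a' b) => x; rewrite col_mxEu.
- by apply: cclass_eq (c2 a' b) => x; rewrite col_mxEd.
Qed.

Lemma entrywise_scale p q (f : T -> C) (F : T -> 'M[C]_(p, q)) :
  cclass P1 f -> entrywise P2 F -> entrywise P3 (fun x => f x *: F x).
Proof.
move=> cf cF a b.
have [h1 h2] := cclassM cf (cF a b).
by split; [move: h1|move: h2]; congr P3; apply/funext => x; rewrite mxE.
Qed.

Lemma cclass_entry_sum (I : Type) (r : seq I) (f g : I -> T -> C) :
  (forall i, cclass P1 (f i)) -> (forall i, cclass P2 (g i)) ->
  cclass P3 (fun x => \sum_(i <- r) f i x * g i x).
Proof.
case: mP3 => P0 PD PN cf cg.
have cfg i := cclassM (cf i) (cg i).
elim: r => [|i r [IH1 IH2]].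
  by split; under eq_fun do rewrite big_nil.
have [h1 h2] := cfg i.
split; under eq_fun do rewrite big_cons.
  by under eq_fun do rewrite cReD; exact: PD.
by under eq_fun do rewrite cImD; exact: PD.
Qed.

Lemma entrywiseM p q r (F : T -> 'M[C]_(p, q)) (G : T -> 'M[C]_(q, r)) :
  entrywise P1 F -> entrywise P2 G -> entrywise P3 (fun x => F x *m G x).
Proof.
move=> cF cG a b.
have [h1 h2] := cclass_entry_sum (index_enum 'I_q) (fun i => cF a i) (fun i => cG i b).
by split; [move: h1|move: h2]; congr P3; apply/funext => x; rewrite mxE.
Qed.

Lemma cclass_dot k (F G : T -> 'cV[C]_k) :
  entrywise P1 F -> entrywise P2 G -> class_module P2 ->
  cclass P3 (fun x => dot (F x) (G x)).
Proof.
move=> cF cG mP2; apply: cclass_entry_sum => i; first exact: cF.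
have [_ _ PN] := mP2; have [g1 g2] := cG i 0; split.
  by under eq_fun do rewrite cRe_conj.
by under eq_fun do rewrite cIm_conj; exact: PN.
Qed.

End Closure.
End FunctionClasses.

(** * Concrete function classes and the complex integral *)

Section ClassInstances.
Context {R : realType} {d : measure_display} {T : measurableType d}.
Variables (mu : {measure set T -> \bar R}) (D : set T).
Hypothesis mD : measurable D.
Notation C := R[i].
Notation LI := (ess_bounded mu D).
Notation Lsq := (sq_integrable mu D).
Notation Lint := (integrableR mu D).

Lemma measurable_fun_sqr (f : T -> R) : measurable_fun D f ->
  measurable_fun D (fun x => f x ^+ 2).
Proof. by move=> mf; under eq_fun do rewrite expr2; exact: measurable_funM. Qed.

Lemma class_module_meas : class_module (measurable_fun D : (T -> R) -> Prop).
Proof.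
split; first exact: measurable_cst.
- by move=> f g mf mg; exact: measurable_funD.
- by move=> f mf; exact: measurableT_comp.
Qed.

Lemma class_module_LI : class_module LI.
Proof.
split.
- split; first exact: measurable_cst.
  by exists 0; apply: aeW => x _; rewrite normr0.
- move=> f g [mf [K fK]] [mg [L gL]]; split; first exact: measurable_funD.
  exists (K + L); apply: aeS2 fK gL => x fK gL Dx.
  by rewrite (le_trans (ler_normD _ _))// lerD ?fK ?gL.
- move=> f [mf [K fK]]; split; first exact: measurableT_comp.
  by exists K; apply: aeS fK => x fK Dx; rewrite normrN fK.
Qed.

Lemma class_module_Lint : class_module Lint.
Proof.
split; first exact: integrable0.
- by move=> f g; exact: integrableRD.
- by move=> f; exact: integrableRN.
Qed.

Lemma class_module_Lsq : class_module Lsq.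
Proof.
split.
- split; first exact: measurable_cst.
  rewrite (_ : _ \o _ = cst 0%E); first exact: integrable0.
  by apply/funext => x /=; rewrite expr0n.
- move=> f g [mf f2] [mg g2]; have mfg : measurable_fun D (fun x => f x + g x).
    exact: measurable_funD.
  split => //.
  apply: (@integrable_ae_le _ _ _ _ _ mD _ (fun x => 2 * f x ^+ 2 + 2 * g x ^+ 2)).
  + exact: measurable_fun_sqr.
  + by apply: integrableRD => //; exact: integrableRZl.
  + apply: aeW => x _; rewrite ger0_norm ?sqr_ge0//.
    have := sqr_ge0 (f x - g x); rewrite sqrrB sqrrD; lra.
- move=> f [mf f2]; split; first exact: measurableT_comp.
  by rewrite (_ : _ \o _ = EFin \o (fun x => f x ^+ 2))//; apply/funext => x /=; rewrite sqrrN.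
Qed.

Lemma class_mul_meas : class_mul (measurable_fun D) (measurable_fun D)
  (measurable_fun D : (T -> R) -> Prop).
Proof. by move=> f g mf mg; exact: measurable_funM. Qed.

Lemma class_mul_LI : class_mul LI LI LI.
Proof.
move=> f g [mf [K fK]] [mg [L gL]]; split; first exact: measurable_funM.
exists (K * L); apply: aeS2 fK gL => x fK gL Dx.
by rewrite normrM ler_pM ?fK ?gL.
Qed.

Lemma class_mul_LI_Lint : class_mul LI Lint Lint.
Proof.
move=> f g [mf [K fK]] ig; have mg := integrable_meas ig.
apply: (@integrable_ae_le _ _ _ _ _ mD _ (fun x => K * `|g x|)).
- exact: measurable_funM.
- apply: integrableRZl => //; exact: integrable_norm.
- by apply: aeS fK => x fK Dx; rewrite normrM ler_wpM2r ?fK.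
Qed.

Lemma class_mul_LI_Lsq : class_mul LI Lsq Lsq.
Proof.
move=> f g [mf [K fK]] [mg g2]; have mfg : measurable_fun D (fun x => f x * g x).
  exact: measurable_funM.
split => //.
apply: (@integrable_ae_le _ _ _ _ _ mD _ (fun x => K ^+ 2 * g x ^+ 2)).
- exact: measurable_fun_sqr.
- exact: integrableRZl.
- apply: aeS fK => x fK Dx; rewrite ger0_norm ?sqr_ge0// exprMn ler_wpM2r ?sqr_ge0//.
  by rewrite -real_normK ?num_real// lerXn2r ?nnegrE ?fK// (le_trans _ (fK Dx)).
Qed.

Lemma class_mul_Lsq : class_mul Lsq Lsq Lint.
Proof.
move=> f g [mf f2] [mg g2].
apply: (@integrable_ae_le _ _ _ _ _ mD _ (fun x => f x ^+ 2 + g x ^+ 2)).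
- exact: measurable_funM.
- exact: integrableRD.
- apply: aeW => x _; rewrite normrM.
  have := sqr_ge0 (`|f x| - `|g x|); rewrite sqrrB !real_normK ?num_real//.
  have := sqr_ge0 (f x); have := sqr_ge0 (g x); lra.
Qed.

Lemma Lsq_Lint f : (mu D < +oo)%E -> Lsq f -> Lint f.
Proof.
move=> fD [mf f2].
apply: (@integrable_ae_le _ _ _ _ _ mD _ (fun x => 1 + f x ^+ 2)) => //.
- apply: integrableRD => //.
  exact: (@integrable_bdd R _ _ mu _ mD (fun=> 1) `|1| fD (measurable_cst _) (fun _ _ => lexx _)).
- apply: aeW => x _; have := sqr_ge0 (`|f x| - 1).
  by rewrite sqrrB real_normK ?num_real//; have := normr_ge0 (f x); lra.
Qed.

Lemma LI_Lsq f : (mu D < +oo)%E -> LI f -> Lsq f.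
Proof.
move=> fD [mf [K fK]]; split => //.
apply: (@integrable_ae_le _ _ _ _ _ mD _ (fun=> K ^+ 2)).
- exact: measurable_fun_sqr.
- exact: (@integrable_bdd R _ _ mu _ mD (fun=> K ^+ 2) `|K ^+ 2| fD (measurable_cst _) (fun _ _ => lexx _)).
- apply: aeS fK => x fK Dx; rewrite ger0_norm ?sqr_ge0//.
  by rewrite -real_normK ?num_real// lerXn2r ?nnegrE ?fK// (le_trans _ (fK Dx)).
Qed.

Lemma LI_cst (c : R) : LI (fun=> c).
Proof.
split; first exact: measurable_cst.
by exists `|c|; apply: aeW.
Qed.

Lemma cclass_sub (P P' : (T -> R) -> Prop) (f : T -> C) :
  (forall g, P g -> P' g) -> cclass P f -> cclass P' f.
Proof. by move=> PP' [f1 f2]; split; exact: PP'. Qed.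

Lemma entrywise_sub (P P' : (T -> R) -> Prop) p q (F : T -> 'M[C]_(p, q)) :
  (forall g, P g -> P' g) -> entrywise P F -> entrywise P' F.
Proof. by move=> PP' cF a b; exact: cclass_sub (cF a b). Qed.

Lemma entrywise_LI_cst p q (A : 'M[C]_(p, q)) : entrywise LI (fun=> A).
Proof. by move=> a b; split; exact: LI_cst. Qed.

Lemma cclass_LI_cst (c : C) : cclass LI (fun=> c).
Proof. by split; exact: LI_cst. Qed.

Notation ci := (cclass Lint).

Lemma eq_cint (f g : T -> C) : (forall x, D x -> f x = g x) -> cint mu D f = cint mu D g.
Proof.
move=> fg; apply: complex_ext => /=; apply: eq_Rintegral => x; rewrite inE => Dx;
by rewrite fg.
Qed.

Lemma ae_eq_cint (f g : T -> C) : cclass (measurable_fun D) f -> cclass (measurable_fun D) g ->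
  {ae mu, forall x, D x -> f x = g x} -> cint mu D f = cint mu D g.
Proof.
move=> [f1 f2] [g1 g2] fg; apply: complex_ext => /=; apply: ae_eq_Rintegral => //;
by apply: aeS fg => x fg Dx; rewrite fg.
Qed.

Lemma cint0 : cint mu D (fun=> 0) = 0.
Proof. by apply: complex_ext; rewrite /= /Rintegral integral0. Qed.

Lemma cintD (f g : T -> C) : ci f -> ci g ->
  cint mu D (fun x => f x + g x) = cint mu D f + cint mu D g.
Proof.
move=> [f1 f2] [g1 g2]; apply: complex_ext; rewrite ?cReD ?cImD /= -RintegralD//;
by apply: eq_Rintegral => x _; rewrite ?cReD ?cImD.
Qed.

Lemma cintN (f : T -> C) : ci f -> cint mu D (fun x => - f x) = - cint mu D f.
Proof.
move=> [f1 f2]; apply: complex_ext; rewrite ?cReN ?cImN /= -RintegralN//;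
by apply: eq_Rintegral => x _; rewrite ?cReN ?cImN.
Qed.

Lemma cintB (f g : T -> C) : ci f -> ci g ->
  cint mu D (fun x => f x - g x) = cint mu D f - cint mu D g.
Proof.
move=> cf cg; rewrite cintD//; last exact: (cclassN class_module_Lint).
by rewrite cintN.
Qed.

Lemma cint_conj (f : T -> C) : ci f -> cint mu D (fun x => (f x)^*) = (cint mu D f)^*.
Proof.
move=> [f1 f2]; apply: complex_ext; rewrite ?cRe_conj ?cIm_conj /=.
  by apply: eq_Rintegral => x _; rewrite cRe_conj.
by rewrite -RintegralN//; apply: eq_Rintegral => x _; rewrite cIm_conj.
Qed.

Lemma cintZl (c : C) (f : T -> C) : ci f -> cint mu D (fun x => c * f x) = c * cint mu D f.
Proof.
move=> [f1 f2]; apply: complex_ext.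
  rewrite [RHS]cReM /cint/=.
  rewrite -!RintegralZl// -RintegralB//; [|exact: integrableRZl..].
  by apply: eq_Rintegral => x _; rewrite cReM.
rewrite [RHS]cImM /cint/= -!RintegralZl// -RintegralD//; [|exact: integrableRZl..].
by apply: eq_Rintegral => x _; rewrite cImM.
Qed.

Lemma cint_sum (I : Type) (r : seq I) (f : I -> T -> C) : (forall i, ci (f i)) ->
  cint mu D (fun x => \sum_(i <- r) f i x) = \sum_(i <- r) cint mu D (f i).
Proof.
move=> cf; elim: r => [|i r IH].
  by rewrite big_nil -[RHS]cint0; apply: eq_cint => x _; rewrite big_nil.
rewrite big_cons -IH -cintD//; last by apply: (cclass_sum class_module_Lint).
by apply: eq_cint => x _; rewrite big_cons.
Qed.

Lemma cint_ge0 (f : T -> C) : (forall x, D x -> 0 <= f x) -> 0 <= cint mu D f.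
Proof.
move=> f0; rewrite lecE /=; apply/andP; split; last first.
  by apply: Rintegral_ge0 => x /f0; rewrite lecE => /andP[].
apply/eqP; rewrite (eq_Rintegral mu (g := fun=> 0)); first by rewrite /Rintegral integral0.
by move=> x; rewrite inE => /f0; rewrite lecE => /andP[/eqP].
Qed.

End ClassInstances.

(** * Vector square integrability and extension by zero from a subset *)

Section Restriction.
Context {R : realType} {d : measure_display} {T : measurableType d}.
Variables (mu : {measure set T -> \bar R}).
Notation C := R[i].

Lemma ae_forall_fin (I : finType) (P : I -> T -> Prop) :
  (forall i, {ae mu, forall x, P i x}) -> {ae mu, forall x, forall i, P i x}.
Proof.
move=> H; suff : {ae mu, forall x, forall i, i \in enum I -> P i x}.
  by apply: aeS => x Hx i; apply: Hx; rewrite mem_enum.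
elim: (enum I) => [|i r IH]; first exact: aeW.
by apply: aeS2 (H i) IH => x Hi Hr j; rewrite inE => /predU1P[->|/Hr].
Qed.

Lemma vnorm2E k (v : 'cV[C]_k) :
  vnorm2 v = \sum_a (complex.Re (v a 0) ^+ 2 + complex.Im (v a 0) ^+ 2).
Proof. by apply: eq_bigr => a _; rewrite normc2. Qed.

Lemma vnorm2_ge0 k (v : 'cV[C]_k) : 0 <= vnorm2 v.
Proof. by apply: sumr_ge0 => a _; exact: sqr_ge0. Qed.

Section Domain.
Variables (A D : set T).
Hypotheses (mA : measurable A) (mD : measurable D).

Lemma vnorm2_meas k (f : T -> 'cV[C]_k) : entrywise (measurable_fun D) f ->
  measurable_fun D (fun x => vnorm2 (f x)).
Proof.
move=> mf; under eq_fun do rewrite vnorm2E.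
apply: measurable_sum => a; have [m1 m2] := mf a 0.
by apply: measurable_funD; exact: measurable_fun_sqr.
Qed.

(** The squared norm of a vector is the sum of the squares of its real coordinates and dominates
    each of them. This links [L2], stated with the norm, to the coordinatewise classes. *)
Lemma entrywise_LsqP k (f : T -> 'cV[C]_k) :
  entrywise (sq_integrable mu D) f <->
  entrywise (measurable_fun D) f /\ (\int[mu]_(x in D) (vnorm2 (f x))%:E < +oo)%E.
Proof.
split=> [Hf|[mf If]].
  have mf : entrywise (measurable_fun D) f by apply: entrywise_sub Hf => g [].
  split => //; apply: integrable_lty => //.
  have -> : (fun x => (vnorm2 (f x))%:E) = EFin \o
      (fun x => \sum_a (complex.Re (f x a 0) ^+ 2 + complex.Im (f x a 0) ^+ 2)).
    by apply/funext => x /=; rewrite vnorm2E.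
  apply: integrable_sumR => // a _; have [[_ h1] [_ h2]] := Hf a 0.
  exact: integrableRD.
have iv : mu.-integrable D (EFin \o (fun x => vnorm2 (f x))).
  apply/integrableP; split; first by apply/measurable_EFinP; exact: vnorm2_meas.
  by under eq_integral do rewrite /= ger0_norm ?vnorm2_ge0//.
move=> a b; rewrite ord1; have [m1 m2] := mf a 0.
have le1 x : complex.Re (f x a 0) ^+ 2 + complex.Im (f x a 0) ^+ 2 <= vnorm2 (f x).
  by rewrite vnorm2E (bigD1 a)//= lerDl sumr_ge0// => i _; rewrite addr_ge0 ?sqr_ge0.
split; split => //; (apply: (@integrable_ae_le _ _ _ _ _ mD _ _ _ iv);
  [exact: measurable_fun_sqr|apply: aeW => x _; rewrite ger0_norm ?sqr_ge0//]);
  apply: le_trans (le1 x); rewrite ?lerDl ?lerDr ?sqr_ge0//.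
Qed.

Lemma integrable_restrictS f : A `<=` D -> integrableR mu A f ->
  integrableR mu D (f \_ A).
Proof.
move=> AD fi; rewrite /integrableR -restrict_EFin.
by apply/integrable_restrict => //=; rewrite setIidr.
Qed.

Lemma measurable_restrictS (f : T -> R) : A `<=` D -> measurable_fun A f ->
  measurable_fun D (f \_ A).
Proof. by move=> AD mf; apply/measurable_restrict => //; rewrite setIidr. Qed.

Lemma sq_integrable_restrict f : A `<=` D -> sq_integrable mu A f ->
  sq_integrable mu D (f \_ A).
Proof.
move=> AD [mf f2]; split; first exact: measurable_restrictS.
have := integrable_restrictS AD f2; rewrite /integrableR; congr integrable.
by apply/funext => x /=; rewrite !patchE; case: ifP => // _; rewrite expr0n.
Qed.

Lemma ess_bounded_restrict f : A `<=` D -> ess_bounded mu A f ->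
  ess_bounded mu D (f \_ A).
Proof.
move=> AD [mf [K fK]]; split; first exact: measurable_restrictS.
exists `|K|; apply: aeS fK => x fK _; rewrite patchE; case: ifPn => [|_].
  by rewrite inE => /fK /le_trans; apply; exact: ler_norm.
by rewrite normr0.
Qed.

Lemma Rintegral_restrict f : A `<=` D ->
  \int[mu]_(x in D) (f \_ A) x = \int[mu]_(x in A) f x.
Proof. by move=> AD; rewrite -Rintegral_mkcondr setIidr. Qed.

Lemma cindic_mul (z : C) x : (\1_A x : C) * z = if x \in A then z else 0.
Proof. by rewrite indicE; case: ifP; rewrite ?mul1r ?mul0r. Qed.

Lemma cclass_restrict (PA PD : (T -> R) -> Prop) (f : T -> C) :
  (forall g, PA g -> PD (g \_ A)) -> cclass PA f ->
  cclass PD (fun x => (\1_A x : C) * f x).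
Proof.
move=> H [f1 f2]; split.
  have := H _ f1; congr PD; apply/funext => x.
  by rewrite cindic_mul patchE; case: ifP.
have := H _ f2; congr PD; apply/funext => x.
by rewrite cindic_mul patchE; case: ifP.
Qed.

Lemma entrywise_restrict (PA PD : (T -> R) -> Prop) p q (F : T -> 'M[C]_(p, q)) :
  (forall g, PA g -> PD (g \_ A)) -> entrywise PA F ->
  entrywise PD (fun x => (\1_A x : C) *: F x).
Proof.
move=> H cF; apply/entrywiseP => a b.
by apply: cclass_eq (cclass_restrict H (cF a b)) => x; rewrite mxE.
Qed.

Lemma cint_restrict (f : T -> C) : A `<=` D ->
  cint mu D (fun x => (\1_A x : C) * f x) = cint mu A f.
Proof.
move=> AD; apply: complex_ext; rewrite /= -(Rintegral_restrict _ AD);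
apply: eq_Rintegral => x _; rewrite cindic_mul patchE; by case: ifP.
Qed.

End Domain.
End Restriction.

(** * Transfer of data from the open interval to the closed one, which differs by a null set *)

Section ClosedInterval.
Context {R : realType}.
Notation C := R[i].
Notation leb := (@lebesgue_measure R).
Variable T : R.
Hypothesis T0 : 0 < T.
Notation I0T := (`]0, T[%classic : set R).
Notation IT := (`[0, T]%classic : set R).

Lemma measurable_IT : measurable (IT : set (measurableTypeR R)).
Proof. exact: measurable_itv. Qed.

Lemma measurable_I0T : measurable (I0T : set (measurableTypeR R)).
Proof. exact: measurable_itv. Qed.

Lemma finite_IT : (leb IT < +oo)%E.
Proof. by rewrite lebesgue_measure_itv/=; case: ifP => //; rewrite ltry. Qed.

Lemma I0T_sub : I0T `<=` IT.
Proof. exact: subset_itv_oo_cc. Qed.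

Lemma ae_I0T : {ae leb, forall t, IT t -> I0T t}.
Proof.
have : leb.-negligible ([set 0] `|` [set T]).
  by apply: negligibleU; apply/negligibleP => //; exact: lebesgue_measure_set1.
apply: negligibleS => t /= /not_implyP[]; rewrite !in_itv/= => /andP[t0 tT] /negP.
by rewrite !lt_neqAle t0 tT !andbT negb_and !negbK => /orP[/eqP <-|/eqP ->]; [left|right].
Qed.

Lemma measurable_I0T_IT (f : R -> R) : measurable_fun I0T f -> measurable_fun IT f.
Proof.
move=> mf; have -> : IT = I0T `|` ([set 0] `|` [set T]).
  apply/seteqP; split => t /=; rewrite !in_itv/=.
    move=> /andP[]; rewrite le_eqVlt => /predU1P[->|t0]; first by right; left.
    by rewrite le_eqVlt => /predU1P[->|tT]; [right; right|left; rewrite t0].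
  by case=> [/andP[/ltW -> /ltW ->]//|[->|->]]; rewrite lexx ltW.
apply/measurable_funU => //; first exact: measurableU.
split => //; apply/measurable_funU => //.
by split; exact: measurable_fun_set1.
Qed.

Lemma ae_restrict_IT (f : R -> R) : {ae leb, forall t, IT t -> (f \_ I0T) t = f t}.
Proof. by apply: aeS ae_I0T => t H /H It; rewrite patchE mem_set. Qed.

Lemma integrable_I0T_IT f : integrableR leb I0T f -> integrableR leb IT f.
Proof.
move=> fi; have mf := measurable_I0T_IT (integrable_meas fi).
apply: (ae_eq_integrable measurable_IT mf (ae_restrict_IT f)).
exact: (integrable_restrictS measurable_I0T measurable_IT I0T_sub fi).
Qed.

Lemma sq_integrable_I0T_IT f : sq_integrable leb I0T f -> sq_integrable leb IT f.
Proof.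
by move=> [mf f2]; split; [exact: measurable_I0T_IT|exact: integrable_I0T_IT].
Qed.

Lemma ess_bounded_I0T_IT f : ess_bounded leb I0T f -> ess_bounded leb IT f.
Proof.
move=> [mf [K fK]]; split; first exact: measurable_I0T_IT.
by exists K; apply: aeS2 ae_I0T fK => t H1 H2 /H1.
Qed.

Lemma cint_I0T (f : R -> C) : cclass (measurable_fun IT) f ->
  cint leb I0T f = cint leb IT f.
Proof.
move=> [m1 m2]; apply: complex_ext; rewrite /= -(@Rintegral_restrict R _ _ leb I0T IT _ I0T_sub);
apply: (ae_eq_Rintegral measurable_IT) (ae_restrict_IT _) => //;
apply: (measurable_restrictS measurable_I0T measurable_IT I0T_sub);
by apply: measurable_funS I0T_sub _.
Qed.

Lemma Linfty_LI p q D (F : R -> 'M[C]_(p, q)) : Linfty D F ->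
  entrywise (ess_bounded leb D) F.
Proof.
move=> [mF [K FK]] a b; have [m1 m2] := mF a b.
split; split => //; exists K; apply: aeS FK => t H /H Kt.
  by rewrite (le_trans (Re_le_normc _)).
by rewrite (le_trans (Im_le_normc _)).
Qed.

Lemma bounded_meas_LI f : bounded_meas T f -> ess_bounded leb IT f.
Proof.
move=> [mf [K fK]]; split => //; exists K; apply: aeW => t /=.
by rewrite in_itv; exact: fK.
Qed.

Lemma class_module_bm : class_module (bounded_meas T).
Proof.
split.
- by split; [exact: measurable_cst|exists 0 => t _; rewrite normr0].
- by move=> f g; exact: bounded_measD.
- by move=> f; exact: bounded_measN.
Qed.

End ClosedInterval.

(** * Products and pairings of matrix functions in the concrete classes *)

Section EntrywiseClasses.
Context {R : realType} {d : measure_display} {T : measurableType d}.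
Context {mu : {measure set T -> \bar R}} {D : set T}.
Hypothesis mD : measurable D.
Notation C := R[i].
Notation LI := (ess_bounded mu D).
Notation Lsq := (sq_integrable mu D).
Notation Lint := (integrableR mu D).
Notation meas := (measurable_fun D : (T -> R) -> Prop).

Lemma ew_LI_meas p q (F : T -> 'M[C]_(p, q)) : entrywise LI F -> entrywise meas F.
Proof. by apply: entrywise_sub => g []. Qed.

Lemma ew_Lsq_meas p q (F : T -> 'M[C]_(p, q)) : entrywise Lsq F -> entrywise meas F.
Proof. by apply: entrywise_sub => g []. Qed.

Lemma cLint_meas (f : T -> C) : cclass Lint f -> cclass meas f.
Proof. by apply: cclass_sub => g; exact: integrable_meas. Qed.

Lemma ew_LI_Lsq p q (F : T -> 'M[C]_(p, q)) : (mu D < +oo)%E ->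
  entrywise LI F -> entrywise Lsq F.
Proof. by move=> fD; apply: entrywise_sub => g; exact: LI_Lsq. Qed.

Lemma ew_Lsq_Lint p q (F : T -> 'M[C]_(p, q)) : (mu D < +oo)%E ->
  entrywise Lsq F -> entrywise Lint F.
Proof. by move=> fD; apply: entrywise_sub => g; exact: Lsq_Lint. Qed.

Lemma ewM_meas p q r (F : T -> 'M[C]_(p, q)) (G : T -> 'M[C]_(q, r)) :
  entrywise meas F -> entrywise meas G -> entrywise meas (fun x => F x *m G x).
Proof. by apply: entrywiseM; [exact: class_module_meas|exact: class_mul_meas]. Qed.

Lemma ewM_LI p q r (F : T -> 'M[C]_(p, q)) (G : T -> 'M[C]_(q, r)) :
  entrywise LI F -> entrywise LI G -> entrywise LI (fun x => F x *m G x).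
Proof. by move=> ? ?; apply: entrywiseM => //; [exact: class_module_LI|exact: class_mul_LI]. Qed.

Lemma ewM_LI_Lsq p q r (F : T -> 'M[C]_(p, q)) (G : T -> 'M[C]_(q, r)) :
  entrywise LI F -> entrywise Lsq G -> entrywise Lsq (fun x => F x *m G x).
Proof. by move=> ? ?; apply: entrywiseM => //; [exact: class_module_Lsq|exact: class_mul_LI_Lsq]. Qed.

Lemma ewM_LI_Lint p q r (F : T -> 'M[C]_(p, q)) (G : T -> 'M[C]_(q, r)) :
  entrywise LI F -> entrywise Lint G -> entrywise Lint (fun x => F x *m G x).
Proof. by move=> ? ?; apply: entrywiseM => //; [exact: class_module_Lint|exact: class_mul_LI_Lint]. Qed.

Lemma ewD_Lsq p q (F G : T -> 'M[C]_(p, q)) : entrywise Lsq F -> entrywise Lsq G ->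
  entrywise Lsq (fun x => F x + G x).
Proof. by move=> ? ?; apply: entrywiseD => //; exact: class_module_Lsq. Qed.

Lemma ewB_Lsq p q (F G : T -> 'M[C]_(p, q)) : entrywise Lsq F -> entrywise Lsq G ->
  entrywise Lsq (fun x => F x - G x).
Proof. by move=> ? ?; apply: entrywiseB => //; exact: class_module_Lsq. Qed.

Lemma ewN_Lsq p q (F : T -> 'M[C]_(p, q)) : entrywise Lsq F ->
  entrywise Lsq (fun x => - F x).
Proof. by move=> ?; apply: entrywiseN => //; exact: class_module_Lsq. Qed.

Lemma ewZ_Lsq p q (c : C) (F : T -> 'M[C]_(p, q)) : entrywise Lsq F ->
  entrywise Lsq (fun x => c *: F x).
Proof.
by move=> ?; apply: entrywise_scale => //; [exact: class_module_Lsq|exact: class_mul_LI_Lsq|exact: cclass_LI_cst].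
Qed.

Lemma ewD_Lint p q (F G : T -> 'M[C]_(p, q)) : entrywise Lint F -> entrywise Lint G ->
  entrywise Lint (fun x => F x + G x).
Proof. by move=> ? ?; apply: entrywiseD => //; exact: class_module_Lint. Qed.

Lemma ewZ_Lint p q (c : C) (F : T -> 'M[C]_(p, q)) : entrywise Lint F ->
  entrywise Lint (fun x => c *: F x).
Proof.
by move=> ?; apply: entrywise_scale => //; [exact: class_module_Lint|exact: class_mul_LI_Lint|exact: cclass_LI_cst].
Qed.

Lemma ew_adj_LI p q (F : T -> 'M[C]_(p, q)) : entrywise LI F ->
  entrywise LI (fun x => (F x)^t*).
Proof. by move=> ?; apply: entrywise_adj => //; exact: class_module_LI. Qed.

Lemma ewsum_Lsq p q (I : Type) (r : seq I) (F : I -> T -> 'M[C]_(p, q)) :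
  (forall i, entrywise Lsq (F i)) -> entrywise Lsq (fun x => \sum_(i <- r) F i x).
Proof. by move=> H; apply: entrywise_sum => //; exact: class_module_Lsq. Qed.

Lemma ewsum_LI p q (I : Type) (r : seq I) (F : I -> T -> 'M[C]_(p, q)) :
  (forall i, entrywise LI (F i)) -> entrywise LI (fun x => \sum_(i <- r) F i x).
Proof. by move=> H; apply: entrywise_sum => //; exact: class_module_LI. Qed.

Lemma cdot_Lsq k (F G : T -> 'cV[C]_k) : entrywise Lsq F -> entrywise Lsq G ->
  cclass Lint (fun x => dot (F x) (G x)).
Proof.
move=> cF cG; have mL := class_module_Lsq mu mD.
by apply: (cclass_dot _ _ cF cG mL); [exact: class_module_Lint|exact: class_mul_Lsq].
Qed.

Lemma cdot_LI_Lint k (F G : T -> 'cV[C]_k) : entrywise LI F -> entrywise Lint G ->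
  cclass Lint (fun x => dot (F x) (G x)).
Proof.
move=> cF cG; have mL := class_module_Lint mu mD.
by apply: (cclass_dot mL _ cF cG mL); exact: class_mul_LI_Lint.
Qed.

Lemma cdot_Lint_LI k (F G : T -> 'cV[C]_k) : entrywise Lint F -> entrywise LI G ->
  cclass Lint (fun x => dot (F x) (G x)).
Proof.
move=> cF cG; have mL := class_module_Lint mu mD.
apply: (cclass_dot mL _ cF cG (class_module_LI mu D)) => f g cf cg.
by under eq_fun do rewrite mulrC; exact: class_mul_LI_Lint.
Qed.

Lemma cclassD_Lint (f g : T -> C) : cclass Lint f -> cclass Lint g ->
  cclass Lint (fun x => f x + g x).
Proof. by move=> ? ?; apply: cclassD => //; exact: class_module_Lint. Qed.

Lemma cclassB_Lint (f g : T -> C) : cclass Lint f -> cclass Lint g ->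
  cclass Lint (fun x => f x - g x).
Proof. by move=> ? ?; apply: cclassB => //; exact: class_module_Lint. Qed.

Lemma cclassZ_Lint (c : C) (f : T -> C) : cclass Lint f -> cclass Lint (fun x => c * f x).
Proof.
by move=> cf; apply: (cclassM _ _ (cclass_LI_cst mu D c) cf); [exact: class_module_Lint|exact: class_mul_LI_Lint].
Qed.

Lemma cclass_conj_Lint (f : T -> C) : cclass Lint f -> cclass Lint (fun x => (f x)^*).
Proof. by move=> ?; apply: cclass_conj => //; exact: class_module_Lint. Qed.

End EntrywiseClasses.

(** * Volterra equations for complex vectors *)

Section VectorPrimitive.
Context {R : realType}.
Notation C := R[i].
Notation leb := (@lebesgue_measure R).
Variables (T : R).
Hypothesis T0 : 0 < T.
Notation IT := (`[0, T]%classic : set R).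
Notation LI := (ess_bounded leb IT).
Notation Lint := (integrableR leb IT).
Notation bm := (bounded_meas T).

Definition vprim k (F : R -> 'cV[C]_k) (t : R) : 'cV[C]_k :=
  \col_a cint leb `[0, t] (fun s => F s a 0).

Lemma Re_vprim k (F : R -> 'cV[C]_k) t a b :
  complex.Re (vprim F t a b) = prim 0 (fun s => complex.Re (F s a 0)) t.
Proof. by rewrite mxE. Qed.

Lemma Im_vprim k (F : R -> 'cV[C]_k) t a b :
  complex.Im (vprim F t a b) = prim 0 (fun s => complex.Im (F s a 0)) t.
Proof. by rewrite mxE. Qed.

Lemma Lint_sub f t : t <= T -> Lint f -> integrableR leb `[0, t] f.
Proof. by move=> tT; exact: integrable_itvS. Qed.

Lemma entrywise_Lint_sub p q (F : R -> 'M[C]_(p, q)) t : t <= T ->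
  entrywise Lint F -> entrywise (integrableR leb `[0, t]) F.
Proof. by move=> tT; apply: entrywise_sub => g; exact: Lint_sub. Qed.

Lemma vprimD k (F G : R -> 'cV[C]_k) t : t <= T -> entrywise Lint F ->
  entrywise Lint G -> vprim (fun s => F s + G s) t = vprim F t + vprim G t.
Proof.
move=> tT iF iG; apply/colP => a; rewrite !mxE.
have mt : measurable (`[0, t]%classic : set (measurableTypeR R)) by exact: measurable_itv.
rewrite -(cintD mt (entrywise_Lint_sub tT iF a 0) (entrywise_Lint_sub tT iG a 0)).
by apply: eq_cint => s _; rewrite mxE.
Qed.

Lemma vprimZ k (c : C) (F : R -> 'cV[C]_k) t : t <= T -> entrywise Lint F ->
  vprim (fun s => c *: F s) t = c *: vprim F t.
Proof.
move=> tT iF; apply/colP => a; rewrite !mxE.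
have mt : measurable (`[0, t]%classic : set (measurableTypeR R)) by exact: measurable_itv.
rewrite -(cintZl mt _ (entrywise_Lint_sub tT iF a 0)).
by apply: eq_cint => s _; rewrite mxE.
Qed.

Lemma eq_vprim k (F G : R -> 'cV[C]_k) t : t <= T ->
  (forall s, 0 <= s <= T -> F s = G s) -> vprim F t = vprim G t.
Proof.
move=> tT FG; apply/colP => a; rewrite !mxE; apply: eq_cint => s.
by rewrite /= in_itv/= => /andP[s0 st]; rewrite FG// s0 (le_trans st).
Qed.

Lemma vprim_bm k (F : R -> 'cV[C]_k) : entrywise Lint F -> entrywise bm (vprim F).
Proof.
move=> iF a b; have [i1 i2] := iF a 0; split.
  under eq_fun do rewrite Re_vprim; exact: prim_bounded_meas.
under eq_fun do rewrite Im_vprim; exact: prim_bounded_meas.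
Qed.

Lemma LI_bm_Lint k (K : R -> 'M[C]_k) (w : R -> 'cV[C]_k) :
  entrywise LI K -> entrywise bm w -> entrywise Lint (fun t => K t *m w t).
Proof.
move=> cK cw; have mT := measurable_IT T.
have cw' : entrywise LI w by apply: entrywise_sub cw => g; exact: bounded_meas_LI.
have := ewM_LI cK cw'; move/(ew_LI_Lsq mT (finite_IT T)).
exact: (ew_Lsq_Lint mT (finite_IT T)).
Qed.

Section ComplexVolterra.
Variables (k : nat) (K : R -> 'M[C]_k).
Hypothesis cK : entrywise LI K.

Let I : finType := (bool * 'I_k)%type.

(** Realification: the indices [(false, a)] and [(true, a)] stand for the real and imaginary parts
    of coordinate [a], and [Kr] is the real matrix of multiplication by [K t] in these
    coordinates. *)
Let Kr (x y : I) (t : R) : R :=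
  if x.1 == y.1 then complex.Re (K t x.2 y.2)
  else if x.1 then complex.Im (K t x.2 y.2) else - complex.Im (K t x.2 y.2).

Let coord (w : R -> 'cV[C]_k) (x : I) (t : R) : R :=
  if x.1 then complex.Im (w t x.2 0) else complex.Re (w t x.2 0).

Let sumKr (w : I -> R -> R) x t : \sum_y Kr x y t * w y t =
  if x.1 then complex.Im ((K t *m (\col_a Complex (w (false, a) t) (w (true, a) t))) x.2 0)
  else complex.Re ((K t *m (\col_a Complex (w (false, a) t) (w (true, a) t))) x.2 0).
Proof.
have -> : \sum_y Kr x y t * w y t = \sum_c \sum_b Kr x (c, b) t * w (c, b) t.
  by rewrite pair_bigA; apply: eq_bigr => -[].
rewrite big_bool/=.
rewrite mxE cRe_sum cIm_sum; case: x => -[] a /=; rewrite /Kr/=.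
  rewrite addrC -big_split/=; apply: eq_bigr => b _.
  by rewrite cImM !mxE/= addrC.
rewrite -big_split/=; apply: eq_bigr => b _.
by rewrite cReM !mxE/= mulNr addrC.
Qed.

Let Kr_LI : exists2 c : R, 0 < c & (forall x y, measurable_fun IT (Kr x y)) /\
  {ae leb, forall t, 0 <= t <= T -> forall x y, `|Kr x y t| <= c}.
Proof.
have L x y : LI (Kr x y).
  have [l1 l2] := cK x.2 y.2; rewrite /Kr; case: (x.1 == y.1) => //; case: x.1 => //.
  by have [_ _ N] := class_module_LI leb IT; exact: N.
have /choice[c Hc] : forall p : I * I, exists c : R,
    {ae leb, forall t, IT t -> `|Kr p.1 p.2 t| <= c}.
  by move=> p; have [_] := L p.1 p.2.
exists (1 + \sum_p `|c p|); first by rewrite ltr_wpDr// sumr_ge0.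
split; first by move=> x y; have [] := L x y.
apply: aeS (ae_forall_fin Hc) => t Ht tT x y.
have := Ht (x, y); rewrite /= in_itv => /(_ tT) /le_trans; apply.
rewrite (le_trans (ler_norm _))// (bigD1 (x, y))//= addrCA lerDl.
by rewrite addr_ge0// sumr_ge0.
Qed.

Lemma cvolterra_exists b : entrywise bm b -> exists w : R -> 'cV[C]_k,
  entrywise bm w /\
  forall t, 0 <= t <= T -> w t = b t + vprim (fun s => K s *m w s) t.
Proof.
move=> bb; have [c c0 [mK Kc]] := Kr_LI.
have bc x : bm (coord b x).
  by rewrite /coord; case: x => -[] a /=; have [] := bb a 0.
have [w [bw wE]] := volterra_exists c0 mK Kc bc.
exists (fun t => \col_a Complex (w (false, a) t) (w (true, a) t)); split.
  move=> a j; split.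
    by have := bw (false, a); congr bounded_meas; apply/funext => t; rewrite mxE.
  by have := bw (true, a); congr bounded_meas; apply/funext => t; rewrite mxE.
move=> t tT; apply/colP => a; apply: complex_ext.
  rewrite [in RHS]mxE cReD Re_vprim mxE/= wE//; congr (_ + _).
  by apply: eq_Rintegral => s _; rewrite sumKr.
rewrite [in RHS]mxE cImD Im_vprim mxE/= wE//; congr (_ + _).
by apply: eq_Rintegral => s _; rewrite sumKr.
Qed.

Lemma cvolterra_unique (w : R -> 'cV[C]_k) : entrywise bm w ->
  (forall t, 0 <= t <= T -> w t = vprim (fun s => K s *m w s) t) ->
  forall t, 0 <= t <= T -> w t = 0.
Proof.
move=> bw wE t tT; have [c c0 [mK Kc]] := Kr_LI.
have bc x : bm (coord w x).
  by rewrite /coord; case: x => -[] a /=; have [] := bw a 0.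
have H x : coord w x t = 0.
  apply: (volterra_unique c0 mK Kc bc) => // {x} [[[] a]] s sT; rewrite {1}/coord/= wE//.
    rewrite Im_vprim; apply: eq_Rintegral => r _; rewrite sumKr/=; congr complex.Im.
    by congr ((_ *m _) _ _); apply/colP => i; rewrite mxE; apply: complex_ext.
  rewrite Re_vprim; apply: eq_Rintegral => r _; rewrite sumKr/=; congr complex.Re.
  by congr ((_ *m _) _ _); apply/colP => i; rewrite mxE; apply: complex_ext.
apply/colP => a; rewrite [RHS]mxE; apply: complex_ext.
  exact: (H (false, a)).
exact: (H (true, a)).
Qed.

End ComplexVolterra.
End VectorPrimitive.

(** * Complex equations with jumps and Green's formula *)

Section ComplexJump.
Context {R : realType} (N : nat) (tk : nat -> R) (T : R).
Hypotheses (tk0 : tk 0 = 0) (tkT : tk N.+1 = T).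
Hypothesis tk_lt : forall k : nat, (k <= N)%N -> tk k < tk k.+1.
Notation C := R[i].
Notation leb := (@lebesgue_measure R).
Notation IT := (`[0, T]%classic : set R).
Notation LI := (ess_bounded leb IT).
Notation Lint := (integrableR leb IT).
Notation bm := (bounded_meas T).

Let T0 : 0 < T. Proof. exact: period_gt0 tk0 tkT tk_lt. Qed.
Let mT : measurable (IT : set (measurableTypeR R)). Proof. exact: measurable_IT. Qed.

Definition csol k (F : R -> 'cV[C]_k) (J : 'I_N -> 'cV[C]_k) (w : R -> 'cV[C]_k) :=
  forall t, 0 <= t <= T -> w t = w 0 + Jsum tk J t + vprim F t.

Lemma Re_Jsum k (J : 'I_N -> 'cV[C]_k) t a b :
  complex.Re (Jsum tk J t a b) = Jsum tk (fun i => complex.Re (J i a b)) t.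
Proof. by rewrite summxE cRe_sum. Qed.

Lemma Im_Jsum k (J : 'I_N -> 'cV[C]_k) t a b :
  complex.Im (Jsum tk J t a b) = Jsum tk (fun i => complex.Im (J i a b)) t.
Proof. by rewrite summxE cIm_sum. Qed.

Lemma csolP k (F : R -> 'cV[C]_k) (J : 'I_N -> 'cV[C]_k) (w : R -> 'cV[C]_k) :
  csol F J w <-> forall a b,
    int_sol tk T (fun t => complex.Re (F t a b)) (fun i => complex.Re (J i a b))
      (fun t => complex.Re (w t a b)) /\
    int_sol tk T (fun t => complex.Im (F t a b)) (fun i => complex.Im (J i a b))
      (fun t => complex.Im (w t a b)).
Proof.
split=> [H a b|H t tT].
  rewrite ord1; split => t tT; rewrite [in LHS](H t tT).
    by rewrite [in LHS]mxE cReD Re_vprim [in LHS]mxE cReD Re_Jsum.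
  by rewrite [in LHS]mxE cImD Im_vprim [in LHS]mxE cImD Im_Jsum.
apply/matrixP => a b; rewrite ord1; have [h1 h2] := H a 0; apply: complex_ext.
  by rewrite h1// [in RHS]mxE cReD Re_vprim [in RHS]mxE cReD Re_Jsum.
by rewrite h2// [in RHS]mxE cImD Im_vprim [in RHS]mxE cImD Im_Jsum.
Qed.

Lemma csol_bm k (F : R -> 'cV[C]_k) J w : entrywise Lint F -> csol F J w ->
  entrywise bm w.
Proof.
move=> iF /csolP H a b; have [h1 h2] := H a b; have [i1 i2] := iF a b.
by split; [exact: (int_sol_bounded tk0 tkT tk_lt i1 h1)|exact: (int_sol_bounded tk0 tkT tk_lt i2 h2)].
Qed.

Lemma csolD k (F G : R -> 'cV[C]_k) J J' w w' : entrywise Lint F -> entrywise Lint G ->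
  csol F J w -> csol G J' w' ->
  csol (fun t => F t + G t) (fun i => J i + J' i) (fun t => w t + w' t).
Proof.
move=> iF iG hw hw' t tT; rewrite (hw t)// (hw' t)// (vprimD _ iF iG); last by case/andP: tT.
rewrite /Jsum big_split/= [LHS]addrACA; congr (_ + _); exact: addrACA.
Qed.

Lemma csolZ k c (F : R -> 'cV[C]_k) J w : entrywise Lint F -> csol F J w ->
  csol (fun t => c *: F t) (fun i => c *: J i) (fun t => c *: w t).
Proof.
move=> iF hw t tT; rewrite (hw t)// (vprimZ c _ iF); last by case/andP: tT.
by rewrite /Jsum -scaler_sumr !scalerDr.
Qed.

Lemma eq_csol k (F G : R -> 'cV[C]_k) J J' w w' :
  (forall t, 0 <= t <= T -> F t = G t) -> (forall i, J i = J' i) ->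
  (forall t, 0 <= t <= T -> w t = w' t) ->
  csol F J w -> csol G J' w'.
Proof.
move=> FG JJ ww H t tT.
rewrite -(ww t)// -(ww 0) ?lexx ?ltW// (H t)// (eq_vprim _ FG); last by case/andP: tT.
by congr (_ + _ + _); apply: eq_bigr => i _; exact: JJ.
Qed.

(** Lagrange's identity: the product of [x] with the conjugate of [z] is differentiated
    coordinatewise, and each jump of [z] contributes at its knot. Real and imaginary parts combine
    the four scalar integrations by parts [rr], [ii], [ir] and [ri]. *)
Lemma green k (h g x z : R -> 'cV[C]_k) (J : 'I_N -> 'cV[C]_k) :
  entrywise Lint h -> entrywise Lint g -> csol h (fun=> 0) x -> csol g J z ->
  dot (x T) (z T) - dot (x 0) (z 0) =
    cint leb IT (fun t => dot (h t) (z t) + dot (x t) (g t)) +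
    \sum_(i < N) dot (x (tk i.+1)) (J i).
Proof.
move=> ih ig hx hz.
have bx := csol_bm ih hx; have bz := csol_bm ig hz.
have Ix a b := ih a b; have Ig a b := ig a b.
have intM (u v : R -> R) : Lint u -> bm v -> Lint (fun t => u t * v t).
  move=> iu [mv [K vK]].
  by refine (@integrable_bddM R _ _ leb _ mT u v K iu mv _) => t; rewrite /= in_itv; exact: vK.
have intM' (u v : R -> R) : bm u -> Lint v -> Lint (fun t => u t * v t).
  move=> bu iv; have := intM _ _ iv bu.
  by congr integrableR; apply/funext => t; exact: mulrC.
have scal a : x T a 0 * (z T a 0)^* - x 0 a 0 * (z 0 a 0)^* =
    cint leb IT (fun t => h t a 0 * (z t a 0)^* + x t a 0 * (g t a 0)^*) +
    \sum_(i < N) x (tk i.+1) a 0 * (J i a 0)^*.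
  have [hxr hxi] := (csolP _ _ _).1 hx a 0.
  have [hzr hzi] := (csolP _ _ _).1 hz a 0.
  have {}hxr : int_sol tk T (fun t => complex.Re (h t a 0)) (fun _ : 'I_N => 0) (fun t => complex.Re (x t a 0)).
    by move: hxr; congr int_sol; apply/funext => i; rewrite mxE.
  have {}hxi : int_sol tk T (fun t => complex.Im (h t a 0)) (fun _ : 'I_N => 0) (fun t => complex.Im (x t a 0)).
    by move: hxi; congr int_sol; apply/funext => i; rewrite mxE.
  have [ihr ihi] := ih a 0; have [igr igi] := ig a 0.
  have [bxr bxi] := bx a 0; have [bzr bzi] := bz a 0.
  have rr := int_sol_ibp tk0 tkT tk_lt ihr igr hxr hzr.
  have ii := int_sol_ibp tk0 tkT tk_lt ihi igi hxi hzi.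
  have ir := int_sol_ibp tk0 tkT tk_lt ihi igr hxi hzr.
  have ri := int_sol_ibp tk0 tkT tk_lt ihr igi hxr hzi.
  have iD (u1 v1 u2 v2 : R -> R) : Lint u1 -> bm v1 -> bm u2 -> Lint v2 ->
      Lint (fun t => u1 t * v1 t + u2 t * v2 t).
    by move=> *; apply: integrableRD => //; [exact: intM|exact: intM'].
  apply: complex_ext.
    rewrite cReB !cReM !cRe_conj !cIm_conj cReD cRe_sum /=.
    have -> : \int[leb]_(t in IT) complex.Re (h t a 0 * (z t a 0)^* + x t a 0 * (g t a 0)^*) =
      prim 0 (fun t => complex.Re (h t a 0) * complex.Re (z t a 0) + complex.Re (x t a 0) * complex.Re (g t a 0)) T +
      prim 0 (fun t => complex.Im (h t a 0) * complex.Im (z t a 0) + complex.Im (x t a 0) * complex.Im (g t a 0)) T.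
      rewrite /prim -RintegralD//; [|exact: iD..].
      by apply: eq_Rintegral => t _; rewrite cReD !cReM !cRe_conj !cIm_conj; ring.
    have -> : \sum_(i < N) complex.Re (x (tk i.+1) a 0 * (J i a 0)^*) =
       \sum_(i < N) complex.Re (x (tk i.+1) a 0) * complex.Re (J i a 0) +
       \sum_(i < N) complex.Im (x (tk i.+1) a 0) * complex.Im (J i a 0).
      rewrite -big_split; apply: eq_bigr => i _ /=.
      by rewrite cReM cRe_conj cIm_conj; ring.
    move: rr ii; lra.
  rewrite cImB !cImM !cRe_conj !cIm_conj cImD cIm_sum /=.
  have -> : \int[leb]_(t in IT) complex.Im (h t a 0 * (z t a 0)^* + x t a 0 * (g t a 0)^*) =
    prim 0 (fun t => complex.Im (h t a 0) * complex.Re (z t a 0) + complex.Im (x t a 0) * complex.Re (g t a 0)) T -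
    prim 0 (fun t => complex.Re (h t a 0) * complex.Im (z t a 0) + complex.Re (x t a 0) * complex.Im (g t a 0)) T.
    rewrite /prim -RintegralB//; [|exact: iD..].
    by apply: eq_Rintegral => t _; rewrite cImD !cImM !cRe_conj !cIm_conj; ring.
  have -> : \sum_(i < N) complex.Im (x (tk i.+1) a 0 * (J i a 0)^*) =
     \sum_(i < N) complex.Im (x (tk i.+1) a 0) * complex.Re (J i a 0) -
     \sum_(i < N) complex.Re (x (tk i.+1) a 0) * complex.Im (J i a 0).
    rewrite -sumrB; apply: eq_bigr => i _ /=.
    by rewrite cImM cRe_conj cIm_conj; ring.
  move: ir ri; lra.
rewrite /dot -sumrB (eq_bigr _ (fun a _ => scal a)) big_split/=; congr (_ + _); last first.
  by rewrite exchange_big.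
rewrite -cint_sum//; first by apply: eq_cint => t _; rewrite big_split.
move=> a; apply: cclassD_Lint => //.
  apply: (cclassM (P1 := Lint) (P2 := bm)); [exact: class_module_Lint|exact: intM|exact: ih|].
  by apply: cclass_conj; [exact: class_module_bm|exact: bz].
apply: (cclassM (P1 := bm) (P2 := Lint)); [exact: class_module_Lint|exact: intM'|exact: bx|].
by apply: cclass_conj; [exact: class_module_Lint|exact: ig].
Qed.

(** The jump may depend linearly on the value of the unknown at the knot, as the jump of [z] depends
    on [p] in the coupled systems. *)
Definition lin_sol k (K : R -> 'M[C]_k) (Jm : 'I_N -> 'M[C]_k) (g : R -> 'cV[C]_k)
    (gi : 'I_N -> 'cV[C]_k) (w : R -> 'cV[C]_k) : Prop :=
  [/\ entrywise bm w,
      csol (fun t => K t *m w t + g t) (fun i => Jm i *m w (tk i.+1) + gi i) w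
    & w T = w 0].

Lemma Jsum_bm k (J : 'I_N -> 'cV[C]_k) : entrywise bm (Jsum tk J).
Proof.
have H (j : 'I_N -> R) : bm (Jsum tk j).
  have -> : Jsum tk j = (fun t => \sum_(i < N) (cst (j i) \_ `]tk i.+1, +oo[) t).
    apply/funext => t; rewrite /Jsum big_mkcond/=; apply: eq_bigr => i _.
    by rewrite patchE mem_setE in_itv/= andbT.
  apply: class_sum => [|i _]; first exact: class_module_bm.
  split.
    apply/(measurable_restrict _ _ _) => //; exact: measurable_cst.
  exists `|j i| => t _; rewrite patchE; case: ifP => // _.
  by rewrite normr0.
move=> a b; split.
  by under eq_fun do rewrite Re_Jsum.
by under eq_fun do rewrite Im_Jsum.
Qed.

End ComplexJump.

(** * Fredholm alternative for periodic problems with jumps *)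

Lemma linear_inj_surj (F : fieldType) (V : vectType F) (f : V -> V) :
  linear f -> (forall v, f v = 0 -> v = 0) -> forall y, exists x, f x = y.
Proof.
move=> lf f0 y.
pose fL : {linear V -> V} := HB.pack f (GRing.isLinear.Build F V V *:%R f lf).
have fE v : linfun fL v = f v by rewrite lfunE.
have k0 : lker (linfun fL) == 0%VS.
  apply/lker0P => u v; rewrite !fE => uv; apply/eqP; rewrite -subr_eq0; apply/eqP/f0.
  by rewrite -[f _]/(fL _) linearB /= uv subrr.
have lf1 : limg (linfun fL) = fullv.
  apply/eqP; rewrite eqEdim subvf -(limg_ker_dim (linfun fL) fullv).
  by rewrite (eqP k0) capv0 dimv0 add0n leqnn.
have : y \in limg (linfun fL) by rewrite lf1 memvf.
by move/memv_imgP => [x _ ->]; exists x; rewrite fE.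
Qed.

Section Fredholm.
Context {R : realType} (N : nat) (tk : nat -> R) (T : R).
Hypotheses (tk0 : tk 0 = 0) (tkT : tk N.+1 = T).
Hypothesis tk_lt : forall k : nat, (k <= N)%N -> tk k < tk k.+1.
Notation C := R[i].
Notation leb := (@lebesgue_measure R).
Notation IT := (`[0, T]%classic : set R).
Notation LI := (ess_bounded leb IT).
Notation Lint := (integrableR leb IT).
Notation bm := (bounded_meas T).
Variables (k : nat) (K : R -> 'M[C]_k) (Jm : 'I_N -> 'M[C]_k).
Hypothesis cK : entrywise LI K.

Let T0 : 0 < T. Proof. exact: period_gt0 tk0 tkT tk_lt. Qed.
Let mT : measurable (IT : set (measurableTypeR R)). Proof. exact: measurable_IT. Qed.

Let P : vectType C := ('cV[C]_k * {ffun 'I_N -> 'cV[C]_k})%type.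

(* The unknown values at [0] and at the jump points are treated as parameters;
   periodicity and consistency at the jump points are then linear conditions on
   them, as many as there are parameters. *)
Let Psol (p : P) (g : R -> 'cV[C]_k) (gi : 'I_N -> 'cV[C]_k) (w : R -> 'cV[C]_k) :=
  entrywise bm w /\ forall t, 0 <= t <= T ->
    w t = p.1 + Jsum tk (fun i => Jm i *m p.2 i + gi i) t + vprim g t +
      vprim (fun s => K s *m w s) t.

Let bmD := entrywiseD (class_module_bm T).

Let LintKw (w : R -> 'cV[C]_k) : entrywise bm w -> entrywise Lint (fun s => K s *m w s).
Proof. exact: LI_bm_Lint. Qed.

Let Lint0 : entrywise Lint (fun=> (0 : 'cV[C]_k)).
Proof. by apply: entrywise0; exact: class_module_Lint. Qed.

Let bm_cstR (c : R) : bm (fun=> c).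
Proof. by split; [exact: measurable_cst|exists `|c|]. Qed.

Let bm_cst (v : 'cV[C]_k) : entrywise bm (fun=> v).
Proof. by move=> a b; split; exact: bm_cstR. Qed.

Let bmZ (c : C) (w : R -> 'cV[C]_k) : entrywise bm w -> entrywise bm (fun t => c *: w t).
Proof.
move=> bw; apply: (entrywise_scale (P1 := bm) (P2 := bm)) => //.
- exact: class_module_bm.
- move=> f h [mf [A fA]] [mh [B hB]]; split; first exact: measurable_funM.
  by exists (A * B) => t tT; rewrite normrM ler_pM ?fA ?hB.
Qed.

Let Psol_exists p g gi : entrywise Lint g -> exists w, Psol p g gi w.
Proof.
move=> ig.
pose b t := p.1 + Jsum tk (fun i => Jm i *m p.2 i + gi i) t + vprim g t.
have bb : entrywise bm b.
  by apply: bmD; [apply: bmD; [exact: bm_cst|exact: Jsum_bm]|exact: vprim_bm].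
have [w [bw wE]] := cvolterra_exists cK bb.
by exists w.
Qed.

Let vprim_at0 (g : R -> 'cV[C]_k) : vprim g 0 = 0.
Proof. by apply/colP => a; apply: complex_ext; rewrite ?Re_vprim ?Im_vprim prim_id mxE. Qed.

(** Linearity jointly in the parameters and in the free terms, so that homogeneous solutions can
    later be added to a particular one. *)
Let Psol_lin c p q g h gi hi w w' : entrywise Lint g -> entrywise Lint h ->
  Psol p g gi w -> Psol q h hi w' ->
  Psol (c *: p + q) (fun t => c *: g t + h t) (fun i => c *: gi i + hi i)
    (fun t => c *: w t + w' t).
Proof.
move=> ig ih [bw wE] [bw' wE']; split.
  by apply: bmD => //; exact: bmZ.
move=> t tT; have tT' : t <= T by case/andP: tT.
have iZg := ewZ_Lint mT c ig; have iKw := LintKw bw.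
rewrite (eq_vprim (F := fun s => K s *m (c *: w s + w' s))
  (G := fun s => c *: (K s *m w s) + K s *m w' s) tT'); last first.
  by move=> s _ /=; rewrite mulmxDr -scalemxAr.
rewrite (vprimD tT' iZg ih) (vprimZ c tT' ig) (vprimD tT' (ewZ_Lint mT c iKw) (LintKw bw')).
rewrite (vprimZ c tT' iKw) (wE t tT) (wE' t tT).
have -> : Jsum tk (fun i => Jm i *m (c *: p + q).2 i + (c *: gi i + hi i)) t =
    c *: Jsum tk (fun i => Jm i *m p.2 i + gi i) t + Jsum tk (fun i => Jm i *m q.2 i + hi i) t.
  rewrite /Jsum scaler_sumr -big_split; apply: eq_bigr => i _ /=.
  by rewrite !ffunE mulmxDr -scalemxAr scalerDr addrACA.
by rewrite /= !scalerDr !addrA; apply/colP => a; rewrite !mxE; ring.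
Qed.

Let Psol_uniq p g gi w w' : entrywise Lint g -> Psol p g gi w -> Psol p g gi w' ->
  forall t, 0 <= t <= T -> w t = w' t.
Proof.
move=> ig [bw wE] [bw' wE'] t tT.
have bN := bmZ (-1) bw'; have bd := bmD bw bN.
suff : w t + (-1) *: w' t = 0 by rewrite scaleN1r => /eqP; rewrite subr_eq0 => /eqP.
apply: (cvolterra_unique cK bd _ tT) => {t tT} t tT.
have tT' : t <= T by case/andP: tT.
rewrite (eq_vprim (G := fun s => K s *m w s + (-1) *: (K s *m w' s)) tT'); last first.
  by move=> s _ /=; rewrite mulmxDr -scalemxAr.
rewrite (vprimD tT' (LintKw bw) (ewZ_Lint mT _ (LintKw bw'))) (vprimZ _ tT' (LintKw bw')).
by rewrite {1}(wE t tT) {1}(wE' t tT) !scaleN1r opprD addrACA subrr add0r.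
Qed.

Let Psol_0 p g gi w : Psol p g gi w -> w 0 = p.1.
Proof.
move=> [_ ->]; last by rewrite lexx ltW.
by rewrite !vprim_at0 Jsum0// !addr0.
Qed.

Let Psol_lin_sol p g gi w : entrywise Lint g -> Psol p g gi w -> w T = p.1 ->
  (forall i : 'I_N, w (tk i.+1) = p.2 i) -> lin_sol tk T K Jm g gi w.
Proof.
move=> ig /[dup] /Psol_0 w0 [bw wE] wT wi; split; rewrite ?w0//.
move=> t tT; have tT' : t <= T by case/andP: tT.
rewrite w0 (vprimD tT' (LintKw bw) ig) (wE t tT) -!addrA; congr (_ + _).
rewrite [vprim g t + _]addrC; congr (_ + _); apply: eq_bigr => i _.
by rewrite wi.
Qed.

(** The mismatches at [T] and at the knots form a linear map [L] of the parameter space into itself.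
    A parameter in its kernel yields a homogeneous periodic solution, so [L] is injective, hence
    onto, and can cancel the mismatch of any particular solution. *)
Theorem fredholm_alternative :
  (forall w, lin_sol tk T K Jm (fun=> 0) (fun=> 0) w -> forall t, 0 <= t <= T -> w t = 0) ->
  forall g gi, entrywise Lint g -> exists w, lin_sol tk T K Jm g gi w.
Proof.
move=> hom g gi ig.
have TT : 0 <= T <= T by rewrite lexx ltW.
have OT : (0 : R) <= 0 <= T by rewrite lexx ltW.
have kT (i : 'I_N) : 0 <= tk i.+1 <= T by exact: knot_inT.
have /choice[sol Hsol] : forall p : P, exists w, Psol p (fun=> 0) (fun=> 0) w.
  by move=> p; apply: Psol_exists.
pose L (p : P) : P := (sol p T - p.1, [ffun i : 'I_N => sol p (tk i.+1) - p.2 i]).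
have solL c p q t : 0 <= t <= T -> sol (c *: p + q) t = c *: sol p t + sol q t.
  have := Psol_lin c Lint0 Lint0 (Hsol p) (Hsol q).
  have -> : (fun t : R => c *: (0 : 'cV[C]_k) + 0) = fun=> 0.
    by apply/funext => ?; rewrite scaler0 addr0.
  have -> : (fun i : 'I_N => c *: (0 : 'cV[C]_k) + 0) = fun=> 0.
    by apply/funext => ?; rewrite scaler0 addr0.
  by move=> H tT; exact: (Psol_uniq Lint0 (Hsol _) H tT).
have lL : linear L.
  move=> c p q; rewrite /L; congr (_, _).
    by rewrite solL//= scalerBr opprD addrACA.
  apply/ffunP => i; rewrite !ffunE solL//=.
  by rewrite scalerBr opprD addrACA.
have L0 p : L p = 0 -> p = 0.
  move=> [/eqP + /ffunP Li]; rewrite subr_eq0 => /eqP LT.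
  have wi (i : 'I_N) : sol p (tk i.+1) = p.2 i.
    by have /eqP := Li i; rewrite !ffunE subr_eq0 => /eqP.
  have z := hom _ (Psol_lin_sol Lint0 (Hsol p) LT wi).
  rewrite [LHS]surjective_pairing; congr (_, _).
    by rewrite -(Psol_0 (Hsol p)) z.
  by apply/ffunP => i; rewrite -wi z// ffunE.
(* The particular solution with all parameters 0: its mismatch is simply its values at [T] and at
   the knots. *)
have [w0 Hw0] := Psol_exists 0 gi ig.
have [p Lp] := linear_inj_surj lL L0 (- (w0 T, [ffun i : 'I_N => w0 (tk i.+1)])).
case: Lp => LT /ffunP Li.
have := Psol_lin 1 Lint0 ig (Hsol p) Hw0.
have -> : (fun t => 1 *: (0 : 'cV[C]_k) + g t) = g.
  by apply/funext => ?; rewrite scaler0 add0r.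
have -> : (fun i => 1 *: (0 : 'cV[C]_k) + gi i) = gi.
  by apply/funext => ?; rewrite scaler0 add0r.
rewrite addr0 scale1r => Hw.
exists (fun t => 1 *: sol p t + w0 t); apply: (Psol_lin_sol ig Hw).
  by rewrite scale1r; move/eqP: LT; rewrite subr_eq => /eqP ->; rewrite addrAC addNr add0r.
move=> i; have := Li i; rewrite !ffunE scale1r => /eqP; rewrite subr_eq => /eqP ->.
by rewrite addrAC addNr add0r.
Qed.

End Fredholm.

(** * Adjoint matrices, positive definite forms and Cauchy-Schwarz *)

Section HermitianAlgebra.
Context {R : realType}.
Notation C := R[i].

Lemma ctM p q r (A : 'M[C]_(p, q)) (B : 'M[C]_(q, r)) : (A *m B)^t* = B^t* *m A^t*.
Proof. by rewrite trmx_mul map_mxM. Qed.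

Lemma ctD p q (A B : 'M[C]_(p, q)) : (A + B)^t* = A^t* + B^t*.
Proof. by apply/matrixP => a b; rewrite !mxE rmorphD. Qed.

Lemma ctN p q (A : 'M[C]_(p, q)) : (- A)^t* = - A^t*.
Proof. by apply/matrixP => a b; rewrite !mxE rmorphN. Qed.

Lemma ctK p q (A : 'M[C]_(p, q)) : (A^t*)^t* = A.
Proof. by apply/matrixP => a b; rewrite !mxE conjCK. Qed.

Lemma ct0 p q : (0 : 'M[C]_(p, q))^t* = 0.
Proof. by apply/matrixP => a b; rewrite !mxE rmorph0. Qed.

Lemma ct1 k : (1%:M : 'M[C]_k)^t* = 1%:M.
Proof. by apply/matrixP => a b; rewrite !mxE eq_sym rmorph_nat. Qed.

Lemma dotE k (x y : 'cV[C]_k) : dot x y = (y^t* *m x) 0 0.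
Proof. by rewrite mxE; apply: eq_bigr => a _; rewrite !mxE mulrC. Qed.

Lemma dotC k (x y : 'cV[C]_k) : dot y x = (dot x y)^*.
Proof. by rewrite rmorph_sum; apply: eq_bigr => a _; rewrite rmorphM /= conjCK mulrC. Qed.

Lemma dotDl k (x y z : 'cV[C]_k) : dot (x + y) z = dot x z + dot y z.
Proof. by rewrite !dotE mulmxDr mxE. Qed.

Lemma dotDr k (x y z : 'cV[C]_k) : dot x (y + z) = dot x y + dot x z.
Proof. by rewrite !dotE ctD mulmxDl mxE. Qed.

Lemma dotNl k (x y : 'cV[C]_k) : dot (- x) y = - dot x y.
Proof. by rewrite !dotE mulmxN mxE. Qed.

Lemma dotNr k (x y : 'cV[C]_k) : dot x (- y) = - dot x y.
Proof. by rewrite !dotE ctN mulNmx mxE. Qed.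

Lemma dotBl k (x y z : 'cV[C]_k) : dot (x - y) z = dot x z - dot y z.
Proof. by rewrite dotDl dotNl. Qed.

Lemma dotBr k (x y z : 'cV[C]_k) : dot x (y - z) = dot x y - dot x z.
Proof. by rewrite dotDr dotNr. Qed.

Lemma dotZl k c (x y : 'cV[C]_k) : dot (c *: x) y = c * dot x y.
Proof. by rewrite !dotE -scalemxAr mxE. Qed.

Lemma dotZr k c (x y : 'cV[C]_k) : dot x (c *: y) = c^* * dot x y.
Proof. by rewrite dotC dotZl rmorphM /= -dotC. Qed.

Lemma dot0l k (y : 'cV[C]_k) : dot 0 y = 0.
Proof. by rewrite dotE mulmx0 mxE. Qed.

Lemma dot0r k (x : 'cV[C]_k) : dot x 0 = 0.
Proof. by rewrite dotC dot0l rmorph0. Qed.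

Lemma dot_suml k (I : Type) (r : seq I) (F : I -> 'cV[C]_k) y :
  dot (\sum_(i <- r) F i) y = \sum_(i <- r) dot (F i) y.
Proof. by apply: (big_morph (fun x => dot x y)) => [u v|]; [exact: dotDl|exact: dot0l]. Qed.

Lemma dot_sumr k (I : Type) (r : seq I) (F : I -> 'cV[C]_k) x :
  dot x (\sum_(i <- r) F i) = \sum_(i <- r) dot x (F i).
Proof. by apply: (big_morph (dot x)) => [u v|]; [exact: dotDr|exact: dot0r]. Qed.

Lemma dot_adjr p q (A : 'M[C]_(p, q)) x y : dot (A *m x) y = dot x (A^t* *m y).
Proof. by rewrite !dotE ctM ctK mulmxA. Qed.

Lemma dot_adjl p q (A : 'M[C]_(p, q)) x y : dot x (A *m y) = dot (A^t* *m x) y.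
Proof. by rewrite dot_adjr ctK. Qed.

Lemma dotxx k (x : 'cV[C]_k) : dot x x = Complex (vnorm2 x) 0.
Proof.
apply: complex_ext; rewrite /dot ?cRe_sum ?cIm_sum /=.
  by rewrite vnorm2E; apply: eq_bigr => a _; rewrite cReM cRe_conj cIm_conj; ring.
by rewrite big1// => a _; rewrite cImM cRe_conj cIm_conj; ring.
Qed.

Lemma vnorm2_eq0 k (x : 'cV[C]_k) : vnorm2 x = 0 -> x = 0.
Proof.
move=> x0; apply/colP => a; rewrite mxE.
have /eqP := x0; rewrite vnorm2E psumr_eq0; last by move=> i _; rewrite addr_ge0 ?sqr_ge0.
move/allP => /(_ a); rewrite mem_index_enum => /(_ isT)/=.
rewrite paddr_eq0 ?sqr_ge0// !sqrf_eq0 => /andP[/eqP r0 /eqP i0].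
exact: complex_ext.
Qed.

Lemma dot_eq0 k (y : 'cV[C]_k) : (forall x, dot x y = 0) -> y = 0.
Proof. by move=> /(_ y); rewrite dotxx => -[/vnorm2_eq0]. Qed.

Lemma tr_mul_adj k (D : 'M[C]_k) (x : 'cV[C]_k) : \tr (D *m (x *m x^t*)) = dot (D *m x) x.
Proof. by rewrite mulmxA mxtrace_mulC dotE /mxtrace big_ord1. Qed.

Section PositiveDefinite.
Variables (k : nat) (S : 'M[C]_k).
Hypothesis pS : posdefmx S.

(** The conjugate of a row in the left kernel is, as [S] is Hermitian, a vector at which the form
    vanishes. *)
Lemma posdef_unit : S \in unitmx.
Proof.
have [_ pos] := pS; rewrite -row_free_unit -kermx_eq0; apply/eqP/row_matrixP => i.
rewrite row0; apply/eqP; apply: contrapT => /negP ri.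
have k0 : row i (kermx S) *m S = 0 by rewrite -row_mul mulmx_ker row0.
have : (row i (kermx S))^t* != 0.
  by apply: contra_neq ri => H; rewrite -[row _ _]ctK H ct0.
move/pos; rewrite -{1}pS.1 -ctM k0 ct0 dot0l ltxx; exact.
Qed.

Lemma posdef_invadj : (invmx S)^t* = invmx S.
Proof.
have uS := posdef_unit.
have : (invmx S)^t* *m S = 1%:M by rewrite -{2}pS.1 -ctM mulmxV ?ct1.
by move/(congr1 (mulmx^~ (invmx S))); rewrite mulmxK// mul1mx.
Qed.

Lemma posdef_ge0 v : 0 <= dot (S *m v) v.
Proof.
have [->|v0] := eqVneq v 0; first by rewrite dot0r.
by apply/ltW/pS.2.
Qed.

Lemma posdef_eq0 v : dot (S *m v) v = 0 -> v = 0.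
Proof.
move=> H; apply/eqP; apply: contrapT => /negP v0.
by have := pS.2 _ v0; rewrite H ltxx.
Qed.

Lemma posdef_inv : posdefmx (invmx S).
Proof.
have uS := posdef_unit; split; first exact: posdef_invadj.
move=> v v0; have -> : v = S *m (invmx S *m v) by rewrite mulKVmx.
rewrite [invmx S *m (S *m _)]mulKmx// dotC; set u := invmx S *m v.
have : u != 0 by apply: contra_neq v0 => H; rewrite -[v](mulKVmx uS) -/u H mulmx0.
move=> /pS.2 H; have := H; rewrite ltcE => /andP[/eqP i0 r0].
rewrite ltcE cIm_conj cRe_conj r0 andbT; apply/eqP.
by move: i0 => /= ->; rewrite oppr0.
Qed.

End PositiveDefinite.

(* [dot (S (x + s S^-1 y)) (x + s S^-1 y) >= 0] *)
Lemma posdef_young k (S : 'M[C]_k) (x y : 'cV[C]_k) (s : C) : posdefmx S ->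
  0 <= complex.Re (dot (S *m x) x) + 2 * complex.Re (s^* * dot x y) +
       Normc.normc s ^+ 2 * complex.Re (dot (invmx S *m y) y).
Proof.
move=> pS; have uS := posdef_unit pS.
have := posdef_ge0 pS (x + s *: (invmx S *m y)).
rewrite mulmxDr -scalemxAr mulKVmx// !dotDl !dotDr !dotZl !dotZr.
rewrite lecE => /andP[_] /=.
have -> : dot (S *m x) (invmx S *m y) = dot x y.
  by rewrite dot_adjl posdef_invadj// mulKmx.
have -> : dot y x = (dot x y)^* by rewrite dotC.
have -> : dot y (invmx S *m y) = dot (invmx S *m y) y.
  by rewrite dot_adjl posdef_invadj.
rewrite normc2 !cReD !cReM !cImM !cRe_conj !cIm_conj.
set a := complex.Re (dot _ _); set b := complex.Re (dot x y); set c := complex.Im (dot x y).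
set e := complex.Re (dot (invmx S *m y) y); set f := complex.Im (dot (invmx S *m y) y).
have -> : f = 0.
  have := posdef_ge0 (posdef_inv pS) y; rewrite lecE => /andP[/eqP].
  by rewrite /f => ->.
by move=> H; apply: le_trans H _; rewrite le_eqVlt; apply/orP; left; apply/eqP; ring.
Qed.

(* A nonnegative quadratic in the complex variable [s] has nonpositive discriminant. *)
Lemma young_cauchy_schwarz (p q : R) (b : C) : 0 <= p -> 0 <= q ->
  (forall s : C, 0 <= p + 2 * complex.Re (s^* * b) + Normc.normc s ^+ 2 * q) ->
  Normc.normc b ^+ 2 <= p * q.
Proof.
move=> p0 q0 H.
(* The choice [s = - r * b] makes the mixed term real and negative for positive [r]. *)
have H' (r : R) : 0 <= p - 2 * r * Normc.normc b ^+ 2 + r ^+ 2 * Normc.normc b ^+ 2 * q.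
  have := H (- (Complex r 0) * b); congr (_ <= _).
  rewrite rmorphM rmorphN /= !normc2 !cReM !cImM !cRe_conj !cIm_conj !cReN !cImN /=.
  by ring.
set B := Normc.normc b ^+ 2 in H' *.
have B0 : 0 <= B by exact: sqr_ge0.
have [q00|qn0] := eqVneq q 0.
  rewrite q00 mulr0; apply: contrapT => /negP; rewrite -ltNge => Bp.
  (* For [q = 0] the expression is affine in [r], and this [r] gives it the negative value
     [- p - 2]. *)
  have := H' ((p + 1) / B); rewrite q00 mulr0 addr0 -mulrA divfK ?gt_eqF//; lra.
have {}q0 : 0 < q by rewrite lt_neqAle eq_sym qn0.
(* The minimum over [r] is attained at the inverse of [q]. *)
have := mulr_ge0 (H' q^-1) (ltW q0).
have -> : (p - 2 * q^-1 * B + q^-1 ^+ 2 * B * q) * q = p * q - B.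
  by field; rewrite gt_eqF.
by rewrite subr_ge0.
Qed.

End HermitianAlgebra.

(** * Regularity of the data and integral form of the equations of the setting *)

Section SettingData.
Context {R : realType} {n r m l N M : nat}.
Variable S : setting R n r m l N M.
Hypothesis HS : standing S.
Notation C := R[i].
Notation leb := (@lebesgue_measure R).
Notation T := (period S).
Notation tk := (knot S).
Notation IT := (`[0, T]%classic : set R).
Notation I0T := (`]0, T[%classic : set R).
Notation LI := (ess_bounded leb IT).
Notation Lsq := (sq_integrable leb IT).
Notation Lint := (integrableR leb IT).
Notation bm := (bounded_meas T).

Lemma T_gt0 : 0 < T.
Proof. exact: period_gt0 (knot_first HS) (knot_last HS) (knot_lt HS). Qed.

Lemma mIT : measurable (IT : set (measurableTypeR R)).
Proof. exact: measurable_IT. Qed.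

Lemma fIT : (leb IT < +oo)%E.
Proof. exact: finite_IT. Qed.

Lemma knotT (i : 'I_N) : 0 <= tk i.+1 <= T.
Proof. exact: knot_inT (knot_first HS) (knot_last HS) (knot_lt HS) i. Qed.

Lemma mOmega j : measurable (Omega S j : set (measurableTypeR R)).
Proof. by have := is_interval_measurable (@Omega_interval _ _ _ _ _ _ _ _ HS j). Qed.

Lemma Omega_IT j : Omega S j `<=` IT.
Proof. by move=> t /(Omega_sub HS). Qed.

Lemma fOmega j : (leb (Omega S j) < +oo)%E.
Proof.
apply: le_lt_trans fIT; apply: le_measure; rewrite ?inE.
- exact: mOmega.
- exact: mIT.
- exact: Omega_IT.
Qed.

Lemma continuous_LI p q (F : R -> 'M[C]_(p, q)) :
  entrywise (fun g : R -> R => continuous g) F -> entrywise LI F.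
Proof.
apply: entrywise_sub => g cg.
have wg : {within IT, continuous g} by apply: continuous_subspaceT => x; exact: cg.
have [K gK] := within_continuous_bounded wg.
apply: bounded_meas_LI; split; last by exists K.
exact: (subspace_continuous_measurable_fun mIT wg).
Qed.

Lemma A_LI : entrywise LI (A S).
Proof. exact: continuous_LI (A_continuous HS). Qed.

Lemma B_LI : entrywise LI (B S).
Proof. exact: continuous_LI (B_continuous HS). Qed.

Lemma Qinv_LI : entrywise LI (fun t => invmx (Q S t)).
Proof.
by apply: entrywise_sub (Linfty_LI (Qinv_Linfty HS)) => g; exact: (ess_bounded_I0T_IT T_gt0).
Qed.

Lemma Q_LI : entrywise LI (Q S).
Proof.
by apply: entrywise_sub (Linfty_LI (Q_Linfty HS)) => g; exact: (ess_bounded_I0T_IT T_gt0).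
Qed.

Lemma L2_I0T k (f : R -> 'cV[C]_k) : L2 I0T f -> entrywise Lsq f.
Proof.
move=> /(entrywise_LsqP _ (measurable_I0T T)).
by apply: entrywise_sub => g; exact: (sq_integrable_I0T_IT T_gt0).
Qed.

Lemma f0_Lsq : entrywise Lsq (f0 S). Proof. exact: L2_I0T (f0_L2 HS). Qed.

Lemma l0_Lsq : entrywise Lsq (l0 S). Proof. exact: L2_I0T (l0_L2 HS). Qed.

Lemma Bt_LI : entrywise LI (fun t => (B S t)^t*).
Proof. exact (ew_adj_LI B_LI). Qed.

Lemma Qtilde_LI : entrywise LI (Qtilde S).
Proof. exact (ewM_LI (ewM_LI B_LI Qinv_LI) Bt_LI). Qed.

Lemma bm_LI p q (F : R -> 'M[C]_(p, q)) : entrywise bm F -> entrywise LI F.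
Proof. by apply: entrywise_sub => g; exact: bounded_meas_LI. Qed.

Lemma LI_Lsq_IT p q (F : R -> 'M[C]_(p, q)) : entrywise LI F -> entrywise Lsq F.
Proof. exact (ew_LI_Lsq mIT fIT). Qed.

Lemma Lsq_Lint_IT p q (F : R -> 'M[C]_(p, q)) : entrywise Lsq F -> entrywise Lint F.
Proof. exact (ew_Lsq_Lint mIT fIT). Qed.

Lemma bm_Lsq p q (F : R -> 'M[C]_(p, q)) : entrywise bm F -> entrywise Lsq F.
Proof. by move=> /bm_LI; exact: LI_Lsq_IT. Qed.

Lemma Hc_LI j : entrywise (ess_bounded leb (Omega S j)) (Hc S j).
Proof.
move=> a b; have [c1 c2] := Hc_continuous HS j a b; have [K HK] := Hc_bounded HS j.
split; split.
- exact: (subspace_continuous_measurable_fun (mOmega j) c1).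
- by exists K; apply: aeW => t Ot; rewrite (le_trans (Re_le_normc _)) ?HK.
- exact: (subspace_continuous_measurable_fun (mOmega j) c2).
- by exists K; apply: aeW => t Ot; rewrite (le_trans (Im_le_normc _)) ?HK.
Qed.

Lemma Dc_LI j : entrywise (ess_bounded leb (Omega S j)) (Dc S j).
Proof. exact: Linfty_LI (Dc_Linfty HS j). Qed.

Lemma Dcinv_LI j : entrywise (ess_bounded leb (Omega S j)) (fun t => invmx (Dc S j t)).
Proof. exact: Linfty_LI (Dcinv_Linfty HS j). Qed.

Lemma LI_IT_Omega p q (F : R -> 'M[C]_(p, q)) j : entrywise LI F ->
  entrywise (ess_bounded leb (Omega S j)) F.
Proof.
apply: entrywise_sub => g [mg [K gK]]; split.
  exact: (measurable_funS mIT (@Omega_IT j) mg).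
by exists K; apply: aeS gK => t H /Omega_IT.
Qed.

Lemma chi_LI j p q (F : R -> 'M[C]_(p, q)) :
  entrywise (ess_bounded leb (Omega S j)) F -> entrywise LI (fun t => chi S j t *: F t).
Proof.
apply: (entrywise_restrict (A := Omega S j)) => g.
exact: (ess_bounded_restrict (mOmega j) mIT (@Omega_IT j)).
Qed.

Lemma chi_Lsq j p q (F : R -> 'M[C]_(p, q)) :
  entrywise (sq_integrable leb (Omega S j)) F -> entrywise Lsq (fun t => chi S j t *: F t).
Proof.
apply: (entrywise_restrict (A := Omega S j)) => g.
exact: (sq_integrable_restrict (mOmega j) mIT (@Omega_IT j)).
Qed.

Lemma cint_chi j (f : R -> C) : cint leb IT (fun t => chi S j t * f t) = cint leb (Omega S j) f.
Proof. exact: (@cint_restrict R _ _ leb (Omega S j) IT f (@Omega_IT j)). Qed.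

Lemma cint_I0T_IT (f : R -> C) : cclass Lint f -> cint leb I0T f = cint leb IT f.
Proof. by move=> cf; have := cLint_meas cf; move/cint_I0T. Qed.

(** [Vc] and [Vd] are the two parts of observation followed by weighting and by the adjoint of
    observation; [backload] is the continuous part of that adjoint applied to weights [u]. *)
Definition Vc (t : R) : 'M[C]_n :=
  \sum_j chi S j t *: ((Hc S j t)^t* *m Dc S j t *m Hc S j t).

Definition Vd (i : 'I_N) : 'M[C]_n := (Hd S i)^t* *m Dd S i *m Hd S i.

Definition backload (u : @obs_family R m l N M) (t : R) : 'cV[C]_n :=
  \sum_j chi S j t *: ((Hc S j t)^t* *m u.2 j t).

Lemma HDH_LI j : entrywise (ess_bounded leb (Omega S j))
  (fun t => (Hc S j t)^t* *m Dc S j t *m Hc S j t).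
Proof. exact (ewM_LI (ewM_LI (ew_adj_LI (Hc_LI j)) (Dc_LI j)) (Hc_LI j)). Qed.

Lemma Vc_LI : entrywise LI Vc.
Proof. by apply: ewsum_LI => j; exact: chi_LI (HDH_LI j). Qed.

Lemma in_H_Lsq (u : @obs_family R m l N M) : in_H S u -> forall j,
  entrywise (sq_integrable leb (Omega S j)) (u.2 j).
Proof. by move=> uH j; apply/(entrywise_LsqP _ (mOmega j)); exact: uH. Qed.

Lemma Lsq_in_H (u : @obs_family R m l N M) :
  (forall j, entrywise (sq_integrable leb (Omega S j)) (u.2 j)) -> in_H S u.
Proof. by move=> uH j; apply/(entrywise_LsqP _ (mOmega j)); exact: uH. Qed.

Lemma backload_Lsq u : in_H S u -> entrywise Lsq (backload u).
Proof.
move=> /in_H_Lsq uH; apply: (ewsum_Lsq mIT) => j; apply: chi_Lsq.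
exact: (ewM_LI_Lsq (mOmega j) (ew_adj_LI (Hc_LI j)) (uH j)).
Qed.

Lemma pjs_jump F J (z : R -> 'cV[C]_n) : periodic_jump_solution S F J z <->
  (forall a b,
    jump_sol tk T (fun t => complex.Re (F t a b)) (fun i => complex.Re (J i a b))
      (fun t => complex.Re (z t a b)) /\
    jump_sol tk T (fun t => complex.Im (F t a b)) (fun i => complex.Im (J i a b))
      (fun t => complex.Im (z t a b))) /\ z T = z 0.
Proof.
split.
  move=> [zk z0 dz zJ zT]; split => // a b; split; split.
  - by move=> k kN; have [h1 h2] := zk k kN; split; [have [] := h1 a b|have [] := h2 a b].
  - by have [] := z0 a b.
  - apply: aeS dz => t H tT; have It : I0T t by rewrite /= in_itv.
    by case: (H It a b).
  - by move=> i; have [] := zJ i a b; rewrite !mxE !cReD.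
  - by move=> k kN; have [h1 h2] := zk k kN; split; [have [] := h1 a b|have [] := h2 a b].
  - by have [] := z0 a b.
  - apply: aeS dz => t H tT; have It : I0T t by rewrite /= in_itv.
    by case: (H It a b).
  - by move=> i; have [] := zJ i a b; rewrite !mxE !cImD.
move=> [H zT]; split => //.
- move=> k kN; split => a b; have [[h1 _ _ _] [h2 _ _ _]] := H a b;
  by have [? ?] := h1 k kN; have [? ?] := h2 k kN.
- by move=> a b; have [[_ ? _ _] [_ ? _ _]] := H a b.
- have : forall p : 'I_n * 'I_1, {ae leb, forall t, 0 < t < T ->
      is_derive t 1 (fun s => complex.Re (z s p.1 p.2)) (complex.Re (F t p.1 p.2)) /\
      is_derive t 1 (fun s => complex.Im (z s p.1 p.2)) (complex.Im (F t p.1 p.2))}.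
    move=> [a b]; have [[_ _ d1 _] [_ _ d2 _]] := H a b.
    by apply: aeS2 d1 d2 => t h1 h2 tT; split; [exact: h1|exact: h2].
  move/ae_forall_fin; apply: aeS => t Ht; rewrite /= in_itv/= => tT a b.
  exact: (Ht (a, b)).
- move=> i a b; have [[_ _ _ h1] [_ _ _ h2]] := H a b.
  by rewrite mxE cReD cImD; split; [exact: h1|exact: h2].
Qed.

Lemma pjs_bm F J (z : R -> 'cV[C]_n) : periodic_jump_solution S F J z -> entrywise bm z.
Proof.
move=> /pjs_jump[H _] a b; have [h1 h2] := H a b; split.
  exact: (jump_sol_bounded (knot_first HS) (knot_last HS) (knot_lt HS) h1).
exact: (jump_sol_bounded (knot_first HS) (knot_last HS) (knot_lt HS) h2).
Qed.

(** Entry by entry this is the equivalence of [jump_sol] and [int_sol]; periodicity is carried along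
    unchanged. *)
Lemma pjs_csol F J (z : R -> 'cV[C]_n) : entrywise Lint F ->
  periodic_jump_solution S F J z <-> csol tk T F J z /\ z T = z 0.
Proof.
move=> iF; split=> [/pjs_jump[H zT]|[/csolP H zT]].
  split => //; apply/csolP => a b; have [i1 i2] := iF a b; have [h1 h2] := H a b.
  split; first exact: (jump_sol_int (knot_first HS) (knot_last HS) (knot_lt HS) i1 h1).
  exact: (jump_sol_int (knot_first HS) (knot_last HS) (knot_lt HS) i2 h2).
apply/pjs_jump; split => // a b; have [i1 i2] := iF a b; have [h1 h2] := H a b.
split.
  exact: (int_sol_jump (knot_first HS) (knot_last HS) (knot_lt HS) i1 h1).
exact: (int_sol_jump (knot_first HS) (knot_last HS) (knot_lt HS) i2 h2).
Qed.

End SettingData.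

(** * Homogeneous periodic state and adjoint equations *)

Section PeriodicHomogeneous.
Context {R : realType} {n r m l N M : nat}.
Variable S : setting R n r m l N M.
Hypothesis HS : standing S.
Notation C := R[i].
Notation leb := (@lebesgue_measure R).
Notation T := (period S).
Notation tk := (knot S).
Notation IT := (`[0, T]%classic : set R).
Notation I0T := (`]0, T[%classic : set R).
Notation LI := (ess_bounded leb IT).
Notation Lsq := (sq_integrable leb IT).
Notation Lint := (integrableR leb IT).
Notation bm := (bounded_meas T).
Variable X : R -> 'M[C]_n.
Hypothesis HX : fundamental_matrix S X.
Hypothesis detX : \det (1%:M - X T) != 0.

Let T0 : 0 < T. Proof. exact: T_gt0 HS. Qed.
Let OT : (0 : R) <= 0 <= T. Proof. by rewrite lexx ltW. Qed.
Let TT : 0 <= T <= T. Proof. by rewrite lexx ltW. Qed.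

(** A bounded derivative everywhere makes [f] Lipschitz by the mean value theorem. *)
Lemma is_derive_lipschitz (f g : R -> R) (K : R) :
  (forall t : R, is_derive t (1 : R) f (g t)) -> (forall t, 0 <= t <= T -> `|g t| <= K) ->
  abs_continuous IT f.
Proof.
move=> df gK; apply: (@abs_continuous_lipschitz _ _ _ (`|K| + 1)).
  by rewrite ltr_wpDl.
have cf x : {for x, continuous f}.
  by apply: differentiable_continuous; apply/derivable1_diffP; case: (df x).
move=> x y; wlog xy : x y / x <= y.
  move=> W Dx Dy; have [xy|/ltW yx] := leP x y; first exact: W.
  by rewrite distrC (distrC y); exact: W.
rewrite /= !in_itv/= => /andP[x0 xT] /andP[y0 yT].
have [c cxy ->] := MVT_segment xy (fun z _ => df z) (continuous_subspaceT cf).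
rewrite normrM ler_wpM2r// (le_trans (gK c _))//.
  by move: cxy; rewrite in_itv/= => /andP[xc cy]; rewrite (le_trans x0 xc) (le_trans cy yT).
by rewrite (le_trans (ler_norm K))// lerDl.
Qed.

Lemma fundamental_bm : entrywise bm X.
Proof.
have [_ dX] := HX.
have H (f : R -> R) : (forall t : R, derivable f t (1 : R)) -> bm f.
  move=> df; have cf : {within IT, continuous f}.
    by apply: derivable_within_continuous => x _; exact: df.
  split; first exact: (subspace_continuous_measurable_fun (mIT S) cf).
  exact: within_continuous_bounded cf.
move=> a b; split; apply: H => t; have [d1 d2] := dX t a b.
  by case: d1.
by case: d2.
Qed.

Lemma bm_const p q (v : 'M[C]_(p, q)) : entrywise bm (fun=> v).
Proof.
move=> a b; split; (split; first exact: measurable_cst).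
  by exists `|complex.Re (v a b)|.
by exists `|complex.Im (v a b)|.
Qed.

Lemma class_mul_bm : class_mul bm bm bm.
Proof.
move=> f h [mf [A1 fA]] [mh [B1 hB]]; split; first exact: measurable_funM.
by exists (A1 * B1) => t tT; rewrite normrM ler_pM ?fA ?hB.
Qed.

Lemma continuous_bm p q (F : R -> 'M[C]_(p, q)) :
  entrywise (fun g : R -> R => continuous g) F -> entrywise bm F.
Proof.
apply: entrywise_sub => g cg.
have wg : {within IT, continuous g} by apply: continuous_subspaceT => x; exact: cg.
have gb := within_continuous_bounded wg.
by split => //; exact: (subspace_continuous_measurable_fun (mIT S) wg).
Qed.

Lemma fundamental_csol (v : 'cV[C]_n) :
  csol tk T (fun t => A S t *m (X t *m v)) (fun _ : 'I_N => 0) (fun t => X t *m v).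
Proof.
have [X0 dX] := HX; have bX := fundamental_bm.
have bAX : entrywise bm (fun t => A S t *m X t).
  by apply: (entrywiseM (class_module_bm T) class_mul_bm); [exact: continuous_bm (A_continuous HS)|].
have XE t : 0 <= t <= T -> forall a b, X t a b = X 0 a b + cint leb `[0, t] (fun s => (A S s *m X s) a b).
  move=> /andP[t0 tT] a b.
  have [[m1 [K1 b1]] [m2 [K2 b2]]] := bAX a b.
  have [i1 i2] := Lsq_Lint_IT (bm_Lsq bAX) a b.
  have ac1 := is_derive_lipschitz (fun s => (dX s a b).1) b1.
  have ac2 := is_derive_lipschitz (fun s => (dX s a b).2) b2.
  have sub : (`[0, t] `<=` IT)%classic.
    by move=> s /=; rewrite !in_itv/= => /andP[-> /le_trans ->].
  apply: complex_ext; rewrite ?cReD ?cImD /=.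
    apply: (abs_continuous_FTC t0 (abs_continuousS sub ac1) (Lint_sub tT i1)).
    by apply: aeW => s _; have [] := dX s a b.
  apply: (abs_continuous_FTC t0 (abs_continuousS sub ac2) (Lint_sub tT i2)).
  by apply: aeW => s _; have [] := dX s a b.
move=> t tT; rewrite /Jsum big1// addr0; apply/colP => a; rewrite !mxE.
have mt : measurable (`[0, t]%classic : set (measurableTypeR R)) by exact: measurable_itv.
have tT' : t <= T by case/andP: tT.
have iAX := entrywise_Lint_sub tT' (Lsq_Lint_IT (bm_Lsq bAX)).
rewrite (eq_cint leb (g := fun s => \sum_b v b 0 * (A S s *m X s) a b)); last first.
  by move=> s _; rewrite mulmxA mxE; apply: eq_bigr => b _; rewrite mulrC.
rewrite (cint_sum mt); last first.
  by move=> b; apply: (cclassZ_Lint mt); exact: iAX.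
rewrite -big_split/=; apply: eq_bigr => b _.
by rewrite (cintZl mt _ (iAX a b)) (XE t tT) mulrDl [v b 0 * _]mulrC.
Qed.

Lemma csol_homogeneous_unique k (K : R -> 'M[C]_k) w : entrywise LI K -> entrywise bm w ->
  csol tk T (fun t => K t *m w t) (fun _ : 'I_N => 0) w -> w 0 = 0 ->
  forall t, 0 <= t <= T -> w t = 0.
Proof.
move=> cK bw Hw w0; apply: (cvolterra_unique cK bw) => t tT.
by rewrite {1}(Hw t tT) w0 add0r /Jsum big1 ?add0r.
Qed.

Let detXu : (1%:M - X T) \in unitmx. Proof. by rewrite unitmxE unitfE. Qed.

(** Uniqueness of the initial value problem gives [x t = X t *m x 0]; periodicity puts [x 0] in the
    kernel of the invertible matrix [1%:M - X T]. *)
Lemma state_homogeneous x : entrywise bm x ->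
  csol tk T (fun t => A S t *m x t) (fun _ : 'I_N => 0) x -> x T = x 0 ->
  forall t, 0 <= t <= T -> x t = 0.
Proof.
move=> bx Hx xT; have AL := A_LI HS; have [X0 _] := HX.
have LX (w : R -> 'cV[C]_n) : entrywise bm w -> entrywise Lint (fun t => A S t *m w t).
  by move=> bw; exact (LI_bm_Lint AL bw).
pose y t := X t *m x 0.
have by_ : entrywise bm y.
  apply: (entrywiseM (class_module_bm T) class_mul_bm); first exact: fundamental_bm.
  exact (bm_const (x 0)).
have Hy : csol tk T (fun t => A S t *m y t) (fun _ : 'I_N => 0) y by exact: fundamental_csol.
pose d t := x t + (-1) *: y t.
have iy := ewZ_Lint (mIT S) (-1) (LX _ by_).
have Hd1 := csolD (LX _ bx) iy Hx (csolZ (-1) (LX _ by_) Hy).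
have bd : entrywise bm d.
  apply: csol_bm Hd1; [exact: knot_first|exact: knot_last|exact: knot_lt|].
  exact (ewD_Lint (mIT S) (LX _ bx) iy).
have Hd : csol tk T (fun t => A S t *m d t) (fun _ : 'I_N => 0) d.
  apply: eq_csol Hd1; [exact: knot_first|exact: knot_last|exact: knot_lt|..] => //.
    by move=> t _; rewrite mulmxDr -scalemxAr.
  by move=> i; rewrite scaler0 addr0.
have d0 : d 0 = 0 by rewrite /d /y X0 mul1mx scaleN1r subrr.
have dz := csol_homogeneous_unique AL bd Hd d0.
have xE t : 0 <= t <= T -> x t = X t *m x 0.
  by move=> /dz /eqP; rewrite /d scaleN1r subr_eq0 => /eqP.
have x0 : x 0 = 0.
  have : (1%:M - X T) *m x 0 = 0 by rewrite mulmxBl mul1mx -xE// xT subrr.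
  by move/(congr1 (mulmx (invmx (1%:M - X T)))); rewrite mulKmx// mulmx0.
by move=> t tT; rewrite xE// x0 mulmx0.
Qed.

(** Green's formula against all the solutions [X t *m v] shows that the adjoint of [1%:M - X T]
    annihilates [z 0]; the initial value problem does the rest. *)
Lemma adjoint_homogeneous z : entrywise bm z ->
  csol tk T (fun t => - (A S t)^t* *m z t) (fun _ : 'I_N => 0) z -> z T = z 0 ->
  forall t, 0 <= t <= T -> z t = 0.
Proof.
move=> bz Hz zT.
have AL : entrywise LI (fun t => - (A S t)^t*).
  apply: (entrywiseN (class_module_LI leb IT)); exact (ew_adj_LI (A_LI HS)).
have iz := LI_bm_Lint AL bz.
have z0 : z 0 = 0.
  have : (1%:M - X T)^t* *m z 0 = 0.
    apply: dot_eq0 => v; rewrite -dot_adjr mulmxBl mul1mx dotBl.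
    have iX : entrywise Lint (fun t => A S t *m (X t *m v)).
      apply: (LI_bm_Lint (A_LI HS)).
      apply: csol_bm (fundamental_csol v); [exact: knot_first|exact: knot_last|exact: knot_lt|].
      have := ewM_LI (A_LI HS) (bm_LI fundamental_bm) => H1.
      have cv : entrywise LI (fun=> v) by exact (entrywise_LI_cst leb IT v).
      have := ewM_LI H1 cv => /LI_Lsq_IT/Lsq_Lint_IT.
      by apply: entrywise_eq => t; rewrite mulmxA.
    have := green (knot_first HS) (knot_last HS) (knot_lt HS) iX iz (fundamental_csol v) Hz.
    have [-> _] := HX; rewrite mul1mx zT => H.
    apply/eqP; rewrite -oppr_eq0 opprB H big1 ?addr0; last by move=> i _; rewrite dot0r.
    rewrite (eq_cint leb (g := fun=> 0)) ?cint0// => t _.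
    by rewrite mulNmx dotNr dot_adjr subrr.
  move/(congr1 (mulmx (invmx (1%:M - X T)^t*))).
  by rewrite mulmxA -ctM mulmxV// ct1 mul1mx mulmx0.
exact: csol_homogeneous_unique AL bz Hz z0.
Qed.

End PeriodicHomogeneous.

(** * Existence for the single equations and the homogeneous coupled system *)

Section Solvability.
Context {R : realType} {n r m l N M : nat}.
Variable S : setting R n r m l N M.
Hypothesis HS : standing S.
Notation C := R[i].
Notation leb := (@lebesgue_measure R).
Notation T := (period S).
Notation tk := (knot S).
Notation IT := (`[0, T]%classic : set R).
Notation I0T := (`]0, T[%classic : set R).
Notation LI := (ess_bounded leb IT).
Notation Lsq := (sq_integrable leb IT).
Notation Lint := (integrableR leb IT).
Notation bm := (bounded_meas T).
Variable X : R -> 'M[C]_n.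
Hypothesis HX : fundamental_matrix S X.
Hypothesis detX : \det (1%:M - X T) != 0.

Let T0 : 0 < T. Proof. exact: T_gt0 HS. Qed.
Let k0 := knot_first HS.
Let kT := knot_last HS.
Let klt := knot_lt HS.

Lemma csol_col (F1 F2 : R -> 'cV[C]_n) (J1 J2 : 'I_N -> 'cV[C]_n) (z p : R -> 'cV[C]_n) :
  csol tk T (fun t => col_mx (F1 t) (F2 t)) (fun i => col_mx (J1 i) (J2 i))
    (fun t => col_mx (z t) (p t)) <-> csol tk T F1 J1 z /\ csol tk T F2 J2 p.
Proof.
have vE t : vprim (fun t => col_mx (F1 t) (F2 t)) t = col_mx (vprim F1 t) (vprim F2 t).
  apply/colP => a; case: (split_ordP a) => a' ->; rewrite ?col_mxEu ?col_mxEd !mxE;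
  by apply: eq_cint => s _; rewrite ?col_mxEu ?col_mxEd.
have JE t : Jsum tk (fun i => col_mx (J1 i) (J2 i)) t = col_mx (Jsum tk J1 t) (Jsum tk J2 t).
  rewrite /Jsum; apply: (big_rec3 (fun x y w => w = col_mx x y)); first by rewrite col_mx0.
  by move=> i x y w _ ->; rewrite add_col_mx.
split=> [H|[H1 H2] t tT].
  split=> t tT; have := H t tT; rewrite vE JE !add_col_mx => /eq_col_mx [? ?]; by [].
by rewrite vE JE !add_col_mx -H1// -H2.
Qed.

Lemma lin_sol_diff k (K : R -> 'M[C]_k) (Jm : 'I_N -> 'M[C]_k) g gi w w' : entrywise LI K ->
  entrywise Lint g -> lin_sol tk T K Jm g gi w -> lin_sol tk T K Jm g gi w' ->
  lin_sol tk T K Jm (fun=> 0) (fun _ : 'I_N => 0) (fun t => w t + (-1) *: w' t).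
Proof.
move=> cK ig [bw Hw wT] [bw' Hw' wT']; have mT := mIT S.
have iKw := LI_bm_Lint cK bw; have iKw' := LI_bm_Lint cK bw'.
have i1 := ewD_Lint mT iKw ig; have i2 := ewD_Lint mT iKw' ig.
have Hd := csolD i1 (ewZ_Lint mT (-1) i2) Hw (csolZ (-1) i2 Hw').
split; last by rewrite wT wT'.
  by apply: csol_bm Hd => //; exact (ewD_Lint mT i1 (ewZ_Lint mT (-1) i2)).
apply: eq_csol Hd => //.
  move=> t _; rewrite mulmxDr -scalemxAr addr0 !scaleN1r.
  by apply/matrixP => a b; rewrite !mxE; ring.
move=> i; rewrite mulmxDr -scalemxAr addr0 !scaleN1r.
by apply/matrixP => a b; rewrite !mxE; ring.
Qed.

(** The Fredholm alternative with zero jump matrices; its uniqueness condition is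
    [state_homogeneous]. *)
Lemma state_exists (g : R -> 'cV[C]_n) : entrywise Lint g -> exists x,
  [/\ entrywise bm x, csol tk T (fun t => A S t *m x t + g t) (fun _ : 'I_N => 0) x
    & x T = x 0].
Proof.
move=> ig.
have [|x [bx Hx xT]] := fredholm_alternative k0 kT klt (A_LI HS) (Jm := fun=> 0) _ (fun=> 0) ig.
  move=> w [bw Hw wT]; apply: (state_homogeneous HS HX detX bw) => //.
  apply: eq_csol Hw => //.
    by move=> t _; rewrite addr0.
  by move=> i; rewrite mul0mx addr0.
exists x; split => //; apply: eq_csol Hx => // i.
by rewrite mul0mx addr0.
Qed.

Lemma adjoint_exists (g : R -> 'cV[C]_n) (gi : 'I_N -> 'cV[C]_n) : entrywise Lint g ->
  exists z, [/\ entrywise bm z,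
    csol tk T (fun t => - (A S t)^t* *m z t + g t) gi z & z T = z 0].
Proof.
move=> ig.
have AL : entrywise LI (fun t => - (A S t)^t*).
  by apply: (entrywiseN (class_module_LI leb IT)); exact (ew_adj_LI (A_LI HS)).
have [|z [bz Hz zT]] := fredholm_alternative k0 kT klt AL (Jm := fun=> 0) _ gi ig.
  move=> w [bw Hw wT]; apply: (adjoint_homogeneous HS HX detX bw) => //.
  apply: eq_csol Hw => //.
    by move=> t _; rewrite addr0.
  by move=> i; rewrite mul0mx addr0.
exists z; split => //; apply: eq_csol Hz => // i.
by rewrite mul0mx add0r.
Qed.

Lemma Vc_ge0 t v : 0 <= dot (Vc S t *m v) v.
Proof.
rewrite /Vc mulmx_suml dot_suml; apply: sumr_ge0 => j _.
rewrite -scalemxAl dotZl /chi indicE; case: (boolP (t \in Omega S j)) => Ot; last by rewrite mul0r.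
rewrite mul1r -!mulmxA dot_adjr ctK; apply: posdef_ge0.
exact: (Dc_posdef HS (set_mem Ot)).
Qed.

Lemma Vd_ge0 i v : 0 <= dot (Vd S i *m v) v.
Proof.
rewrite /Vd -!mulmxA dot_adjr ctK; apply: posdef_ge0; exact: (Dd_posdef HS).
Qed.

Lemma Qtilde_ge0 t v : I0T t -> 0 <= dot (Qtilde S t *m v) v.
Proof.
move=> It; rewrite /Qtilde -!mulmxA dot_adjr; apply: posdef_ge0.
exact/posdef_inv/(Q_posdef HS).
Qed.

(** The form of [Qtilde] at [v] is the positive definite form of the inverse of [Q] at the adjoint
    of [B] applied to [v]; if it vanishes, so does that vector. *)
Lemma Qtilde_eq0 t v : I0T t -> dot (Qtilde S t *m v) v = 0 -> Qtilde S t *m v = 0.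
Proof.
move=> It; rewrite /Qtilde -!mulmxA dot_adjr => /posdef_eq0 ->; rewrite ?mulmx0//.
exact/posdef_inv/(Q_posdef HS).
Qed.

Lemma Vc_herm t x y : dot x (Vc S t *m y) = dot (Vc S t *m x) y.
Proof.
rewrite /Vc !mulmx_suml dot_suml dot_sumr; apply: eq_bigr => j _.
rewrite -!scalemxAl dotZl dotZr /chi indicE; case: (boolP (t \in Omega S j)) => Ot.
  rewrite rmorph1 !mul1r -!mulmxA dot_adjl ctK dot_adjr ctK dot_adjl.
  by rewrite (Dc_posdef HS (set_mem Ot)).1.
by rewrite rmorph0 !mul0r.
Qed.

Lemma Vd_herm i x y : dot x (Vd S i *m y) = dot (Vd S i *m x) y.
Proof.
by rewrite /Vd -!mulmxA dot_adjl ctK [RHS]dot_adjr ctK dot_adjl (Dd_posdef HS i).1.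
Qed.

Lemma Qtilde_herm t x y : I0T t -> dot x (Qtilde S t *m y) = dot (Qtilde S t *m x) y.
Proof.
move=> It; rewrite /Qtilde -!mulmxA dot_adjl [RHS]dot_adjr dot_adjl.
by rewrite (posdef_invadj (Q_posdef HS It)).
Qed.

(** The coupled system as one equation for [col_mx z p]: the off-diagonal blocks couple the
    equations, and [Jzp] lets the value of [p] at a knot produce the jump of [z]. *)
Definition Kzp t : 'M[C]_(n + n) := block_mx (- (A S t)^t*) (Vc S t) (Qtilde S t) (A S t).
Definition Jzp (i : 'I_N) : 'M[C]_(n + n) := block_mx 0 (Vd S i) 0 0.

Lemma Kzp_LI : entrywise LI Kzp.
Proof.
apply: entrywise_block; [|exact: Vc_LI|exact: Qtilde_LI|exact: A_LI] => //.
by apply: (entrywiseN (class_module_LI leb IT)); exact (ew_adj_LI (A_LI HS)).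
Qed.

Lemma lin_sol_zp (g1 g2 : R -> 'cV[C]_n) gi (z p : R -> 'cV[C]_n) :
  lin_sol tk T Kzp Jzp (fun t => col_mx (g1 t) (g2 t)) (fun i => col_mx (gi i) 0)
    (fun t => col_mx (z t) (p t)) <->
  [/\ entrywise bm z, entrywise bm p,
    csol tk T (fun t => - (A S t)^t* *m z t + Vc S t *m p t + g1 t)
      (fun i => Vd S i *m p (tk i.+1) + gi i) z,
    csol tk T (fun t => Qtilde S t *m z t + A S t *m p t + g2 t) (fun _ : 'I_N => 0) p &
    z T = z 0 /\ p T = p 0].
Proof.
have E1 : (fun t => Kzp t *m col_mx (z t) (p t) + col_mx (g1 t) (g2 t)) =
    (fun t => col_mx (- (A S t)^t* *m z t + Vc S t *m p t + g1 t)
      (Qtilde S t *m z t + A S t *m p t + g2 t)).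
  by apply/funext => t; rewrite mul_block_col add_col_mx.
have E2 : (fun i => Jzp i *m col_mx (z (tk i.+1)) (p (tk i.+1)) + col_mx (gi i) 0) =
    (fun i => col_mx (Vd S i *m p (tk i.+1) + gi i) 0).
  by apply/funext => i; rewrite mul_block_col add_col_mx !mul0mx !add0r.
split.
  move=> [bw Hw wT]; rewrite /= E1 E2 in Hw; move/csol_col: Hw => [h1 h2].
  split => //.
  - move=> a b; have := bw (lshift n a) b.
    by congr (_ /\ _); congr bounded_meas; apply/funext => t; rewrite col_mxEu.
  - move=> a b; have := bw (rshift n a) b.
    by congr (_ /\ _); congr bounded_meas; apply/funext => t; rewrite col_mxEd.
  - by move/eq_col_mx : wT => [].
move=> [bz bp hz hp [zT pT]]; split.
- exact: entrywise_col.
- by rewrite E1 E2; apply/csol_col.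
- by rewrite zT pT.
Qed.

(** Green's formula for [p] and [z] leaves the energy identity [E], in which three nonnegative terms
    add up to zero. Vanishing of the first gives [Qtilde z = 0] almost everywhere, so that [p]
    solves the homogeneous state equation; once [p] vanishes, [z] solves the homogeneous adjoint
    equation. *)
Lemma zp_homogeneous w : lin_sol tk T Kzp Jzp (fun=> 0) (fun _ : 'I_N => 0) w ->
  forall t, 0 <= t <= T -> w t = 0.
Proof.
pose z t := usubmx (w t); pose p t := dsubmx (w t).
have -> : w = fun t => col_mx (z t) (p t) by apply/funext => t; rewrite vsubmxK.
have -> : (fun _ : R => 0 : 'cV[C]_(n + n)) = (fun t : R => col_mx (0 : 'cV[C]_n) (0 : 'cV[C]_n)).
  by apply/funext => t; rewrite col_mx0.
have -> : (fun _ : 'I_N => 0 : 'cV[C]_(n + n)) = (fun i : 'I_N => col_mx (0 : 'cV[C]_n) (0 : 'cV[C]_n)).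
  by apply/funext => t; rewrite col_mx0.
move=> /lin_sol_zp[bz bp hz hp [zT pT]]; have mT := mIT S.
have iQz := LI_bm_Lint (Qtilde_LI HS) bz; have iAp := LI_bm_Lint (A_LI HS) bp.
have iVp := LI_bm_Lint (Vc_LI HS) bp.
have AL : entrywise LI (fun t => - (A S t)^t*).
  by apply: (entrywiseN (class_module_LI leb IT)); exact (ew_adj_LI (A_LI HS)).
have iAz := LI_bm_Lint AL bz.
have {}hz : csol tk T (fun t => - (A S t)^t* *m z t + Vc S t *m p t)
    (fun i => Vd S i *m p (tk i.+1)) z.
  by apply: eq_csol hz => // [t _|i]; rewrite addr0.
have {}hp : csol tk T (fun t => Qtilde S t *m z t + A S t *m p t) (fun _ : 'I_N => 0) p.
  by apply: eq_csol hp => // t _; rewrite addr0.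
have iz := ewD_Lint mT iAz iVp; have ip := ewD_Lint mT iQz iAp.
have G := green k0 kT klt ip iz hp hz.
have cQ : cclass Lint (fun t => dot (Qtilde S t *m z t) (z t)).
  exact (cdot_Lint_LI mT iQz (bm_LI bz)).
have cV : cclass Lint (fun t => dot (Vc S t *m p t) (p t)).
  exact (cdot_Lint_LI mT iVp (bm_LI bp)).
have E : cint leb IT (fun t => dot (Qtilde S t *m z t) (z t)) +
   cint leb IT (fun t => dot (Vc S t *m p t) (p t)) +
   \sum_(i < N) dot (Vd S i *m p (tk i.+1)) (p (tk i.+1)) = 0.
  move: G; rewrite zT pT subrr => /esym; apply: etrans; congr (_ + _).
    rewrite -(cintD mT cQ cV); apply: eq_cint => t _.
    rewrite dotDl dotDr mulNmx dotNr (dot_adjr (A S t)) Vc_herm; ring.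
  by apply: eq_bigr => i _; rewrite Vd_herm.
have Q0 : 0 <= cint leb IT (fun t => dot (Qtilde S t *m z t) (z t)).
  rewrite -(cint_I0T_IT cQ); apply: cint_ge0 => t It; exact: Qtilde_ge0.
have V0 : 0 <= cint leb IT (fun t => dot (Vc S t *m p t) (p t)).
  by apply: cint_ge0 => t _; exact: Vc_ge0.
have S0 : 0 <= \sum_(i < N) dot (Vd S i *m p (tk i.+1)) (p (tk i.+1)).
  by apply: sumr_ge0 => i _; exact: Vd_ge0.
have QZ : cint leb I0T (fun t => dot (Qtilde S t *m z t) (z t)) = 0.
  rewrite (cint_I0T_IT cQ); move/eqP: E.
  by rewrite paddr_eq0 ?addr_ge0// paddr_eq0// => /andP[/andP[/eqP ->]].
have [iq _] : cclass (integrableR leb I0T) (fun t => dot (Qtilde S t *m z t) (z t)).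
  by apply: cclass_sub cQ => g; apply: integrableS => //; exact: I0T_sub.
have Qae : {ae leb, forall t, I0T t -> Qtilde S t *m z t = 0}.
  have re0 t : I0T t -> 0 <= complex.Re (dot (Qtilde S t *m z t) (z t)).
    by move=> It; have := Qtilde_ge0 (z t) It; rewrite lecE => /andP[].
  have /ae_eq_integral_abs : (\int[leb]_(t in I0T) `|(complex.Re (dot (Qtilde S t *m z t) (z t)))%:E| = 0)%E.
    have := congr1 (@complex.Re R) QZ; rewrite /= /Rintegral => H0.
    rewrite -(fineK (integrable_fin_num (measurable_I0T T) iq)) in H0 *.
    rewrite -[RHS]/(0%:E) -{}[in RHS]H0 fineK; last first.
      by apply: integrable_fin_num => //; exact: measurable_I0T.
    by apply: eq_integral => t; rewrite inE => It; rewrite /= ger0_norm// re0.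
  move=> H; have := H (measurable_I0T T) (measurable_int _ iq).
  apply: aeS => t Ht It; apply: Qtilde_eq0 => //; apply: complex_ext.
    by have [] := Ht It.
  by have := Qtilde_ge0 (z t) It; rewrite lecE => /andP[/eqP].
(* The term [Qtilde z] is zero only almost everywhere; in integral form this suffices to drop it. *)
have p0 : forall t, 0 <= t <= T -> p t = 0.
  apply: (state_homogeneous HS HX detX bp) => // t tT.
  rewrite {1}(hp t tT); congr (_ + _); apply/colP => a; rewrite !mxE.
  have tT' : t <= T by case/andP: tT.
  have mt : measurable (`[0, t]%classic : set (measurableTypeR R)) by exact: measurable_itv.
  apply: (ae_eq_cint mt).
  - by apply: cLint_meas; exact (entrywise_Lint_sub tT' ip a 0).
  - by apply: cLint_meas; exact (entrywise_Lint_sub tT' iAp a 0).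
  apply: aeS2 (ae_I0T T) Qae => s H1 H2 /=; rewrite in_itv/= => /andP[s0 st].
  rewrite H2 ?add0r//; apply: H1; rewrite /= in_itv/= s0.
  exact: le_trans tT'.
have z0 : forall t, 0 <= t <= T -> z t = 0.
  apply: (adjoint_homogeneous HS HX detX bz) => //.
  apply: eq_csol hz => //.
    by move=> t tT; rewrite p0// mulmx0 addr0.
  by move=> i; rewrite p0 ?mulmx0//; exact: knotT.
by move=> t tT; rewrite z0// p0// col_mx0.
Qed.

End Solvability.

(** * Unique solvability of the two systems and the integral form of states *)

Section UniqueSolvability.
Context {R : realType} {n r m l N M : nat}.
Variable S : setting R n r m l N M.
Hypothesis HS : standing S.
Notation C := R[i].
Notation leb := (@lebesgue_measure R).
Notation T := (period S).
Notation tk := (knot S).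
Notation IT := (`[0, T]%classic : set R).
Notation I0T := (`]0, T[%classic : set R).
Notation LI := (ess_bounded leb IT).
Notation Lsq := (sq_integrable leb IT).
Notation Lint := (integrableR leb IT).
Notation bm := (bounded_meas T).
Variable X : R -> 'M[C]_n.
Hypothesis HX : fundamental_matrix S X.
Hypothesis detX : \det (1%:M - X T) != 0.

Let T0 : 0 < T. Proof. exact: T_gt0 HS. Qed.
Let k0 := knot_first HS.
Let kT := knot_last HS.
Let klt := knot_lt HS.
Let mT := mIT S.

Lemma adjA_LI : entrywise LI (fun t => - (A S t)^t*).
Proof. by apply: (entrywiseN (class_module_LI leb IT)); exact (ew_adj_LI (A_LI HS)). Qed.

(** Common form of both systems of the theorem, which have the same linear part and differ in the
    free terms. *)
Definition coupled_system (g1 : R -> 'cV[C]_n) (gi : 'I_N -> 'cV[C]_n)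
    (g2 : R -> 'cV[C]_n) (z p : R -> 'cV[C]_n) : Prop :=
  periodic_jump_solution S (fun t => - (A S t)^t* *m z t + Vc S t *m p t + g1 t)
    (fun i => Vd S i *m p (tk i.+1) + gi i) z /\
  periodic_jump_solution S (fun t => Qtilde S t *m z t + A S t *m p t + g2 t)
    (fun=> 0) p.

Lemma coupled_system_lin g1 gi g2 z p : entrywise Lint g1 -> entrywise Lint g2 ->
  coupled_system g1 gi g2 z p <->
  lin_sol tk T (Kzp S) (Jzp S) (fun t => col_mx (g1 t) (g2 t))
    (fun i => col_mx (gi i) 0) (fun t => col_mx (z t) (p t)).
Proof.
move=> i1 i2.
have H1 : entrywise bm z -> entrywise bm p ->
    entrywise Lint (fun t => - (A S t)^t* *m z t + Vc S t *m p t + g1 t).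
  move=> bz bp.
  exact (ewD_Lint mT (ewD_Lint mT (LI_bm_Lint adjA_LI bz) (LI_bm_Lint (Vc_LI HS) bp)) i1).
have H2 : entrywise bm z -> entrywise bm p ->
    entrywise Lint (fun t => Qtilde S t *m z t + A S t *m p t + g2 t).
  move=> bz bp.
  exact (ewD_Lint mT (ewD_Lint mT (LI_bm_Lint (Qtilde_LI HS) bz) (LI_bm_Lint (A_LI HS) bp)) i2).
split.
  (* Boundedness is read off the jump conditions first; it makes the right-hand sides integrable, as
     the integral form requires. *)
  move=> [hz hp]; have bz := pjs_bm HS hz; have bp := pjs_bm HS hp.
  have [cz zT] := (pjs_csol HS _ _ (H1 bz bp)).1 hz.
  have [cp pT] := (pjs_csol HS _ _ (H2 bz bp)).1 hp.
  exact/lin_sol_zp.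
move=> /lin_sol_zp[bz bp cz cp [zT pT]]; split.
  by apply/(pjs_csol HS _ _ (H1 bz bp)).
by apply/(pjs_csol HS _ _ (H2 bz bp)).
Qed.

Lemma coupled_system_solvable g1 gi g2 : entrywise Lint g1 -> entrywise Lint g2 ->
  uniquely_solvable S (coupled_system g1 gi g2).
Proof.
move=> i1 i2.
have ig : entrywise Lint (fun t => col_mx (g1 t) (g2 t)) by exact: entrywise_col.
split.
  have [w Hw] := fredholm_alternative k0 kT klt (Kzp_LI HS)
    (zp_homogeneous HS HX detX) (fun i => col_mx (gi i) 0) ig.
  exists (fun t => usubmx (w t)), (fun t => dsubmx (w t)).
  apply/coupled_system_lin => //.
  by under [X in lin_sol _ _ _ _ _ _ X]eq_fun do rewrite vsubmxK.
move=> z p z' p' /(coupled_system_lin _ _ _ i1 i2) h /(coupled_system_lin _ _ _ i1 i2) h' t tT.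
have := zp_homogeneous HS HX detX (lin_sol_diff HS (Kzp_LI HS) ig h h') tT.
rewrite scaleN1r => /eqP; rewrite subr_eq0 => /eqP /eq_col_mx[-> ->]; by [].
Qed.

Lemma system_zpE z p : system_zp S z p = coupled_system (fun t => - l0 S t) (fun=> 0) (fun=> 0) z p.
Proof.
rewrite /system_zp /coupled_system; congr (periodic_jump_solution S _ _ z /\ periodic_jump_solution S _ _ p).
- apply/funext => t; have -> : Vc S t *m p t = \sum_j chi S j t *:
      ((Hc S j t)^t* *m Dc S j t *m Hc S j t *m p t).
    by rewrite mulmx_suml; apply: eq_bigr => j _; rewrite -scalemxAl.
  by rewrite mulNmx opprB opprD addrCA addrA.
- by apply/funext => i; rewrite addr0.
- by apply/funext => t; rewrite addr0 addrC.
Qed.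

Definition weigh (y : @obs_family R m l N M) : @obs_family R m l N M :=
  (fun i => Dd S i *m y.1 i, fun j t => Dc S j t *m y.2 j t).

Lemma system_pxE y p x : system_px S y p x =
  coupled_system (fun t => - backload S (weigh y) t)
    (fun i => - ((Hd S i)^t* *m (weigh y).1 i)) (fun t => B S t *m f0 S t) p x.
Proof.
rewrite /system_px /coupled_system; congr (periodic_jump_solution S _ _ p /\ periodic_jump_solution S _ _ x).
- apply/funext => t; have -> : Vc S t *m x t = \sum_j chi S j t *:
      ((Hc S j t)^t* *m Dc S j t *m Hc S j t *m x t).
    by rewrite mulmx_suml; apply: eq_bigr => j _; rewrite -scalemxAl.
  rewrite mulNmx opprB -addrA [RHS]addrC -sumrB; congr (_ - _).
  apply: eq_bigr => j _; rewrite -scalerBr; congr (_ *: _).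
  by rewrite mulmxBr !mulmxA.
- by apply/funext => i; rewrite mulmxBr /Vd !mulmxA.
- by apply/funext => t; rewrite [_ + A S t *m _]addrC.
Qed.

Lemma weigh_in_H y : in_H S y -> in_H S (weigh y).
Proof.
move=> /(in_H_Lsq HS) yH; apply: (Lsq_in_H HS) => j.
exact (ewM_LI_Lsq (mOmega HS j) (Dc_LI HS j) (yH j)).
Qed.

Lemma l0N_Lint : entrywise Lint (fun t => - l0 S t).
Proof.
by apply: (entrywiseN (class_module_Lint leb mT)); exact (Lsq_Lint_IT (l0_Lsq HS)).
Qed.

Lemma Bf_Lsq (f : R -> 'cV[C]_r) : entrywise Lsq f -> entrywise Lsq (fun t => B S t *m f t).
Proof. by move=> hf; exact (ewM_LI_Lsq mT (B_LI HS) hf). Qed.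

Theorem system_zp_solvable : uniquely_solvable S (system_zp S).
Proof.
have -> : system_zp S = coupled_system (fun t => - l0 S t) (fun=> 0) (fun=> 0).
  by apply/funext => z; apply/funext => p; rewrite system_zpE.
apply: coupled_system_solvable; first exact l0N_Lint.
by apply: entrywise0; exact: class_module_Lint.
Qed.

Theorem system_px_solvable y : in_H S y -> uniquely_solvable S (system_px S y).
Proof.
move=> yH.
have -> : system_px S y = coupled_system (fun t => - backload S (weigh y) t)
    (fun i => - ((Hd S i)^t* *m (weigh y).1 i)) (fun t => B S t *m f0 S t).
  by apply/funext => p; apply/funext => x; rewrite system_pxE.
apply: coupled_system_solvable.
  apply: (entrywiseN (class_module_Lint leb mT)).
  exact (Lsq_Lint_IT (backload_Lsq HS (weigh_in_H yH))).
exact (Lsq_Lint_IT (Bf_Lsq (f0_Lsq HS))).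
Qed.

Lemma is_state_csol (f : R -> 'cV[C]_r) (x : R -> 'cV[C]_n) : entrywise Lsq f -> is_state S f x ->
  [/\ entrywise bm x,
    csol tk T (fun t => A S t *m x t + B S t *m f t) (fun _ : 'I_N => 0) x & x T = x 0].
Proof.
move=> hf [acx dx xT].
have iT : is_interval IT by exact: interval_is_interval.
have bx : entrywise bm x.
  apply: entrywise_sub acx => g acg; have wg := abs_continuous_within iT acg; split.
    exact: (subspace_continuous_measurable_fun mT wg).
  exact: within_continuous_bounded wg.
split => //; apply/csolP => a b.
have iF : entrywise Lint (fun t => A S t *m x t + B S t *m f t).
  exact (ewD_Lint mT (LI_bm_Lint (A_LI HS) bx) (Lsq_Lint_IT (Bf_Lsq hf))).
have [i1 i2] := iF a b; have [ac1 ac2] := acx a b.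
have sub t : t <= T -> (`[0, t] `<=` IT)%classic.
  by move=> tT s /=; rewrite !in_itv/= => /andP[-> /le_trans ->].
split=> t /andP[t0 tT]; rewrite /Jsum big1 ?addr0; try by move=> i _; rewrite mxE.
  apply: (abs_continuous_FTC t0 (abs_continuousS (sub _ tT) ac1) (Lint_sub tT i1)).
  apply: aeS dx => s H /andP[s0 st]; have Is : I0T s by rewrite /= in_itv/= s0 (lt_le_trans st tT).
  by have [] := H Is a b.
apply: (abs_continuous_FTC t0 (abs_continuousS (sub _ tT) ac2) (Lint_sub tT i2)).
apply: aeS dx => s H /andP[s0 st]; have Is : I0T s by rewrite /= in_itv/= s0 (lt_le_trans st tT).
by have [] := H Is a b.
Qed.

(** With zero jumps each entry is a constant plus a primitive, hence absolutely continuous on the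
    whole closed interval. *)
Lemma csol_is_state (f : R -> 'cV[C]_r) (x : R -> 'cV[C]_n) : entrywise Lsq f -> entrywise bm x ->
  csol tk T (fun t => A S t *m x t + B S t *m f t) (fun _ : 'I_N => 0) x ->
  x T = x 0 -> is_state S f x.
Proof.
move=> hf bx Hx xT.
have iF : entrywise Lint (fun t => A S t *m x t + B S t *m f t).
  exact (ewD_Lint mT (LI_bm_Lint (A_LI HS) bx) (Lsq_Lint_IT (Bf_Lsq hf))).
have key (F z : R -> R) (J : 'I_N -> R) : Lint F -> (forall i, J i = 0) -> int_sol tk T F J z ->
    abs_continuous IT z /\ {ae leb, forall t, I0T t -> is_derive t (1 : R) z (F t)}.
  move=> iG J0 zE; have zE' t : IT t -> z 0 + prim 0 F t = z t.
    by rewrite /= in_itv => tT; rewrite (zE t tT) /Jsum big1 ?addr0.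
  split.
    apply: (@eq_abs_continuous _ _ (fun t => z 0 + prim 0 F t)).
      by move=> t; rewrite inE; exact: zE'.
    apply: abs_continuousD; last exact: abs_continuous_prim.
    by apply: (abs_continuous_lipschitz ltr01) => ? ? _ _; rewrite subrr normr0 mul1r.
  apply: aeS (prim_derive (ltW T0) iG) => t dt; rewrite /= in_itv/= => /andP[t0 tT].
  apply: (@near_eq_is_derive _ _ _ (fun t => z 0 + prim 0 F t)).
    near=> s; apply: zE'; rewrite /= in_itv/=; apply/andP; split; apply/ltW; near: s.
      exact: lt_nbhsr.
    exact: lt_nbhsl.
  by rewrite -[F t]add0r; apply: is_deriveD; apply: dt; rewrite t0.
have K a b : _ := (csolP _ _ _ _ _).1 Hx a b.
have z1 a b (_ : 'I_N) : complex.Re ((0 : 'cV[C]_n) a b) = 0 by rewrite mxE.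
have z2 a b (_ : 'I_N) : complex.Im ((0 : 'cV[C]_n) a b) = 0 by rewrite mxE.
have k1 a b := key _ _ _ (iF a b).1 (z1 a b) (K a b).1.
have k2 a b := key _ _ _ (iF a b).2 (z2 a b) (K a b).2.
split => //.
  by move=> a b; split; [have [] := k1 a b|have [] := k2 a b].
have : forall p : 'I_n * 'I_1, {ae leb, forall t, I0T t ->
    is_derive t (1 : R) (fun s => complex.Re (x s p.1 p.2)) (complex.Re ((A S t *m x t + B S t *m f t) p.1 p.2)) /\
    is_derive t (1 : R) (fun s => complex.Im (x s p.1 p.2)) (complex.Im ((A S t *m x t + B S t *m f t) p.1 p.2))}.
  move=> [a b]; have [_ d1] := k1 a b; have [_ d2] := k2 a b.
  by apply: aeS2 d1 d2 => t h1 h2 tT; split; [exact: h1|exact: h2].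
move/ae_forall_fin; apply: aeS => t Ht tT a b.
exact: (Ht (a, b)).
Unshelve. all: by end_near. Qed.

End UniqueSolvability.

(** * Weighted Cauchy-Schwarz inequality for integrals *)

Section ClassRestriction.
Context {R : realType} {d : measure_display} {T : measurableType d}.
Variables (mu : {measure set T -> \bar R}) (A D : set T).
Hypotheses (mA : measurable A) (mD : measurable D) (AD : A `<=` D).

Lemma sq_integrableS (f : T -> R) : sq_integrable mu D f -> sq_integrable mu A f.
Proof.
move=> [mf f2]; split; first exact: measurable_funS mf.
exact: integrableS f2.
Qed.

Lemma integrableRS (f : T -> R) : integrableR mu D f -> integrableR mu A f.
Proof. exact: integrableS. Qed.

End ClassRestriction.

Section IntegralYoung.
Context {R : realType} {d : measure_display} {T : measurableType d}.
Variables (mu : {measure set T -> \bar R}) (D : set T).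
Hypothesis mD : measurable D.
Notation C := R[i].
Notation LI := (ess_bounded mu D).
Notation Lsq := (sq_integrable mu D).
Notation Lint := (integrableR mu D).

Lemma Re_cint_ge0 (f : T -> C) : (forall x, D x -> 0 <= complex.Re (f x)) ->
  0 <= complex.Re (cint mu D f).
Proof. by move=> f0; apply: Rintegral_ge0. Qed.

(** The pointwise inequality [posdef_young], integrated with one and the same [s] at all points. *)
Lemma integral_young k (W : T -> 'M[C]_k) (x y : T -> 'cV[C]_k) (s : C) :
  (forall t, D t -> posdefmx (W t)) -> entrywise LI W ->
  entrywise LI (fun t => invmx (W t)) -> entrywise Lsq x -> entrywise Lsq y ->
  0 <= complex.Re (cint mu D (fun t => dot (W t *m x t) (x t))) +
       2 * complex.Re (s^* * cint mu D (fun t => dot (x t) (y t))) +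
       Normc.normc s ^+ 2 * complex.Re (cint mu D (fun t => dot (invmx (W t) *m y t) (y t))).
Proof.
move=> pW LW LWi hx hy.
have c1 : cclass Lint (fun t => dot (W t *m x t) (x t)).
  exact (cdot_Lsq mD (ewM_LI_Lsq mD LW hx) hx).
have c2 : cclass Lint (fun t => dot (x t) (y t)) by exact (cdot_Lsq mD hx hy).
have c3 : cclass Lint (fun t => dot (invmx (W t) *m y t) (y t)).
  exact (cdot_Lsq mD (ewM_LI_Lsq mD LWi hy) hy).
have c2' := cclassZ_Lint mD (2 * s^*) c2.
have c3' := cclassZ_Lint mD (Complex (Normc.normc s ^+ 2) 0) c3.
have c12 := cclassD_Lint mD c1 c2'.
have := @Re_cint_ge0 (fun t => dot (W t *m x t) (x t) + (2 * s^*) * dot (x t) (y t) +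
  Complex (Normc.normc s ^+ 2) 0 * dot (invmx (W t) *m y t) (y t)).
rewrite (cintD mD c12 c3') (cintD mD c1 c2') (cintZl mD _ c2) (cintZl mD _ c3).
have R2 (z : C) : complex.Re (2 * z) = 2 * complex.Re z.
  by rewrite !mulr2n !mulrDl !mul1r cReD.
have Rr (r : R) (z : C) : complex.Re (Complex r 0 * z) = r * complex.Re z.
  by rewrite cReM /= mul0r subr0.
rewrite !cReD -mulrA R2 Rr; apply => t Dt.
by rewrite !cReD -mulrA R2 Rr; exact/posdef_young/pW.
Qed.

Lemma integral_cauchy_schwarz k (W : T -> 'M[C]_k) (x y : T -> 'cV[C]_k) :
  (forall t, D t -> posdefmx (W t)) -> entrywise LI W ->
  entrywise LI (fun t => invmx (W t)) -> entrywise Lsq x -> entrywise Lsq y ->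
  Normc.normc (cint mu D (fun t => dot (x t) (y t))) ^+ 2 <=
  complex.Re (cint mu D (fun t => dot (W t *m x t) (x t))) *
  complex.Re (cint mu D (fun t => dot (invmx (W t) *m y t) (y t))).
Proof.
move=> pW LW LWi hx hy; apply: young_cauchy_schwarz.
- apply: Re_cint_ge0 => t Dt.
  by have := posdef_ge0 (pW t Dt) (x t); rewrite lecE => /andP[].
- apply: Re_cint_ge0 => t Dt.
  by have := posdef_ge0 (posdef_inv (pW t Dt)) (y t); rewrite lecE => /andP[].
- by move=> s; exact: integral_young.
Qed.

End IntegralYoung.

(** * Duality between states and observation weights *)

Section Duality.
Context {R : realType} {n r m l N M : nat}.
Variable S : setting R n r m l N M.
Hypothesis HS : standing S.
Notation C := R[i].
Notation leb := (@lebesgue_measure R).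
Notation T := (period S).
Notation tk := (knot S).
Notation IT := (`[0, T]%classic : set R).
Notation I0T := (`]0, T[%classic : set R).
Notation LI := (ess_bounded leb IT).
Notation Lsq := (sq_integrable leb IT).
Notation Lint := (integrableR leb IT).
Notation bm := (bounded_meas T).
Notation fam := (@obs_family R m l N M).

Let k0 := knot_first HS.
Let kT := knot_last HS.
Let klt := knot_lt HS.
Let mT := mIT S.

(** Inner product of the observation space; [estimate] is this product plus [c]. *)
Definition obs_pair (y u : fam) : C :=
  \sum_i dot (y.1 i) (u.1 i) +
  \sum_j cint leb (Omega S j) (fun t => dot (y.2 j t) (u.2 j t)).

Definition obs_of (x : R -> 'cV[C]_n) : fam :=
  (fun i => Hd S i *m x (tk i.+1), fun j t => Hc S j t *m x t).

Definition famD (y u : fam) : fam := (fun i => y.1 i + u.1 i, fun j t => y.2 j t + u.2 j t).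
Definition famN (u : fam) : fam := (fun i => - u.1 i, fun j t => - u.2 j t).
Definition famB (y u : fam) : fam := famD y (famN u).

Lemma obs_of_in_H x : entrywise bm x -> in_H S (obs_of x).
Proof.
move=> bx; apply: (Lsq_in_H HS) => j.
have lx := LI_IT_Omega HS j (bm_LI bx).
exact (ew_LI_Lsq (mOmega HS j) (fOmega HS j) (ewM_LI (Hc_LI HS j) lx)).
Qed.

Lemma famD_in_H y u : in_H S y -> in_H S u -> in_H S (famD y u).
Proof.
move=> /(in_H_Lsq HS) hy /(in_H_Lsq HS) hu; apply: (Lsq_in_H HS) => j.
exact (ewD_Lsq (mOmega HS j) (hy j) (hu j)).
Qed.

Lemma famN_in_H u : in_H S u -> in_H S (famN u).
Proof.
move=> /(in_H_Lsq HS) hu; apply: (Lsq_in_H HS) => j.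
exact (ewN_Lsq (mOmega HS j) (hu j)).
Qed.

Lemma obs_dot_Lint y u j : in_H S y -> in_H S u ->
  cclass (integrableR leb (Omega S j)) (fun t => dot (y.2 j t) (u.2 j t)).
Proof.
by move=> /(in_H_Lsq HS) hy /(in_H_Lsq HS) hu; exact (cdot_Lsq (mOmega HS j) (hy j) (hu j)).
Qed.

Lemma obs_pairDl y y' u : in_H S y -> in_H S y' -> in_H S u ->
  obs_pair (famD y y') u = obs_pair y u + obs_pair y' u.
Proof.
move=> hy hy' hu; rewrite /obs_pair addrACA -!big_split/=; congr (_ + _).
  by apply: eq_bigr => i _; rewrite dotDl.
apply: eq_bigr => j _.
rewrite -(cintD (mOmega HS j) (obs_dot_Lint j hy hu) (obs_dot_Lint j hy' hu)).
by apply: eq_cint => t _; rewrite dotDl.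
Qed.

(** The free term [backload] and the jumps generated by [u.1] together form the adjoint of the
    observation operator [obs_of]. *)
Lemma obs_pair_backload x u : entrywise bm x -> in_H S u ->
  cint leb IT (fun t => dot (x t) (backload S u t)) +
  \sum_(i < N) dot (x (tk i.+1)) ((Hd S i)^t* *m u.1 i) = obs_pair (obs_of x) u.
Proof.
move=> bx hu; rewrite /obs_pair addrC; congr (_ + _).
  by apply: eq_bigr => i _; rewrite dot_adjr.
have E j t : chi S j t * dot (Hc S j t *m x t) (u.2 j t) =
    dot (x t) (chi S j t *: ((Hc S j t)^t* *m u.2 j t)).
  by rewrite dotZr dot_adjr /chi indicE; congr (_ * _); rewrite rmorph_nat.
have hl := LI_Lsq_IT (bm_LI bx); have hu' := in_H_Lsq HS hu.
under [RHS]eq_bigr do rewrite -(cint_chi HS).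
rewrite -(cint_sum mT); last first.
  move=> j; have hj : entrywise Lsq (fun t => chi S j t *: ((Hc S j t)^t* *m u.2 j t)).
    exact (chi_Lsq HS (ewM_LI_Lsq (mOmega HS j) (ew_adj_LI (Hc_LI HS j)) (hu' j))).
  by apply: cclass_eq (cdot_Lsq mT hl hj) => t; rewrite /= E.
apply: eq_cint => t _; rewrite /backload dot_sumr; apply: eq_bigr => j _.
by rewrite E.
Qed.

(** In Green's formula the boundary terms cancel by periodicity and [A] cancels against its adjoint,
    so only the free terms and the jumps of [z] remain. *)
Lemma pairing (b g x z : R -> 'cV[C]_n) (gi : 'I_N -> 'cV[C]_n) :
  entrywise Lsq b -> entrywise Lsq g -> entrywise bm x -> entrywise bm z ->
  csol tk T (fun t => A S t *m x t + b t) (fun _ : 'I_N => 0) x -> x T = x 0 ->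
  csol tk T (fun t => - (A S t)^t* *m z t + g t) gi z -> z T = z 0 ->
  cint leb IT (fun t => dot (b t) (z t)) + cint leb IT (fun t => dot (x t) (g t)) +
  \sum_(i < N) dot (x (tk i.+1)) (gi i) = 0.
Proof.
move=> hb hg bx bz hx xT hz zT.
have ib := Lsq_Lint_IT hb; have ig := Lsq_Lint_IT hg.
have ix := ewD_Lint mT (LI_bm_Lint (A_LI HS) bx) ib.
have iz := ewD_Lint mT (LI_bm_Lint (adjA_LI HS) bz) ig.
have := green k0 kT klt ix iz hx hz; rewrite xT zT subrr => /esym.
apply: etrans; congr (_ + _).
rewrite -(cintD mT (cdot_Lint_LI mT ib (bm_LI bz)) (cdot_LI_Lint mT (bm_LI bx) ig)).
apply: eq_cint => t _; rewrite dotDl dotDr mulNmx dotNr (dot_adjr (A S t)).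
ring.
Qed.

(** The free terms are chosen so that in [pairing] with a state [x] they contribute
    [obs_pair (obs_of x) u - ell S x]. *)
Definition adjoint_of (u : fam) (z : R -> 'cV[C]_n) : Prop :=
  [/\ entrywise bm z,
    csol tk T (fun t => - (A S t)^t* *m z t + (backload S u t - l0 S t))
      (fun i => (Hd S i)^t* *m u.1 i) z & z T = z 0].

Lemma ell_IT x : entrywise bm x -> ell S x = cint leb IT (fun t => dot (x t) (l0 S t)).
Proof.
by move=> bx; exact (cint_I0T_IT (cdot_Lsq mT (bm_Lsq bx) (l0_Lsq HS))).
Qed.

Lemma ell_duality (b x z : R -> 'cV[C]_n) u : in_H S u -> entrywise Lsq b ->
  entrywise bm x ->
  csol tk T (fun t => A S t *m x t + b t) (fun _ : 'I_N => 0) x -> x T = x 0 ->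
  adjoint_of u z ->
  ell S x = obs_pair (obs_of x) u + cint leb IT (fun t => dot (b t) (z t)).
Proof.
move=> hu hb bx hx xT [bz hz zT].
have hB := backload_Lsq HS hu; have hl := l0_Lsq HS.
have := pairing hb (ewB_Lsq mT hB hl) bx bz hx xT hz zT.
have -> : cint leb IT (fun t => dot (x t) (backload S u t - l0 S t)) =
    cint leb IT (fun t => dot (x t) (backload S u t)) - ell S x.
  rewrite (ell_IT bx) -(cintB mT (cdot_Lsq mT (bm_Lsq bx) hB) (cdot_Lsq mT (bm_Lsq bx) hl)).
  by apply: eq_cint => t _; rewrite dotBr.
rewrite -(obs_pair_backload bx hu) => H.
by apply/eqP; rewrite eq_sym -subr_eq0; apply/eqP; rewrite -[RHS]H; ring.
Qed.

(** [qform], [dform_d] and [dform_c] will turn out to be the worst squared contributions to the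
    error of [f], of the discrete noise and of the continuous noise. *)
Definition qform (z : R -> 'cV[C]_n) : R :=
  complex.Re (cint leb IT (fun t => dot (Qtilde S t *m z t) (z t))).

Definition dform_d (u : fam) : R :=
  \sum_i complex.Re (dot (invmx (Dd S i) *m u.1 i) (u.1 i)).

Definition dform_c (u : fam) : R :=
  \sum_j complex.Re (cint leb (Omega S j) (fun t => dot (invmx (Dc S j t) *m u.2 j t) (u.2 j t))).

Lemma Qtilde_dot_Lint z w : entrywise bm z -> entrywise bm w ->
  cclass Lint (fun t => dot (Qtilde S t *m z t) (w t)).
Proof. by move=> bz bw; exact (cdot_Lint_LI mT (LI_bm_Lint (Qtilde_LI HS) bz) (bm_LI bw)). Qed.

Lemma qform_ge0 z : entrywise bm z -> 0 <= qform z.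
Proof.
move=> bz; rewrite /qform -(cint_I0T_IT (Qtilde_dot_Lint bz bz)).
by apply: Re_cint_ge0 => t It; have := Qtilde_ge0 HS (z t) It; rewrite lecE => /andP[].
Qed.

Lemma dform_d_ge0 u : 0 <= dform_d u.
Proof.
apply: sumr_ge0 => i _.
by have := posdef_ge0 (posdef_inv (Dd_posdef HS i)) (u.1 i); rewrite lecE => /andP[].
Qed.

Lemma dform_c_ge0 u : 0 <= dform_c u.
Proof.
apply: sumr_ge0 => j _; apply: Re_cint_ge0 => t Ot.
by have := posdef_ge0 (posdef_inv (Dc_posdef HS Ot)) (u.2 j t); rewrite lecE => /andP[].
Qed.

End Duality.

(** * The quadratic functional of the weights and its minimiser *)

Lemma Rintegral_eq0_ae (R : realType) d (T : measurableType d)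
    (mu : {measure set T -> \bar R}) (D : set T) (f : T -> R) : measurable D ->
  integrableR mu D f -> (forall x, D x -> 0 <= f x) ->
  \int[mu]_(x in D) f x = 0 -> {ae mu, forall x, D x -> f x = 0}.
Proof.
move=> mD fi f0 If.
have : (\int[mu]_(x in D) `|(f x)%:E| = 0)%E.
  rewrite -[RHS]/(0%:E) -If /Rintegral fineK; last exact: integrable_fin_num.
  by apply: eq_integral => x; rewrite inE => Dx; rewrite /= ger0_norm// f0.
move/(ae_eq_integral_abs mu mD (measurable_int _ fi)).
by apply: aeS => x H /H[].
Qed.

Lemma Rintegral_comb (R : realType) d (T : measurableType d)
    (mu : {measure set T -> \bar R}) (D : set T) (f g h k : T -> R) : measurable D ->
  integrableR mu D f -> integrableR mu D g -> integrableR mu D h ->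
  (forall x, D x -> k x = f x + g x + 2 * h x) ->
  \int[mu]_(x in D) k x =
  \int[mu]_(x in D) f x + \int[mu]_(x in D) g x + 2 * \int[mu]_(x in D) h x.
Proof.
move=> mD fi gi hi E; rewrite -(RintegralZl _ mD hi) -(RintegralD mD fi gi).
rewrite -(RintegralD mD (integrableRD mD fi gi) (integrableRZl mD 2 hi)).
by apply: eq_Rintegral => x; rewrite inE => /E.
Qed.

Section Quadratic.
Context {R : realType} {n r m l N M : nat}.
Variable S : setting R n r m l N M.
Hypothesis HS : standing S.
Notation C := R[i].
Notation leb := (@lebesgue_measure R).
Notation T := (period S).
Notation tk := (knot S).
Notation IT := (`[0, T]%classic : set R).
Notation I0T := (`]0, T[%classic : set R).
Notation LI := (ess_bounded leb IT).
Notation Lsq := (sq_integrable leb IT).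
Notation Lint := (integrableR leb IT).
Notation bm := (bounded_meas T).
Notation fam := (@obs_family R m l N M).

Let k0 := knot_first HS.
Let kT := knot_last HS.
Let klt := knot_lt HS.
Let mT := mIT S.

Section Optimal.
Variables z p : R -> 'cV[C]_n.
Hypothesis Hzp : system_zp S z p.
Notation uh := (u_hat S p).

(** Read with [u_hat] in place of the weighted observations of [p], the equation for [z] says that
    [z] is the adjoint state of the weights [u_hat]. *)
Lemma system_zp_parts : [/\ entrywise bm z, entrywise bm p, adjoint_of S uh z,
  csol tk T (fun t => A S t *m p t + Qtilde S t *m z t) (fun _ : 'I_N => 0) p & p T = p 0].
Proof.
have i0 : entrywise Lint (fun=> (0 : 'cV[C]_n)).
  by apply: entrywise0; exact: class_module_Lint.
have := Hzp; rewrite system_zpE => /(coupled_system_lin HS _ _ _ (l0N_Lint HS) i0).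
move=> /lin_sol_zp[bz bp cz cp [zT pT]]; split; [exact bz|exact bp| | |exact pT].
  split; [exact bz| |exact zT].
  refine (eq_csol k0 kT klt _ _ _ cz); [| |by []].
    move=> t _; have E : Vc S t *m p t = backload S uh t.
      rewrite /Vc /backload mulmx_suml; apply: eq_bigr => j _.
      by rewrite -scalemxAl /u_hat /= -!mulmxA.
    by rewrite -addrA E.
  by move=> i; rewrite addr0 /Vd /u_hat /= -!mulmxA.
refine (eq_csol k0 kT klt _ _ _ cp); [|by []|by []].
by move=> t _; rewrite addr0 addrC.
Qed.

Let bz : entrywise bm z. Proof. by have [] := system_zp_parts. Qed.
Let bp : entrywise bm p. Proof. by have [] := system_zp_parts. Qed.

Lemma u_hat_in_H : in_H S uh.
Proof.
apply: (Lsq_in_H HS) => j; have mO := mOmega HS j.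
have lp := LI_IT_Omega HS j (bm_LI bp).
exact (ew_LI_Lsq mO (fOmega HS j) (ewM_LI (ewM_LI (Dc_LI HS j) (Hc_LI HS j)) lp)).
Qed.

Lemma inv_u_hat_d i : invmx (Dd S i) *m uh.1 i = Hd S i *m p (tk i.+1).
Proof. by rewrite /= -mulmxA mulKmx//; exact/posdef_unit/(Dd_posdef HS). Qed.

Lemma inv_u_hat_c j t : Omega S j t -> invmx (Dc S j t) *m uh.2 j t = Hc S j t *m p t.
Proof. by move=> Ot; rewrite /= -mulmxA mulKmx//; exact/posdef_unit/(Dc_posdef HS). Qed.

(** Duality for the state [p], whose free term is [Qtilde z]. The inverse weights applied to [u_hat]
    are the observations of [p], so pairing these with [u_hat] yields the two noise forms. All the
    terms are nonnegative, hence real. *)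
Lemma ell_p : ell S p = Complex (qform S z + dform_d S uh + dform_c S uh) 0.
Proof.
have [_ _ az cp pT] := system_zp_parts.
have hQ : entrywise Lsq (fun t => Qtilde S t *m z t).
  exact (LI_Lsq_IT (ewM_LI (Qtilde_LI HS) (bm_LI bz))).
rewrite (ell_duality HS u_hat_in_H hQ bp cp pT az) /obs_pair.
have d0 i : 0 <= dot (Hd S i *m p (tk i.+1)) (uh.1 i).
  by rewrite -inv_u_hat_d; exact/posdef_ge0/posdef_inv/(Dd_posdef HS).
have c0 j t : Omega S j t -> 0 <= dot (Hc S j t *m p t) (uh.2 j t).
  by move=> Ot; rewrite -inv_u_hat_c//; exact/posdef_ge0/posdef_inv/(Dc_posdef HS).
have q0 : 0 <= cint leb IT (fun t => dot (Qtilde S t *m z t) (z t)).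
  rewrite -(cint_I0T_IT (Qtilde_dot_Lint HS bz bz)).
  by apply: cint_ge0 => t It; exact: Qtilde_ge0.
have Im0 (x : C) : 0 <= x -> complex.Im x = 0 by rewrite lecE => /andP[/eqP].
apply: complex_ext; rewrite ?cReD ?cImD ?cRe_sum ?cIm_sum.
  rewrite addrC addrA /=; congr (_ + _ + _).
    by apply: eq_bigr => i _; rewrite inv_u_hat_d.
  apply: eq_bigr => j _; apply: eq_Rintegral => t; rewrite inE => Ot.
  by congr (complex.Re (dot _ _)); rewrite -inv_u_hat_c.
rewrite (Im0 _ q0) addr0 big1 ?add0r; last by move=> i _; rewrite Im0 ?d0.
by rewrite big1// => j _; apply: Im0; apply: cint_ge0 => t Ot; exact: c0.
Qed.

Lemma herm_expand k (W : 'M[C]_k) (x v : 'cV[C]_k) : W^t* = W ->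
  complex.Re (dot (W *m (x + v)) (x + v)) = complex.Re (dot (W *m x) x) +
    complex.Re (dot (W *m v) v) + 2 * complex.Re (dot (W *m x) v).
Proof.
move=> hW; rewrite mulmxDr !dotDl !dotDr !cReD.
have -> : complex.Re (dot (W *m v) x) = complex.Re (dot (W *m x) v).
  by rewrite dot_adjr hW dotC cRe_conj.
ring.
Qed.

(** Expand around [u_hat] with [v = u - u_hat] and [w = zu - z]. The identity [Pr], which pairs [p]
    with [w], says that the three mixed terms add up to zero: this is the Euler equation. The square
    of [w] is dropped and the squares of [v] are kept. *)
Lemma quadratic_gap u zu : in_H S u -> adjoint_of S u zu ->
  qform S z + dform_d S uh + dform_c S uh +
    (dform_d S (famB u uh) + dform_c S (famB u uh)) <=
  qform S zu + dform_d S u + dform_c S u.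
Proof.
move=> hu [bzu hzu zuT]; have [_ _ [_ hz zT] cp pT] := system_zp_parts.
pose v := famB u uh; pose w t := zu t - z t.
have huh := u_hat_in_H.
have hv : in_H S v by apply: famD_in_H => //; exact: famN_in_H.
have bw : entrywise bm w by apply: (entrywiseB (class_module_bm T)).
have hBu := backload_Lsq HS hu; have hBh := backload_Lsq HS huh.
have hBv := backload_Lsq HS hv; have hl := l0_Lsq HS.
have i1 := ewD_Lint mT (LI_bm_Lint (adjA_LI HS) bzu) (Lsq_Lint_IT (ewB_Lsq mT hBu hl)).
have i2 := ewD_Lint mT (LI_bm_Lint (adjA_LI HS) bz) (Lsq_Lint_IT (ewB_Lsq mT hBh hl)).
have hw : csol tk T (fun t => - (A S t)^t* *m w t + backload S v t)
    (fun i => (Hd S i)^t* *m v.1 i) w.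
  refine (eq_csol k0 kT klt _ _ _ (csolD i1 (ewZ_Lint mT (-1) i2) hzu
    (csolZ (-1) i2 hz))).
  - move=> t _; rewrite mulmxBr scaleN1r.
    have -> : backload S v t = backload S u t - backload S uh t.
      by rewrite /backload -sumrB; apply: eq_bigr => j _; rewrite -scalerBr -mulmxBr.
    by apply/matrixP => a b; rewrite !mxE; ring.
  - by move=> i; rewrite scaleN1r -mulmxBr.
  - by move=> t _; rewrite scaleN1r.
have wT : w T = w 0 by rewrite /w zuT zT.
have hQ : entrywise Lsq (fun t => Qtilde S t *m z t).
  exact (LI_Lsq_IT (ewM_LI (Qtilde_LI HS) (bm_LI bz))).
have Pr := pairing HS hQ hBv bp bw cp pT hw wT.
rewrite -addrA (obs_pair_backload HS bp hv) in Pr.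
have Dd : dform_d S u = dform_d S uh + dform_d S v +
    2 * complex.Re (\sum_i dot (Hd S i *m p (tk i.+1)) (v.1 i)).
  rewrite cRe_sum mulr_sumr -!big_split/=; apply: eq_bigr => i _.
  rewrite -inv_u_hat_d -(herm_expand _ _ (posdef_invadj (Dd_posdef HS i))).
  by rewrite [_ + (_ - _)]addrC subrK.
have Dc' : dform_c S u = dform_c S uh + dform_c S v +
    2 * complex.Re (\sum_j cint leb (Omega S j) (fun t => dot (Hc S j t *m p t) (v.2 j t))).
  rewrite cRe_sum mulr_sumr -!big_split/=; apply: eq_bigr => j _.
  have mO := mOmega HS j; have hj := in_H_Lsq HS huh j; have vj := in_H_Lsq HS hv j.
  have Li := Dcinv_LI HS j.
  have [c1 _] := cdot_Lsq mO (ewM_LI_Lsq mO Li hj) hj.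
  have [c2 _] := cdot_Lsq mO (ewM_LI_Lsq mO Li vj) vj.
  have [c3 _] := obs_dot_Lint HS j (obs_of_in_H HS bp) hv.
  refine (Rintegral_comb mO c1 c2 c3 _) => t Ot.
  have E := herm_expand (uh.2 j t) (v.2 j t) (posdef_invadj (Dc_posdef HS Ot)).
  have uE : uh.2 j t + v.2 j t = u.2 j t by exact: subrKC.
  by rewrite uE [X in 2 * complex.Re (dot X _)]inv_u_hat_c// in E; exact E.
have Q : qform S z + 2 * complex.Re (cint leb IT (fun t => dot (Qtilde S t *m z t) (w t))) <= qform S zu.
  have mI : measurable (I0T : set (measurableTypeR R)) by exact: measurable_I0T.
  have sub (f : R -> C) : cclass Lint f -> cclass (integrableR leb I0T) f.
    by apply: cclass_sub => g; apply: integrableS => //; exact: I0T_sub.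
  have czz := Qtilde_dot_Lint HS bz bz; have czw := Qtilde_dot_Lint HS bz bw.
  have cuu := Qtilde_dot_Lint HS bzu bzu.
  rewrite /qform -(cint_I0T_IT czz) -(cint_I0T_IT czw) -(cint_I0T_IT cuu) /=.
  have [szz _] := sub _ czz; have [szw _] := sub _ czw; have [suu _] := sub _ cuu.
  rewrite -(RintegralZl _ mI szw) -(RintegralD mI szz (integrableRZl mI 2 szw)).
  apply: (le_Rintegral mI _ suu); first exact: (integrableRD mI szz (integrableRZl mI 2 szw)).
  move=> t It; have Qh : (Qtilde S t)^t* = Qtilde S t.
    by rewrite /Qtilde !ctM ctK (posdef_invadj (Q_posdef HS It)) mulmxA.
  have -> : zu t = z t + w t by rewrite /w addrC subrK.
  rewrite (herm_expand _ _ Qh) lerD2r lerDl.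
  by have := Qtilde_ge0 HS (w t) It; rewrite lecE => /andP[].
have arith (a1 a2 a3 b1 b2 c x y w' : R) : a1 + 2 * x <= c -> x + (y + w') = 0 ->
    a1 + a2 + a3 + (b1 + b2) <= c + (a2 + b1 + 2 * y) + (a3 + b2 + 2 * w').
  by move=> h1 h2; lra.
rewrite -/v Dd Dc'; apply: arith Q _.
by have := congr1 (@complex.Re R) Pr; rewrite /obs_pair !cReD.
Qed.

End Optimal.

(** A sum or integral of nonnegative terms vanishes only if each term does, almost everywhere in the
    integral, and the inverse weights are definite. *)
Lemma eq_H_of_dform u u' : in_H S u -> in_H S u' ->
  dform_d S (famB u u') = 0 -> dform_c S (famB u u') = 0 -> eq_H S u u'.
Proof.
move=> hu hu' d0 c0; split.
  move=> i; apply/eqP; rewrite -subr_eq0; apply/eqP.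
  have Pi := posdef_inv (Dd_posdef HS i).
  apply: (posdef_eq0 Pi); have := posdef_ge0 Pi (u.1 i - u'.1 i); rewrite lecE => /andP[/eqP Im0 _].
  apply: complex_ext => //; have /eqP := d0; rewrite psumr_eq0; last first.
    by move=> j _; have := posdef_ge0 (posdef_inv (Dd_posdef HS j)) ((famB u u').1 j); rewrite lecE => /andP[].
  by move/allP => /(_ i); rewrite mem_index_enum => /(_ isT)/eqP.
move=> j; have mO := mOmega HS j.
have hv : in_H S (famB u u') by apply: famD_in_H => //; exact: famN_in_H.
have vj := in_H_Lsq HS hv j.
have [c1 _] := cdot_Lsq mO (ewM_LI_Lsq mO (Dcinv_LI HS j) vj) vj.
have ge0 k t : Omega S k t -> 0 <= complex.Re (dot (invmx (Dc S k t) *m (famB u u').2 k t) ((famB u u').2 k t)).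
  by move=> Ot; have := posdef_ge0 (posdef_inv (Dc_posdef HS Ot)) ((famB u u').2 k t); rewrite lecE => /andP[].
have I0 : \int[leb]_(t in Omega S j) complex.Re (dot (invmx (Dc S j t) *m (famB u u').2 j t) ((famB u u').2 j t)) = 0.
  have /eqP := c0; rewrite psumr_eq0; last by move=> k _; apply: Re_cint_ge0 => t; exact: ge0.
  by move/allP => /(_ j); rewrite mem_index_enum => /(_ isT)/eqP.
apply: aeS (Rintegral_eq0_ae mO c1 (ge0 j) I0) => t H Ot.
have Pt := posdef_inv (Dc_posdef HS Ot).
apply/eqP; rewrite -subr_eq0; apply/eqP; apply: (posdef_eq0 Pt).
have := posdef_ge0 Pt (u.2 j t - u'.2 j t); rewrite lecE => /andP[/eqP Im0 _].
by apply: complex_ext => //; exact: H.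
Qed.

(** The continuous weights enter the integral form only under the integral sign, so null sets do not
    affect the adjoint state. *)
Lemma adjoint_of_eq_H u u' z : in_H S u -> in_H S u' -> eq_H S u u' ->
  adjoint_of S u' z -> adjoint_of S u z.
Proof.
move=> hu hu' [e1 e2] [bz hz zT]; split; [exact bz| |exact zT].
have hBu := backload_Lsq HS hu; have hBh := backload_Lsq HS hu'; have hl := l0_Lsq HS.
have i1 := ewD_Lint mT (LI_bm_Lint (adjA_LI HS) bz) (Lsq_Lint_IT (ewB_Lsq mT hBu hl)).
have i2 := ewD_Lint mT (LI_bm_Lint (adjA_LI HS) bz) (Lsq_Lint_IT (ewB_Lsq mT hBh hl)).
move=> t tT; rewrite (hz t tT).
have -> : Jsum tk (fun i => (Hd S i)^t* *m u.1 i) t = Jsum tk (fun i => (Hd S i)^t* *m u'.1 i) t.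
  by apply: eq_bigr => i _; rewrite e1.
suff -> : vprim (fun s => - (A S s)^t* *m z s + (backload S u s - l0 S s)) t =
  vprim (fun s => - (A S s)^t* *m z s + (backload S u' s - l0 S s)) t by [].
apply/colP => a; rewrite /vprim [LHS]mxE [RHS]mxE.
have tT' : t <= T by case/andP: tT.
have mt : measurable (`[0, t]%classic : set (measurableTypeR R)) by exact: measurable_itv.
apply: (ae_eq_cint mt).
- by apply: cLint_meas; exact (entrywise_Lint_sub tT' i1 a 0).
- by apply: cLint_meas; exact (entrywise_Lint_sub tT' i2 a 0).
apply: aeS (ae_forall_fin e2) => s Hs _.
suff -> : backload S u s = backload S u' s by [].
apply: eq_bigr => j _; rewrite /chi indicE; case: (boolP (s \in Omega S j)) => Os.
  by rewrite Hs//; exact: set_mem.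
by rewrite !scale0r.
Qed.

End Quadratic.

(** * Fubini on the product of a probability space and an observation interval *)

Section ProductDomain.
Context {R : realType} {d1 d2 : measure_display}.
Context {W : measurableType d1} {Y : measurableType d2}.
Variables (P : probability W R) (mu : {sigma_finite_measure set Y -> \bar R}) (D : set Y).
Hypothesis mD : measurable D.
Notation C := R[i].
Notation D2 := ([set: W] `*` D).
Notation mu2 := (P \x mu)%E.
Implicit Types f : W * Y -> R.

Lemma measurable_D2 : measurable D2.
Proof. exact: measurableX. Qed.

Lemma patch_D2 (V : pointedType) (f : W * Y -> V) x y : (f \_ D2) (x, y) = ((fun y => f (x, y)) \_ D) y.
Proof. by rewrite !patchE in_setX in_setT. Qed.

Lemma measurable_section1 f x : measurable_fun D2 f -> measurable_fun D (fun y => f (x, y)).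
Proof.
move=> /(measurable_restrictT _ measurable_D2) mf; apply/(measurable_restrictT _ mD).
have := measurableT_comp mf (pair1_measurable x).
by congr measurable_fun; apply/funext => y /=; rewrite patch_D2.
Qed.

Lemma measurable_section2 f y : D y -> measurable_fun D2 f ->
  measurable_fun [set: W] (fun x => f (x, y)).
Proof.
move=> Dy /(measurable_restrictT _ measurable_D2) mf.
have := measurableT_comp mf (pair2_measurable y).
by congr measurable_fun; apply/funext => x /=; rewrite patch_D2 patchE mem_set.
Qed.

Lemma measurable_lift1 (g : W -> R) : measurable_fun setT g ->
  measurable_fun D2 (fun z => g z.1).
Proof.
by move=> mg; apply: measurable_funS (measurableT_comp mg measurable_fst).
Qed.

Lemma measurable_lift2 (g : Y -> R) : measurable_fun D g ->
  measurable_fun D2 (fun z => g z.2).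
Proof.
move=> /(measurable_restrictT _ mD) mg; apply/(measurable_restrictT _ measurable_D2).
have := measurableT_comp mg (@measurable_snd _ _ W Y).
congr measurable_fun; apply/funext => -[x y] /=; by rewrite patch_D2.
Qed.

Section Tonelli.
Variable f : W * Y -> R.
Hypotheses (mf : measurable_fun D2 f) (f0 : forall z, D2 z -> 0 <= f z).

Let g z := ((f \_ D2) z)%:E.

Let mg : measurable_fun setT g.
Proof. by apply/measurable_EFinP/(measurable_restrictT _ measurable_D2). Qed.

Let g0 z : (0 <= g z)%E.
Proof. by rewrite lee_fin patchE; case: ifPn => //; rewrite inE; exact: f0. Qed.

Let Ig : (\int[mu2]_(z in D2) (f z)%:E = \int[mu2]_z g z)%E.
Proof. by rewrite integral_mkcond restrict_EFin. Qed.

Let I1 x : (\int[mu]_y g (x, y) = \int[mu]_(y in D) (f (x, y))%:E)%E.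
Proof.
rewrite [RHS]integral_mkcond; apply: eq_integral => y _.
by rewrite /g patch_D2 !patchE; case: ifP.
Qed.

Lemma tonelli1 : (\int[mu2]_(z in D2) (f z)%:E = \int[P]_x \int[mu]_(y in D) (f (x, y))%:E)%E.
Proof. by rewrite Ig (fubini_tonelli1 g mg g0); apply: eq_integral => x _; exact: I1. Qed.

End Tonelli.

Section FubiniReal.
Variable f : W * Y -> R.
Hypothesis fi : integrableR mu2 D2 f.

Let g z := ((f \_ D2) z)%:E.

Let gi : mu2.-integrable setT g.
Proof. by have /(integrable_mkcond _ measurable_D2) := fi; rewrite restrict_EFin. Qed.

Let I1 x : fubini_F mu g x = (\int[mu]_(y in D) (f (x, y))%:E)%E.
Proof.
rewrite [RHS]integral_mkcond; apply: eq_integral => y _.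
by rewrite /g patch_D2 !patchE; case: ifP.
Qed.

Let I2 y : fubini_G P g y = ((fun y => \int[P]_x (f (x, y))%:E)%E \_ D) y.
Proof.
rewrite patchE; case: ifPn => Dy; first last.
  by rewrite -[RHS](integral0 P setT); apply: eq_integral => x _; rewrite /g patch_D2 patchE (negbTE Dy).
by apply: eq_integral => x _; rewrite /g patch_D2 patchE Dy.
Qed.

(** Fubini's inner integrals are extended reals, finite almost everywhere; taking [fine] makes them
    real without changing the outer integral. *)
Lemma fine_integrable d (T : measurableType d) (m : {measure set T -> \bar R}) (A : set T)
    (h : T -> \bar R) : measurable A -> m.-integrable A h ->
  integrableR m A (fun x => fine (h x)) /\ (\int[m]_(x in A) (fine (h x))%:E = \int[m]_(x in A) h x)%E.
Proof.
move=> mA hi; have mh := measurable_int _ hi.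
have mfh : measurable_fun A (EFin \o (fun x => fine (h x))).
  apply/measurable_EFinP.
  exact: (measurableT_comp (fine_measurable measurableT) mh).
have E : ae_eq m A h (EFin \o (fun x => fine (h x))).
  by apply: aeS (integrable_ae mA hi) => x H /H hx; rewrite /= fineK.
split; first by apply: (le_integrable mA mfh _ hi) => x _ /=; case: (h x) => [r||] //=; rewrite leey.
by apply: ae_eq_integral => //; exact: ae_eq_sym.
Qed.

Lemma integrable_section1 : {ae P, forall x, integrableR mu D (fun y => f (x, y))}.
Proof.
apply: aeS (ae_integrable1 gi) => x H; apply/(integrable_mkcond _ mD).
move: H; congr (_.-integrable _ _); apply/funext => y.
by rewrite /g patch_D2 restrict_EFin.
Qed.

Lemma integrable_section2 : {ae mu, forall y, D y -> integrableR P setT (fun x => f (x, y))}.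
Proof.
apply: aeS (ae_integrable2 gi) => y H Dy; move: H.
congr (_.-integrable _ _); apply/funext => x.
by rewrite /g patch_D2 patchE mem_set.
Qed.

Let i1 : P.-integrable setT (fun x => \int[mu]_(y in D) (f (x, y))%:E)%E.
Proof.
have := integrable_fubini_F gi; congr (_.-integrable _ _).
by apply/funext => x; exact: I1.
Qed.

Let gG : mu.-integrable setT (fubini_G P g).
Proof.
have mg := measurable_int _ gi; have mag := measurableT_comp (@abse_measurable R setT) mg.
have mG := measurable_fubini_G gi.
apply/integrableP; split=> //; have /(integrable21ltyP P mu mg) := gi; apply: le_lt_trans.
apply: ge0_le_integral => //.
- exact: measurableT_comp.
- exact: (@measurable_fun_fubini_tonelli_G _ _ _ _ _ P _ mag (fun z => abse_ge0 (g z))).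
- move=> y _; apply: le_abse_integral => //.
  exact: (measurableT_comp mg (pair2_measurable y)).
Qed.

Let i2 : mu.-integrable D (fun y => \int[P]_x (f (x, y))%:E)%E.
Proof.
apply/(integrable_mkcond _ mD).
have := gG; congr (_.-integrable _ _).
by apply/funext => y; exact: I2.
Qed.

Lemma fubini_int1 : integrableR P setT (fun x => \int[mu]_(y in D) f (x, y)).
Proof. by case: (fine_integrable measurableT i1). Qed.

Lemma fubini_int2 : integrableR mu D (fun y => \int[P]_x f (x, y)).
Proof. by case: (fine_integrable mD i2). Qed.

Lemma fubini_R : \int[P]_x \int[mu]_(y in D) f (x, y) = \int[mu]_(y in D) \int[P]_x f (x, y).
Proof.
have [_ E1] := fine_integrable measurableT i1; have [_ E2] := fine_integrable mD i2.
congr fine; rewrite E1 E2.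
transitivity (\int[P]_x \int[mu]_y g (x, y))%E.
  by apply: eq_integral => x _; rewrite -I1.
rewrite (Fubini gi) [RHS]integral_mkcond.
by apply: eq_integral => y _; rewrite -I2.
Qed.

End FubiniReal.

Notation Lint2 := (integrableR mu2 D2).
Notation Lsq2 := (sq_integrable mu2 D2).
Notation LI2 := (ess_bounded mu2 D2).

Lemma cfubini_int1 (f : W * Y -> C) : cclass Lint2 f ->
  cclass (integrableR P setT) (fun x => cint mu D (fun y => f (x, y))).
Proof. by move=> [f1 f2]; split; [exact: fubini_int1 f1|exact: fubini_int1 f2]. Qed.

Lemma cfubini (f : W * Y -> C) : cclass Lint2 f ->
  cint P setT (fun x => cint mu D (fun y => f (x, y))) =
  cint mu D (fun y => cint P setT (fun x => f (x, y))).
Proof.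
by move=> [f1 f2]; apply: complex_ext; [exact: fubini_R f1|exact: fubini_R f2].
Qed.

Lemma cfubini_int2 (f : W * Y -> C) : cclass Lint2 f ->
  cclass (integrableR mu D) (fun y => cint P setT (fun x => f (x, y))).
Proof. by move=> [f1 f2]; split; [exact: fubini_int2 f1|exact: fubini_int2 f2]. Qed.

Lemma ess_bounded_lift2 (g : Y -> R) : ess_bounded mu D g -> LI2 (fun z => g z.2).
Proof.
move=> [mg [K gK]]; split; first exact: measurable_lift2.
exists K; case: gK => N [mN N0 sub]; exists ([set: W] `*` N); split.
- exact: measurableX.
- by transitivity (P setT * mu N)%E; [exact: product_measure1E|rewrite N0 mule0].
- move=> [x y] /= H; split => //; apply: sub => /= H'; apply: H => -[_ Dy]; exact: H'.
Qed.

(** By Tonelli the square integral of a product of functions of separate variables factors. *)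
Lemma sq_integrable_lift (a : W -> R) (b : Y -> R) : sq_integrable P setT a ->
  sq_integrable mu D b -> Lsq2 (fun z => a z.1 * b z.2).
Proof.
move=> [ma ia] [mb ib].
have mab : measurable_fun D2 (fun z => a z.1 * b z.2).
  by apply: measurable_funM; [exact: measurable_lift1|exact: measurable_lift2].
split=> //; apply/integrableP; split; first by apply/measurable_EFinP; exact: measurable_fun_sqr.
have -> : (\int[mu2]_(z in D2) `|(EFin \o (fun z => ((a z.1 * b z.2) ^+ 2)%R)) z| =
   \int[mu2]_(z in D2) ((a z.1 * b z.2) ^+ 2)%R%:E)%E.
  by apply: eq_integral => z _; rewrite /= ger0_norm ?sqr_ge0.
rewrite tonelli1; [|exact: measurable_fun_sqr|by move=> z _; exact: sqr_ge0].
have E x : (\int[mu]_(y in D) ((a (x, y).1 * b (x, y).2) ^+ 2)%R%:E =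
    (a x ^+ 2)%R%:E * \int[mu]_(y in D) (b y ^+ 2)%R%:E)%E.
  rewrite -integralZl//; apply: eq_integral => y _; by rewrite /= exprMn EFinM.
under eq_integral do rewrite E.
have fb : (\int[mu]_(y in D) (b y ^+ 2)%R%:E \is a fin_num)%E by exact: integrable_fin_num.
rewrite -(fineK fb) integralZr//.
have fa : (\int[P]_x (a x ^+ 2)%R%:E \is a fin_num)%E by exact: integrable_fin_num.
by rewrite -(fineK fa) -EFinM ltry.
Qed.

End ProductDomain.

Lemma outer_Lint (R : realType) d (T : measurableType d) (mu : {measure set T -> \bar R})
    (D : set T) (mD : measurable D) p q (x : T -> 'cV[R[i]]_p) (y : T -> 'cV[R[i]]_q) :
  entrywise (sq_integrable mu D) x -> entrywise (sq_integrable mu D) y ->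
  entrywise (integrableR mu D) (fun w => x w *m (y w)^t*).
Proof.
move=> hx hy; have mL := class_module_Lsq mu mD.
apply: (entrywiseM _ _ hx (entrywise_adj mL hy)); first exact: class_module_Lint.
exact: class_mul_Lsq.
Qed.

(** * Sections of vector-valued random functions and expectations of traces *)

Section ProductMatrices.
Context {R : realType} {d1 d2 : measure_display}.
Context {W : measurableType d1} {Y : measurableType d2}.
Variables (P : probability W R) (mu : {sigma_finite_measure set Y -> \bar R}) (D : set Y).
Hypothesis mD : measurable D.
Notation C := R[i].
Notation D2 := ([set: W] `*` D).
Notation mu2 := (P \x mu)%E.
Notation Lsq2 := (sq_integrable mu2 D2).

Lemma scale_lift_Lsq k (s : W -> C) (u : Y -> 'cV[C]_k) :
  cclass (sq_integrable P setT) s -> entrywise (sq_integrable mu D) u ->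
  entrywise Lsq2 (fun z => s z.1 *: u z.2).
Proof.
move=> [s1 s2] hu a b; have [u1 u2] := hu a b.
have [_ hD hN] := class_module_Lsq mu2 (measurable_D2 (W := W) mD).
have L := sq_integrable_lift mD; split.
  under eq_fun do rewrite mxE cReM; apply: hD; first exact: L s1 u1.
  by apply: hN; exact: L s2 u2.
by under eq_fun do rewrite mxE cImM; apply: hD; [exact: L s1 u2|exact: L s2 u1].
Qed.

Lemma lift2_Lsq k (u : Y -> 'cV[C]_k) : entrywise (sq_integrable mu D) u ->
  entrywise Lsq2 (fun z => u z.2).
Proof.
move=> hu; have h1 : cclass (sq_integrable P setT) (fun=> (1 : C)).
  apply: cclass_sub (cclass_LI_cst P setT 1) => g; apply: LI_Lsq => //.
  by apply: le_lt_trans (probability_le1 P measurableT) _; rewrite ltry.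
apply: entrywise_eq (scale_lift_Lsq h1 hu) => z; by rewrite scale1r.
Qed.

Lemma lift2_LI p q (u : Y -> 'M[C]_(p, q)) : entrywise (ess_bounded mu D) u ->
  entrywise (ess_bounded mu2 D2) (fun z => u z.2).
Proof. by move=> hu a b; have [u1 u2] := hu a b; split; [exact: (ess_bounded_lift2 _ mD u1)|exact: (ess_bounded_lift2 _ mD u2)]. Qed.

Lemma section1_Lsq k (F : W * Y -> 'cV[C]_k) : entrywise Lsq2 F ->
  {ae P, forall x, entrywise (sq_integrable mu D) (fun y => F (x, y))}.
Proof.
move=> hF.
have key (g : W * Y -> R) : Lsq2 g -> {ae P, forall x, sq_integrable mu D (fun y => g (x, y))}.
  move=> [mg /(integrable_section1 mD) ig]; apply: aeS ig => x ix; split => //.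
  exact: measurable_section1.
have H a : {ae P, forall x, sq_integrable mu D (fun y => complex.Re (F (x, y) a 0)) /\
    sq_integrable mu D (fun y => complex.Im (F (x, y) a 0))}.
  by have [/key h1 /key h2] := hF a 0; apply: aeS2 h1 h2.
by apply: aeS (ae_forall_fin H) => x Hx a b; rewrite ord1; exact: Hx.
Qed.

Lemma section2_Lsq k (F : W * Y -> 'cV[C]_k) : entrywise Lsq2 F ->
  {ae mu, forall y, D y -> entrywise (sq_integrable P setT) (fun x => F (x, y))}.
Proof.
move=> hF.
have key (g : W * Y -> R) : Lsq2 g ->
    {ae mu, forall y, D y -> sq_integrable P setT (fun x => g (x, y))}.
  move=> [mg /(integrable_section2 mD) ig]; apply: aeS ig => y iy Dy; split; last exact: iy.
  exact: (measurable_section2 mD Dy mg).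
have H a : {ae mu, forall y, D y -> sq_integrable P setT (fun x => complex.Re (F (x, y) a 0)) /\
    sq_integrable P setT (fun x => complex.Im (F (x, y) a 0))}.
  have [/key h1 /key h2] := hF a 0; apply: aeS2 h1 h2 => y H1 H2 Dy.
  by split; [exact: H1|exact: H2].
by apply: aeS (ae_forall_fin H) => x Hx Dx a b; rewrite ord1; exact: Hx.
Qed.

Lemma mx_expectationE p q (M : W -> 'M[C]_(p, q)) :
  mx_expectation P M = \matrix_(a, b) cint P setT (fun w => M w a b).
Proof. by apply/matrixP => a b; rewrite !mxE !unlock. Qed.

Lemma cint_trace p q (K : 'M[C]_(p, q)) (M : W -> 'M[C]_(q, p)) :
  entrywise (integrableR P setT) M ->
  cint P setT (fun w => \tr (K *m M w)) = \tr (K *m mx_expectation P M).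
Proof.
move=> hM; rewrite mx_expectationE.
have E w : \tr (K *m M w) = \sum_a \sum_b K a b * M w b a.
  by apply: eq_bigr => a _; rewrite mxE.
have c a b : cclass (integrableR P setT) (fun w => K a b * M w b a).
  by apply: cclassZ_Lint => //; exact: hM.
under eq_cint do rewrite E.
rewrite cint_sum//; last first.
  by move=> a; apply: cclass_sum; first exact: class_module_Lint.
apply: eq_bigr => a _; rewrite cint_sum// mxE; apply: eq_bigr => b _.
by rewrite cintZl ?mxE//; exact: hM.
Qed.

End ProductMatrices.

(** * Second moment of a constant minus two uncorrelated centred variables *)

Section MomentIdentity.
Context {R : realType} {d : measure_display} {W : measurableType d}.
Variable P : probability W R.
Notation C := R[i].
Notation Lsq := (sq_integrable P setT).
Notation Lint := (integrableR P setT).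
Notation nrm := Normc.normc.

Lemma P_fin : (P setT < +oo)%E.
Proof. by apply: le_lt_trans (probability_le1 P measurableT) _; rewrite ltry. Qed.

Lemma class_mul_Lsq_LI : class_mul Lsq (ess_bounded P setT) Lsq.
Proof. by move=> f g cf cg; under eq_fun do rewrite mulrC; exact: class_mul_LI_Lsq. Qed.

Lemma dot_cst_Lsq k (x : W -> 'cV[C]_k) c : entrywise Lsq x -> cclass Lsq (fun w => dot (x w) c).
Proof.
move=> hx; have mL := class_module_Lsq P (@measurableT _ W).
exact: (cclass_dot mL class_mul_Lsq_LI hx (entrywise_LI_cst P setT c) (class_module_LI P setT)).
Qed.

Lemma cLsq_Lint (f : W -> C) : cclass Lsq f -> cclass Lint f.
Proof. by apply: cclass_sub => g; apply: Lsq_Lint => //; exact: P_fin. Qed.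

Lemma cLsq_conjM (f g : W -> C) : cclass Lsq f -> cclass Lsq g ->
  cclass Lint (fun w => (f w)^* * g w).
Proof.
move=> hf hg; have mL := class_module_Lsq P (@measurableT _ W).
apply: (cclassM _ _ (cclass_conj mL hf) hg); first exact: class_module_Lint.
exact: class_mul_Lsq.
Qed.

Lemma normc2_Lint (f : W -> C) : cclass Lsq f -> Lint (fun w => nrm (f w) ^+ 2).
Proof.
move=> [[_ h1] [_ h2]]; under eq_fun do rewrite normc2.
exact: integrableRD.
Qed.

Lemma cint_dot_mean k (x : W -> 'cV[C]_k) c : entrywise Lsq x -> mx_expectation P x = 0 ->
  cint P setT (fun w => dot (x w) c) = 0.
Proof.
move=> hx m0; have E w : dot (x w) c = \tr (c^t* *m x w) by rewrite dotE /mxtrace big_ord1.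
under eq_cint do rewrite E.
rewrite cint_trace ?m0 ?mulmx0 ?mxtrace0//.
by apply: entrywise_sub hx => g; apply: Lsq_Lint => //; exact: P_fin.
Qed.

Lemma normc2_sub (b X Y : C) : nrm (b - (X + Y)) ^+ 2 =
  nrm b ^+ 2 + nrm X ^+ 2 + nrm Y ^+ 2 + 2 * complex.Re (X^* * Y - b^* * X - b^* * Y).
Proof.
case: b X Y => [b1 b2] [x1 x2] [y1 y2]; rewrite !normc2 !cReB !cImB !cReD !cImD !cReM.
rewrite !cRe_conj !cIm_conj /=; ring.
Qed.

(** In the expansion of the square, zero means remove the mixed terms with [b], and uncorrelatedness
    removes the mixed term of [X] and [Y]. *)
Lemma second_moment (b : C) (X Y : W -> C) : cclass Lsq X -> cclass Lsq Y ->
  cint P setT X = 0 -> cint P setT Y = 0 -> cint P setT (fun w => (X w)^* * Y w) = 0 ->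
  Lint (fun w => nrm (b - (X w + Y w)) ^+ 2) /\
  \int[P]_w (nrm (b - (X w + Y w)) ^+ 2) =
  nrm b ^+ 2 + \int[P]_w (nrm (X w) ^+ 2) + \int[P]_w (nrm (Y w) ^+ 2).
Proof.
move=> hX hY X0 Y0 XY0.
have iX := cLsq_Lint hX; have iY := cLsq_Lint hY; have iXY := cLsq_conjM hX hY.
have ibX := cclassZ_Lint measurableT b^* iX; have ibY := cclassZ_Lint measurableT b^* iY.
have i1 := cclassB_Lint measurableT iXY ibX; have [ig1 ig2] := cclassB_Lint measurableT i1 ibY.
have nX := normc2_Lint hX; have nY := normc2_Lint hY.
have nb : Lint (fun=> nrm b ^+ 2) by exact: (@finite_measure_integrable_cst _ _ _ P setT _ measurableT).
have nbX := integrableRD measurableT nb nX.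
have E w := normc2_sub b (X w) (Y w); split.
  under eq_fun do rewrite E.
  exact: (integrableRD measurableT (integrableRD measurableT nbX nY) (integrableRZl measurableT 2 ig1)).
rewrite (Rintegral_comb measurableT nbX nY ig1 (fun w _ => E w)) (RintegralD measurableT nb nX).
have -> : \int[P]_w (nrm b ^+ 2) = nrm b ^+ 2.
  rewrite Rintegral_cst// -[RHS]mulr1; congr (_ * _).
  by rewrite -[RHS]/(fine 1%E) -(probability_setT P).
suff -> : \int[P]_w complex.Re ((X w)^* * Y w - b^* * X w - b^* * Y w) = 0 by rewrite mulr0 addr0.
rewrite -[LHS]/(complex.Re (cint P setT (fun w => (X w)^* * Y w - b^* * X w - b^* * Y w))).
rewrite (cintB measurableT i1 ibY) (cintB measurableT iXY ibX).
by rewrite !(cintZl measurableT) // XY0 X0 Y0 !mulr0 !subr0.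
Qed.

End MomentIdentity.

(** * Noise contributions to the estimate: bounds, means and correlation *)

Section Noise.
Context {R : realType} {n r m l N M : nat}.
Variable S : setting R n r m l N M.
Hypothesis HS : standing S.
Notation C := R[i].
Notation leb := (@lebesgue_measure R).
Notation fam := (@obs_family R m l N M).
Notation nrm := Normc.normc.

(** [eta_d] and [eta_c] are the contributions of discrete and continuous noise to the estimate;
    [noise_form_d] and [noise_form_c] are the forms whose means are the traces bounded in
    [in_G2]. *)
Definition eta_d (y u : fam) : C := \sum_i dot (y.1 i) (u.1 i).

Definition eta_c (y u : fam) : C :=
  \sum_j cint leb (Omega S j) (fun t => dot (y.2 j t) (u.2 j t)).

Definition noise_form_d (y : fam) : R := \sum_i complex.Re (dot (Dd S i *m y.1 i) (y.1 i)).

Definition noise_form_c (y : fam) : R :=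
  \sum_j complex.Re (cint leb (Omega S j) (fun t => dot (Dc S j t *m y.2 j t) (y.2 j t))).

Lemma noise_form_c_ge0 y : 0 <= noise_form_c y.
Proof.
apply: sumr_ge0 => j _; apply: Re_cint_ge0 => t Ot.
by have := posdef_ge0 (Dc_posdef HS Ot) (y.2 j t); rewrite lecE => /andP[].
Qed.

(** Cauchy-Schwarz is applied to the whole sum over [i] at once, for each realization, so
    correlations between different discrete noises, which [in_G2] permits, are covered. *)
Lemma eta_d_bound y u : nrm (eta_d y u) ^+ 2 <= noise_form_d y * dform_d S u.
Proof.
apply: young_cauchy_schwarz; last 1 first.
- move=> s; rewrite /eta_d mulr_sumr cRe_sum !mulr_sumr -!big_split/=.
  by apply: sumr_ge0 => i _; exact: posdef_young (Dd_posdef HS i).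
- apply: sumr_ge0 => i _.
  by have := posdef_ge0 (Dd_posdef HS i) (y.1 i); rewrite lecE => /andP[].
- exact: dform_d_ge0.
Qed.

Lemma eta_c_bound y u : in_H S y -> in_H S u ->
  nrm (eta_c y u) ^+ 2 <= noise_form_c y * dform_c S u.
Proof.
move=> /(in_H_Lsq HS) hy /(in_H_Lsq HS) hu; apply: young_cauchy_schwarz; last 1 first.
- move=> s; rewrite /eta_c mulr_sumr cRe_sum !mulr_sumr -!big_split/=.
  apply: sumr_ge0 => j _.
  exact: (integral_young (mOmega HS j) s (fun t Ot => Dc_posdef HS Ot) (Dc_LI HS j)
    (Dcinv_LI HS j) (hy j) (hu j)).
- exact: noise_form_c_ge0.
- exact: dform_c_ge0.
Qed.

Section Realization.
Context {d : measure_display} {W : measurableType d}.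
Variables (P : probability W R) (xi : W -> fam).
Hypothesis HG : in_G2 S P xi.
Notation Lsq := (sq_integrable P setT).
Notation Lint := (integrableR P setT).
Notation D2 j := ([set: W] `*` Omega S j).
Notation mu2 := (P \x leb)%E.

Lemma noise_d_Lsq i : entrywise Lsq (fun w => (xi w).1 i).
Proof.
apply/(entrywise_LsqP _ measurableT); split; first exact (noise_d_measurable HG i).
by have := noise_d_moment2 HG i; rewrite unlock.
Qed.

(** By Tonelli the finite second moment is square integrability on the product space, which gives
    access to Fubini in what follows. *)
Lemma noise_c_Lsq j : entrywise (sq_integrable mu2 (D2 j)) (fun z => (xi z.1).2 j z.2).
Proof.
have mO := mOmega HS j; have mD2 := measurable_D2 (W := W) mO.
have mf := noise_c_measurable HG j.
apply/(entrywise_LsqP _ mD2); split; first exact mf.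
rewrite tonelli1//; first exact: (noise_c_moment2 HG j).
- exact: (vnorm2_meas mf).
- by move=> z _; exact: vnorm2_ge0.
Qed.

Lemma noise_in_H : {ae P, forall w, in_H S (xi w)}.
Proof.
have H j := section1_Lsq (mOmega HS j) (noise_c_Lsq j).
by apply: aeS (ae_forall_fin H) => w Hw; exact: (Lsq_in_H HS).
Qed.

Lemma noise_form_c_cclass j : cclass (integrableR mu2 (D2 j))
  (fun z => dot (Dc S j z.2 *m (xi z.1).2 j z.2) ((xi z.1).2 j z.2)).
Proof.
have mO := mOmega HS j; have mD2 := measurable_D2 (W := W) mO; have hx := noise_c_Lsq j.
exact (cdot_Lsq mD2 (ewM_LI_Lsq mD2 (lift2_LI P mO (Dc_LI HS j)) hx) hx).
Qed.

Lemma noise_form_c_Lint : Lint (fun w => noise_form_c (xi w)).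
Proof.
apply: integrable_sumR => // j _.
by have [] := cfubini_int1 (mOmega HS j) (noise_form_c_cclass j).
Qed.

Lemma noise_form_d_Lint : Lint (fun w => noise_form_d (xi w)).
Proof.
apply: integrable_sumR => // i _; have hx := noise_d_Lsq i.
have hD := ewM_LI_Lsq measurableT (entrywise_LI_cst P setT (Dd S i)) hx.
by have [] := cdot_Lsq measurableT hD hx.
Qed.

Lemma noise_form_d_mean : \int[P]_w noise_form_d (xi w) <= 1.
Proof.
have hx i := noise_d_Lsq i.
have ix i : cclass Lint (fun w => dot (Dd S i *m (xi w).1 i) ((xi w).1 i)).
  exact (cdot_Lsq measurableT (ewM_LI_Lsq measurableT (entrywise_LI_cst P setT (Dd S i)) (hx i)) (hx i)).
have -> : \int[P]_w noise_form_d (xi w) =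
    complex.Re (\sum_i \tr (Dd S i *m mx_expectation P (fun w => (xi w).1 i *m ((xi w).1 i)^t*))).
  rewrite (Rintegral_sum measurableT); last by move=> i; case: (ix i).
  rewrite cRe_sum; apply: eq_bigr => i _.
  rewrite -(cint_trace (Dd S i) (outer_Lint measurableT (hx i) (hx i))).
  by apply: eq_Rintegral => w _; rewrite tr_mul_adj.
by have := noise_d_trace HG; rewrite lecE => /andP[].
Qed.

(** Fubini exchanges expectation and time integral. For almost every [t] the noise at time [t] is
    square integrable, and the expected form is the trace of [Dc] times its covariance. *)
Lemma noise_form_c_mean : \int[P]_w noise_form_c (xi w) <= 1.
Proof.
have cF j := noise_form_c_cclass j.
have -> : \int[P]_w noise_form_c (xi w) =
    complex.Re (\sum_j cint leb (Omega S j) (fun t => \tr (Dc S j t *m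
      mx_expectation P (fun w => (xi w).2 j t *m ((xi w).2 j t)^t*)))).
  rewrite (Rintegral_sum measurableT); last first.
    by move=> j; case: (cfubini_int1 (mOmega HS j) (cF j)).
  rewrite cRe_sum; apply: eq_bigr => j _; have mO := mOmega HS j.
  have mD2 := measurable_D2 (W := W) mO; have hx := noise_c_Lsq j.
  transitivity (complex.Re (cint P setT (fun w => cint leb (Omega S j)
    (fun t => dot (Dc S j t *m (xi w).2 j t) ((xi w).2 j t))))) => //.
  rewrite (cfubini mO (cF j)); congr (@complex.Re R _).
  have hxx := outer_Lint mD2 hx hx.
  apply: (ae_eq_cint mO); first exact: cLint_meas (cfubini_int2 mO (cF j)).
    have hE : entrywise (measurable_fun (Omega S j)) (fun t =>
        mx_expectation P (fun w => (xi w).2 j t *m ((xi w).2 j t)^t*)).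
      move=> a b; have [m1 m2] := cLint_meas (cfubini_int2 mO (hxx a b)).
      by split; [move: m1|move: m2]; congr measurable_fun;
        apply/funext => t; rewrite mx_expectationE mxE.
    apply: cclass_sum => [|a _]; first exact: class_module_meas.
    exact (ewM_meas (ew_LI_meas (Dc_LI HS j)) hE a a).
  apply: aeS (section2_Lsq mO hx) => t ht Ot.
  rewrite -(cint_trace _ (outer_Lint measurableT (ht Ot) (ht Ot))).
  by apply: eq_cint => w _; rewrite tr_mul_adj.
by have := noise_c_trace HG; rewrite lecE => /andP[].
Qed.

Section Weights.
Variable u : fam.
Hypothesis hu : in_H S u.

Lemma eta_d_Lsq : cclass Lsq (fun w => eta_d (xi w) u).
Proof.
apply: cclass_sum => [|i _]; first exact: class_module_Lsq.
exact: dot_cst_Lsq (noise_d_Lsq i).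
Qed.

Lemma eta_d_mean : cint P setT (fun w => eta_d (xi w) u) = 0.
Proof.
rewrite cint_sum//; last by move=> i; exact: cLsq_Lint (dot_cst_Lsq _ (noise_d_Lsq i)).
by apply: big1 => i _; exact: cint_dot_mean (noise_d_Lsq i) (noise_d_mean HG i).
Qed.

Lemma eta_c_Lint : cclass Lint (fun w => eta_c (xi w) u).
Proof.
apply: cclass_sum => [|j _]; first exact: class_module_Lint.
have mO := mOmega HS j; have mD2 := measurable_D2 (W := W) mO.
exact: (cfubini_int1 mO (cdot_Lsq mD2 (noise_c_Lsq j) (lift2_Lsq P mO (in_H_Lsq HS hu j)))).
Qed.

Lemma eta_c_le : {ae P, forall w, [set: W] w ->
  nrm (eta_c (xi w) u) ^+ 2 <= noise_form_c (xi w) * dform_c S u}.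
Proof. by apply: aeS noise_in_H => w hw _; exact: eta_c_bound. Qed.

(** Measurability comes from Fubini, and Cauchy-Schwarz dominates the square by an integrable
    multiple of [noise_form_c]. *)
Lemma eta_c_Lsq : cclass Lsq (fun w => eta_c (xi w) u).
Proof.
have [m1 m2] := cLint_meas eta_c_Lint.
have iV := integrableRZr measurableT (dform_c S u) noise_form_c_Lint.
split; split => //; (apply: (integrable_ae_le measurableT _ iV);
  [exact: measurable_fun_sqr|apply: aeS eta_c_le => w H /H; rewrite normc2 ger0_norm ?sqr_ge0//]);
  by apply: le_trans; rewrite ?lerDl ?lerDr ?sqr_ge0.
Qed.

Lemma eta_d_variance : \int[P]_w (nrm (eta_d (xi w) u) ^+ 2) <= dform_d S u.
Proof.
have iV := integrableRZr measurableT (dform_d S u) noise_form_d_Lint.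
apply: (@le_trans _ _ (\int[P]_w (noise_form_d (xi w) * dform_d S u))).
  apply: (le_Rintegral measurableT (normc2_Lint eta_d_Lsq) iV) => w _.
  exact: eta_d_bound.
rewrite (RintegralZr _ measurableT noise_form_d_Lint).
by apply: ler_piMl; [exact: dform_d_ge0|exact: noise_form_d_mean].
Qed.

Lemma eta_c_variance : \int[P]_w (nrm (eta_c (xi w) u) ^+ 2) <= dform_c S u.
Proof.
have iV := integrableRZr measurableT (dform_c S u) noise_form_c_Lint.
apply: (@le_trans _ _ (\int[P]_w (noise_form_c (xi w) * dform_c S u))).
  have iN := normc2_Lint eta_c_Lsq; rewrite -[leLHS]ger0_norm; last first.
    by apply: Rintegral_ge0 => w _; exact: sqr_ge0.
  apply: (ae_le_normr_Rintegral measurableT (integrable_meas iN) iV) => [w _|].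
    exact (mulr_ge0 (noise_form_c_ge0 (xi w)) (dform_c_ge0 HS u)).
  by apply: aeS eta_c_le => w H /H; rewrite ger0_norm ?sqr_ge0.
rewrite (RintegralZr _ measurableT noise_form_c_Lint).
by apply: ler_piMl; [exact: dform_c_ge0|exact: noise_form_c_mean].
Qed.

(** Taking [s = 1] gives the mean of [eta_c], and [s = eta_d] its correlation with the discrete
    noise. Fubini moves the expectation inside the time integral, where it vanishes for almost every
    [t]. *)
Lemma eta_c_weighted (s : W -> C) : cclass Lsq s ->
  (forall j, {ae leb, forall t, Omega S j t ->
    cint P setT (fun w => dot ((xi w).2 j t) (s w *: u.2 j t)) = 0}) ->
  cint P setT (fun w => (s w)^* * eta_c (xi w) u) = 0.
Proof.
move=> hs H0.
pose F j (z : W * R) := dot ((xi z.1).2 j z.2) (s z.1 *: u.2 j z.2).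
have cF j : cclass (integrableR mu2 (D2 j)) (F j).
  have mO := mOmega HS j; have mD2 := measurable_D2 (W := W) mO.
  exact (cdot_Lsq mD2 (noise_c_Lsq j) (scale_lift_Lsq mO hs (in_H_Lsq HS hu j))).
have cF1 j := cfubini_int1 (mOmega HS j) (cF j).
transitivity (cint P setT (fun w => \sum_j cint leb (Omega S j) (fun t => F j (w, t)))).
  apply: ae_eq_cint => //.
  - apply: cLint_meas => //; exact: cLsq_conjM hs eta_c_Lsq.
  - by apply: cLint_meas => //; apply: cclass_sum => //; exact: class_module_Lint.
  apply: aeS noise_in_H => w hw _; rewrite mulr_sumr; apply: eq_bigr => j _.
  have mO := mOmega HS j.
  rewrite -(cintZl mO _ (obs_dot_Lint HS j hw hu)); apply: eq_cint => t _.
  by rewrite /F dotZr.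
rewrite cint_sum//; apply: big1 => j _; have mO := mOmega HS j.
rewrite (cfubini mO (cF j)) -[RHS](cint0 leb (Omega S j)).
apply: (ae_eq_cint mO); first exact: cLint_meas (cfubini_int2 mO (cF j)).
  by split; exact: measurable_cst.
exact: H0.
Qed.

Lemma eta_c_mean : cint P setT (fun w => eta_c (xi w) u) = 0.
Proof.
have h1 : cclass Lsq (fun=> (1 : C)).
  by apply: cclass_sub (cclass_LI_cst P setT 1) => g; apply: LI_Lsq => //; exact: P_fin.
transitivity (cint P setT (fun w => (1 : C)^* * eta_c (xi w) u)).
  by apply: eq_cint => w _; rewrite rmorph1 mul1r.
apply: (eta_c_weighted h1) => j.
apply: aeS2 (noise_c_mean HG j) (section2_Lsq (mOmega HS j) (noise_c_Lsq j)) => t m0 hx Ot.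
by apply: cint_dot_mean; [exact: hx|exact: m0].
Qed.

Lemma eta_uncorrelated : cint P setT (fun w => (eta_d (xi w) u)^* * eta_c (xi w) u) = 0.
Proof.
apply: (eta_c_weighted eta_d_Lsq) => j.
apply: aeS2 (ae_forall_fin (fun i => noise_uncorrelated HG i j))
  (section2_Lsq (mOmega HS j) (noise_c_Lsq j)) => t m0 hx Ot.
(* The product of two scalar pairings becomes a trace of the constant matrix [K i] against the
   random matrix [X i], whose mean is the vanishing cross-covariance. *)
pose K i := u.2 j t *m (u.1 i)^t*; pose X i w := (xi w).1 i *m ((xi w).2 j t)^t*.
have iX i : entrywise Lint (X i) by exact (outer_Lint measurableT (noise_d_Lsq i) (hx Ot)).
have E w : dot ((xi w).2 j t) (eta_d (xi w) u *: u.2 j t) =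
    (\sum_i \tr (K i *m X i w))^*.
  rewrite dotZr /eta_d !rmorph_sum mulr_suml; apply: eq_bigr => i _.
  rewrite -[dot _ (u.2 j t)]conjCK -dotC -rmorphM; congr (_^*).
  rewrite /K /X -mulmxA mxtrace_mulC -!mulmxA mulmxA mxtrace_mulC !dotE -mulmxA.
  by rewrite [in RHS]/mxtrace big_ord1 mulmxA [in RHS]mxE big_ord1 mulrC.
under eq_cint do rewrite E.
have ct i : cclass Lint (fun w => \tr (K i *m X i w)).
  apply: cclass_sum => [|a _]; first exact: class_module_Lint.
  exact (ewM_LI_Lint measurableT (entrywise_LI_cst P setT (K i)) (iX i) a a).
rewrite cint_conj//; last by apply: cclass_sum => //; exact: class_module_Lint.
rewrite cint_sum// big1 ?rmorph0// => i _.
by rewrite (cint_trace _ (iX i)) m0// mulmx0 mxtrace0.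
Qed.

End Weights.
End Realization.
End Noise.

(** * The mean square error of an estimate *)

Section EstimateError.
Context {R : realType} {n r m l N M : nat}.
Variable S : setting R n r m l N M.
Hypothesis HS : standing S.
Notation C := R[i].
Notation leb := (@lebesgue_measure R).
Notation T := (period S).
Notation IT := (`[0, T]%classic : set R).
Notation I0T := (`]0, T[%classic : set R).
Notation Lsq := (sq_integrable leb IT).
Notation bm := (bounded_meas T).
Notation fam := (@obs_family R m l N M).
Notation nrm := Normc.normc.

(** The part of the error caused by [f]; the constant [c_hat S z] is the bias of [f0]. *)
Definition bias (f : R -> 'cV[C]_r) (z : R -> 'cV[C]_n) : C :=
  cint leb I0T (fun t => dot (f t) ((B S t)^t* *m z t)).

Lemma bias_Lint f z : entrywise Lsq f -> entrywise bm z ->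
  cclass (integrableR leb IT) (fun t => dot (f t) ((B S t)^t* *m z t)).
Proof.
move=> hf bz; have mT := mIT S.
have hB := ewM_LI (Bt_LI HS) (bm_LI bz).
exact (cdot_Lsq mT hf (LI_Lsq_IT hB)).
Qed.

Lemma bias_IT f z : entrywise Lsq f -> entrywise bm z ->
  cint leb IT (fun t => dot (B S t *m f t) (z t)) = bias f z.
Proof.
move=> hf bz; rewrite /bias (cint_I0T_IT (bias_Lint hf bz)).
by apply: eq_cint => t _; rewrite dot_adjr.
Qed.

Section Realization.
Context {d : measure_display} {W : measurableType d}.
Variables (P : probability W R) (xi : W -> fam).
Hypothesis HG : in_G2 S P xi.
Variables (f : R -> 'cV[C]_r) (x z : R -> 'cV[C]_n) (u : fam) (c : C).
Hypotheses (hf : entrywise Lsq f) (hx : is_state S f x).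
Hypotheses (hu : in_H S u) (hz : adjoint_of S u z).

Let err w := ell S x - estimate S (observe S x (xi w)) u c.

Let bx : entrywise bm x. Proof. by have [] := is_state_csol HS hf hx. Qed.

Lemma observe_in_H w : in_H S (xi w) -> in_H S (observe S x (xi w)).
Proof. by move=> hw; exact (famD_in_H HS (obs_of_in_H HS bx) hw). Qed.

(** Duality writes [ell S x] as the exact observations paired with [u] plus the bias, and the former
    cancel against the estimate. *)
Lemma error_ae w : in_H S (xi w) ->
  err w = bias f z - c - (eta_d (xi w) u + eta_c S (xi w) u).
Proof.
move=> hw; have [_ cx xT] := is_state_csol HS hf hx; have [bz _ _] := hz.
rewrite /err (ell_duality HS hu (Bf_Lsq HS hf) bx cx xT hz) (bias_IT hf bz).
have -> : estimate S (observe S x (xi w)) u c =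
    obs_pair S (obs_of S x) u + obs_pair S (xi w) u + c.
  by rewrite -(obs_pairDl HS (obs_of_in_H HS bx) hw hu).
rewrite -[obs_pair S (xi w) u]/(eta_d (xi w) u + eta_c S (xi w) u).
ring.
Qed.

(** The formula in [error_ae] is available for almost every [w]. Measurability of the error itself
    is established separately, so that both expressions have the same expectation. *)
Lemma error_meas : cclass (measurable_fun setT) err.
Proof.
have mL : class_module (measurable_fun [set: W] : (W -> R) -> Prop) by exact: class_module_meas.
have cst (e : C) : cclass (measurable_fun [set: W] : (W -> R) -> Prop) (fun=> e).
  by split; exact: measurable_cst.
have Ld i : entrywise (measurable_fun [set: W] : (W -> R) -> Prop) (fun w => (observe S x (xi w)).1 i).
  have mc : entrywise (measurable_fun [set: W] : (W -> R) -> Prop) (fun=> Hd S i *m x (knot S i.+1)).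
    by move=> a b; split; exact: measurable_cst.
  exact (entrywiseD mL mc (noise_d_measurable HG i)).
apply: (cclassB mL) => //; apply: (cclassD mL) => //; apply: (cclassD mL).
  apply: cclass_sum => [|i _]; first exact: mL.
  have mu1 : entrywise (measurable_fun [set: W] : (W -> R) -> Prop) (fun=> u.1 i).
    by move=> a b; split; exact: measurable_cst.
  apply: (cclass_dot mL _ (Ld i) mu1 mL); exact: class_mul_meas.
apply: cclass_sum => [|j _]; first exact: mL.
have mO := mOmega HS j.
have mD2 := measurable_D2 (W := W) mO; apply: cLint_meas.
have hu2 := lift2_Lsq P mO (in_H_Lsq HS hu j).
have hx2 := lift2_Lsq P mO (in_H_Lsq HS (obs_of_in_H HS bx) j).
exact: (cfubini_int1 mO (cdot_Lsq mD2 (ewD_Lsq mD2 hx2 (noise_c_Lsq HS HG j)) hu2)).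
Qed.

Theorem estimate_error : ('E_P[fun w => (nrm (err w) ^+ 2)%R] =
  (nrm (bias f z - c) ^+ 2 + \int[P]_w (nrm (eta_d (xi w) u) ^+ 2) +
   \int[P]_w (nrm (eta_c S (xi w) u) ^+ 2))%R%:E)%E.
Proof.
have [ii <-] := second_moment (bias f z - c) (eta_d_Lsq HG u) (eta_c_Lsq HS HG hu)
  (eta_d_mean HG u) (eta_c_mean HS HG hu) (eta_uncorrelated HS HG hu).
rewrite unlock /Rintegral fineK; last exact: integrable_fin_num.
apply: ae_eq_integral => //.
- apply/measurable_EFinP; have [m1 m2] := error_meas.
  under eq_fun do rewrite normc2.
  by apply: measurable_funD; exact: measurable_fun_sqr.
- exact: (measurable_int _ ii).
- by apply: aeS (noise_in_H HS HG) => w hw _; rewrite /= error_ae.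
Qed.

End Realization.
End EstimateError.

(** * Two independent random signs and the noise built from them *)

Section Signs.
Context {R : realType}.
Notation C := R[i].

Definition coin : probability bool R := bernoulli_prob (2^-1 : R).

(** One coin will drive the discrete noise and the other the continuous noise; their independence
    makes the two uncorrelated. *)
Definition two_coins : probability (bool * bool)%type R := (coin \x coin)%E.

Lemma measurable_bool2 (f : bool * bool -> R) : measurable_fun setT f.
Proof.
have -> : f = fun w => if w.1 then (if w.2 then f (true, true) else f (true, false))
                      else (if w.2 then f (false, true) else f (false, false)).
  by apply/funext => -[[] []].
by apply: measurable_fun_ifT; do ?[exact: measurable_fst|
  apply: measurable_fun_ifT; [exact: measurable_snd|exact: measurable_cst|exact: measurable_cst]].
Qed.

Lemma integral_two_coins (f : bool * bool -> R) : (forall w, 0 <= f w) ->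
  \int[two_coins]_w f w =
  (f (true, true) + f (true, false) + f (false, true) + f (false, false)) / 4.
Proof.
move=> f0; have p01 : 0 <= (2^-1 : R) <= 1 by lra.
have E g : (forall b, 0 <= g b) -> (\int[coin]_b (g b)%:E = ((g true + g false) / 2)%R%:E)%E.
  move=> g0; rewrite /coin integral_bernoulli_prob// /unstable.onem -!EFinM -EFinD.
  by congr EFin; field.
rewrite /Rintegral /two_coins fubini_tonelli1//.
- under eq_integral => a _ do rewrite /fubini_F E//.
  by rewrite E /=; [field|move=> b; rewrite divr_ge0 ?addr_ge0].
- by apply/measurable_EFinP; exact: measurable_bool2.
Qed.

Lemma integrable_two_coins (f : bool * bool -> R) : integrableR two_coins setT f.
Proof.
pose K := `|f (true, true)| + `|f (true, false)| + `|f (false, true)| + `|f (false, false)|.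
apply: (integrable_ae_le measurableT (measurable_bool2 f)
  (@finite_measure_integrable_cst _ _ _ two_coins setT K measurableT)).
have n0 w : 0 <= `|f w| by [].
by apply: aeW => -[[] []] _ /=; rewrite /K; move: (n0 (true, true)) (n0 (true, false))
  (n0 (false, true)) (n0 (false, false)) => *; lra.
Qed.

Lemma Rintegral_two_coins (f : bool * bool -> R) : \int[two_coins]_w f w =
  (f (true, true) + f (true, false) + f (false, true) + f (false, false)) / 4.
Proof.
(* Adding this constant makes [f] nonnegative, where Tonelli computes the integral. *)
pose K := `|f (true, true)| + `|f (true, false)| + `|f (false, true)| + `|f (false, false)|.
have n0 w : - f w <= `|f w| by rewrite -normrN ler_norm.
have p0 w : 0 <= `|f w| by [].
have H : forall w, 0 <= f w + K.
  by move=> -[[] []]; rewrite /K; move: (n0 (true, true)) (n0 (true, false))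
  (n0 (false, true)) (n0 (false, false)) (p0 (true, true)) (p0 (true, false))
  (p0 (false, true)) (p0 (false, false)) => *; lra.
have := integral_two_coins H.
rewrite (RintegralD measurableT (integrable_two_coins f) (integrable_two_coins (fun=> K))).
by rewrite [in X in _ + X = _](integral_two_coins (f := fun=> K)) ?addr_ge0//; lra.
Qed.

Lemma cint_two_coins (f : bool * bool -> C) : cint two_coins setT f =
  (f (true, true) + f (true, false) + f (false, true) + f (false, false)) * Complex (4^-1) 0.
Proof.
apply: complex_ext; rewrite ?cReM ?cImM !(cReD, cImD) /= Rintegral_two_coins; ring.
Qed.

Definition sgn (b : bool) : C := if b then 1 else -1.

Lemma sgnK b : sgn b * (sgn b)^* = 1.
Proof. by case: b; rewrite /sgn ?rmorphN rmorph1 ?mulrNN mulr1. Qed.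

Lemma cclass_two_coins (s : bool * bool -> C) : cclass (sq_integrable two_coins setT) s.
Proof. by split; (split; [exact: measurable_bool2|exact: integrable_two_coins]). Qed.

End Signs.

Section SignNoise.
Context {R : realType} {n r m l N M : nat}.
Variable S : setting R n r m l N M.
Hypothesis HS : standing S.
Notation C := R[i].
Notation leb := (@lebesgue_measure R).
Notation fam := (@obs_family R m l N M).
Notation nrm := Normc.normc.
Notation P4 := (@two_coins R).

Definition sign_noise (v : fam) (w : bool * bool) : fam :=
  (fun i => sgn w.1 *: v.1 i, fun j t => sgn w.2 *: v.2 j t).

Lemma sum_signs1 (p q : nat) (A : 'M[C]_(p, q)) : mx_expectation P4 (fun w => sgn w.1 *: A) = 0.
Proof.
by rewrite mx_expectationE; apply/matrixP => a b; rewrite !mxE cint_two_coins !mxE /=; ring.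
Qed.

Lemma sum_signs2 (p q : nat) (A : 'M[C]_(p, q)) : mx_expectation P4 (fun w => sgn w.2 *: A) = 0.
Proof.
by rewrite mx_expectationE; apply/matrixP => a b; rewrite !mxE cint_two_coins !mxE /=; ring.
Qed.

Lemma sum_signs_outer (p q : nat) (x : 'cV[C]_p) (y : 'cV[C]_q) :
  mx_expectation P4 (fun w => (sgn w.1 *: x) *m (sgn w.2 *: y)^t*) = 0.
Proof.
rewrite mx_expectationE; apply/matrixP => a b; rewrite !mxE cint_two_coins.
by rewrite !mxE !big_ord1 !mxE /= !rmorphM rmorphN !rmorph1; ring.
Qed.

Lemma outer_sgn k (s : bool) (x : 'cV[C]_k) : (sgn s *: x) *m (sgn s *: x)^t* = x *m x^t*.
Proof.
by apply/matrixP => a b; rewrite !mxE !big_ord1 !mxE rmorphM mulrACA sgnK mul1r.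
Qed.

Lemma mx_expectation_cst p q (A : 'M[C]_(p, q)) : mx_expectation P4 (fun=> A) = A.
Proof.
rewrite mx_expectationE; apply/matrixP => a b; rewrite !mxE cint_two_coins.
by apply: complex_ext; rewrite ?cReM ?cImM !(cReD, cImD) /=; field.
Qed.

(** A fair sign has mean zero and square one: means and cross-covariances vanish, and within each
    part the covariances are those of the fixed pattern [v]. *)
Lemma sign_noise_G2 v : in_H S v -> noise_form_d S v <= 1 -> noise_form_c S v <= 1 ->
  in_G2 S P4 (sign_noise v).
Proof.
move=> hv nd nc; have mO := mOmega HS; have hv2 := in_H_Lsq HS hv.
have L2v j := scale_lift_Lsq (mO j) (cclass_two_coins (fun w => sgn w.2)) (hv2 j).
have mv j := ew_Lsq_meas (L2v j).
split.
- by move=> i a b; split; exact: measurable_bool2.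
- exact mv.
- by move=> i; rewrite unlock; apply: integrable_lty => //; exact: integrable_two_coins.
- move=> j; have mD2 := measurable_D2 (W := (bool * bool)%type) (mO j).
  have /(entrywise_LsqP _ mD2)[_] := L2v j; rewrite tonelli1//.
    exact: (vnorm2_meas (mv j)).
  by move=> z _; exact: vnorm2_ge0.
- by move=> i; exact: sum_signs1.
- by move=> j; apply: aeW => t _; exact: sum_signs2.
- by move=> i j; apply: aeW => t _; exact: sum_signs_outer.
- under eq_bigr => i _ do rewrite (eq_fun (fun w => outer_sgn w.1 (v.1 i))) mx_expectation_cst tr_mul_adj.
  rewrite lecE /= cIm_sum cRe_sum; apply/andP; split; last exact: nd.
  rewrite big1// => i _.
  by have := posdef_ge0 (Dd_posdef HS i) (v.1 i); rewrite lecE => /andP[/eqP].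
- under eq_bigr => j _ do under eq_cint => t _ do
    rewrite (eq_fun (fun w => outer_sgn w.2 (v.2 j t))) mx_expectation_cst tr_mul_adj.
  rewrite lecE /= cIm_sum cRe_sum; apply/andP; split; last exact: nc.
  rewrite big1// => j _.
  have : 0 <= cint leb (Omega S j) (fun t => dot (Dc S j t *m v.2 j t) (v.2 j t)).
    by apply: cint_ge0 => t Ot; exact: posdef_ge0 (Dc_posdef HS Ot) _.
  by rewrite lecE => /andP[/eqP].
Qed.

Lemma eta_d_sign v u w : nrm (eta_d (sign_noise v w) u) ^+ 2 = nrm (eta_d v u) ^+ 2.
Proof.
have -> : eta_d (sign_noise v w) u = sgn w.1 * eta_d v u.
  by rewrite /eta_d mulr_sumr; apply: eq_bigr => i _; rewrite dotZl.
by rewrite !normc2 cReM cImM /sgn; case: w.1 => /=; ring.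
Qed.

Lemma eta_c_sign v u w : in_H S v -> in_H S u ->
  nrm (eta_c S (sign_noise v w) u) ^+ 2 = nrm (eta_c S v u) ^+ 2.
Proof.
move=> hv hu; have -> : eta_c S (sign_noise v w) u = sgn w.2 * eta_c S v u.
  rewrite /eta_c mulr_sumr; apply: eq_bigr => j _.
  rewrite -(cintZl (mOmega HS j) _ (obs_dot_Lint HS j hv hu)).
  by apply: eq_cint => t _; rewrite dotZl.
by rewrite !normc2 cReM cImM /sgn; case: w.2 => /=; ring.
Qed.

End SignNoise.

(** * The worst-case error for given weights *)

Section WorstCase.
Context {R : realType} {n r m l N M : nat}.
Variable S : setting R n r m l N M.
Hypothesis HS : standing S.
Notation C := R[i].
Notation leb := (@lebesgue_measure R).
Notation T := (period S).
Notation IT := (`[0, T]%classic : set R).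
Notation I0T := (`]0, T[%classic : set R).
Notation Lsq := (sq_integrable leb IT).
Notation Lint := (integrableR leb IT).
Notation bm := (bounded_meas T).
Notation fam := (@obs_family R m l N M).
Notation nrm := Normc.normc.

Let mI : measurable (I0T : set (measurableTypeR R)).
Proof. exact: measurable_I0T. Qed.

Lemma Lint_I0T (g : R -> C) : cclass Lint g -> cclass (integrableR leb I0T) g.
Proof. by apply: cclass_sub => h; apply: integrableRS => //; exact: I0T_sub. Qed.

Lemma Lsq_I0T k (g : R -> 'cV[C]_k) : entrywise Lsq g -> entrywise (sq_integrable leb I0T) g.
Proof. by apply: entrywise_sub => h; apply: sq_integrableS => //; exact: I0T_sub. Qed.

Lemma biasD f g z : entrywise Lsq f -> entrywise Lsq g -> entrywise bm z ->
  bias S (fun t => f t + g t) z = bias S f z + bias S g z.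
Proof.
move=> hf hg bz.
have if1 := Lint_I0T (bias_Lint HS hf bz); have ig1 := Lint_I0T (bias_Lint HS hg bz).
by rewrite /bias -(cintD mI if1 ig1); apply: eq_cint => t _; rewrite dotDl.
Qed.

Lemma bias_qform z : entrywise bm z ->
  complex.Re (cint leb I0T (fun t => dot (invmx (Q S t) *m ((B S t)^t* *m z t)) ((B S t)^t* *m z t))) =
  qform S z.
Proof.
move=> bz; rewrite /qform -(cint_I0T_IT (Qtilde_dot_Lint HS bz bz)).
congr (@complex.Re R _); apply: eq_cint => t _.
by rewrite /Qtilde -!mulmxA (dot_adjr (B S t)).
Qed.

Lemma bias_le g z : entrywise Lsq g -> entrywise bm z ->
  nrm (bias S g z) ^+ 2 <= complex.Re (cint leb I0T (fun t => dot (Q S t *m g t) (g t))) * qform S z.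
Proof.
move=> hg bz; rewrite -(bias_qform bz).
have hB := LI_Lsq_IT (ewM_LI (Bt_LI HS) (bm_LI bz)).
exact: (integral_cauchy_schwarz mI (fun t It => Q_posdef HS It) (Linfty_LI (Q_Linfty HS))
  (Linfty_LI (Qinv_Linfty HS)) (Lsq_I0T hg) (Lsq_I0T hB)).
Qed.

(** For [c = c_hat S z] only the bias of [f - f0] is left, which Cauchy-Schwarz in the metric of [Q]
    bounds by [qform S z]; the variances are bounded in the same way. *)
Theorem sigma_le u z : in_H S u -> adjoint_of S u z ->
  (sigma S u (c_hat S z) <= (qform S z + dform_d S u + dform_c S u)%:E)%E.
Proof.
move=> hu hz; have [bz _ _] := hz.
apply: ge_ereal_sup => _ [f [x [d [W [P [xi [[f2 fQ] hx HG ->]]]]]]].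
have hf := L2_I0T HS f2.
rewrite (estimate_error HS HG (c_hat S z) hf hx hu hz) lee_fin.
apply: lerD; last exact: (eta_c_variance HS HG hu).
apply: lerD; last exact: (eta_d_variance HS HG).
pose g t := f t - f0 S t; have hg : entrywise Lsq g by exact (ewB_Lsq (mIT S) hf (f0_Lsq HS)).
have -> : bias S f z - c_hat S z = bias S g z.
  apply/eqP; rewrite subr_eq; apply/eqP.
  rewrite -[c_hat S z]/(bias S (f0 S) z) -(biasD hg (f0_Lsq HS) bz).
  by apply: eq_cint => t _; rewrite subrK.
apply: (le_trans (bias_le hg bz)); apply: ler_piMl; first exact: qform_ge0.
by move: fQ; rewrite lecE => /andP[].
Qed.

(** At [q = 0] the inverse of the square root is 0 by convention and both claims still hold, so
    vanishing forms need no separate treatment in the extremal choices. *)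
Lemma inv_sqrt_sq (q : R) : 0 <= q -> (Num.sqrt q)^-1 ^+ 2 * q <= 1 /\ (Num.sqrt q)^-1 ^+ 2 * q ^+ 2 = q.
Proof.
move=> q0; have [->|q1] := eqVneq q 0; first by rewrite expr0n/= !mulr0.
have E : (Num.sqrt q)^-1 ^+ 2 * q = 1 by rewrite exprVn sqr_sqrtr// mulVf.
by rewrite expr2 mulrA E mul1r.
Qed.

Section Pattern.
Variable u : fam.
Hypothesis hu : in_H S u.
Notation kd := ((Num.sqrt (dform_d S u))^-1).
Notation kc := ((Num.sqrt (dform_c S u))^-1).

(** The equality case of Cauchy-Schwarz: each part is proportional to the inverse weights applied to
    [u], normalised to exhaust its constraint unless the form vanishes. *)
Definition worst_pattern : fam :=
  (fun i => Complex kd 0 *: (invmx (Dd S i) *m u.1 i),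
   fun j t => Complex kc 0 *: (invmx (Dc S j t) *m u.2 j t)).
Notation v := worst_pattern.

Lemma scaled_inverse_form k (D : 'M[C]_k) (y : 'cV[C]_k) (a : R) : posdefmx D ->
  complex.Re (dot (D *m (Complex a 0 *: (invmx D *m y))) (Complex a 0 *: (invmx D *m y))) =
  a ^+ 2 * complex.Re (dot (invmx D *m y) y).
Proof.
move=> pD; rewrite -scalemxAr mulKVmx; last exact: posdef_unit.
by rewrite dotZl dotZr [dot y _]dotC !cReM cRe_conj cIm_conj !cImM !cRe_conj !cIm_conj /=; ring.
Qed.

Lemma worst_pattern_in_H : in_H S v.
Proof.
apply: (Lsq_in_H HS) => j; have mO := mOmega HS j.
exact (ewZ_Lsq mO _ (ewM_LI_Lsq mO (Dcinv_LI HS j) (in_H_Lsq HS hu j))).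
Qed.

Lemma dform_c_cclass j : cclass (integrableR leb (Omega S j))
  (fun t => dot (invmx (Dc S j t) *m u.2 j t) (u.2 j t)).
Proof.
have mO := mOmega HS j; have uj := in_H_Lsq HS hu j.
exact (cdot_Lsq mO (ewM_LI_Lsq mO (Dcinv_LI HS j) uj) uj).
Qed.

Lemma worst_pattern_d : noise_form_d S v <= 1.
Proof.
have [+ _] := inv_sqrt_sq (dform_d_ge0 HS u); congr (_ <= 1).
rewrite [in LHS]/dform_d mulr_sumr; apply: eq_bigr => i _.
by rewrite (scaled_inverse_form _ _ (Dd_posdef HS i)).
Qed.

Lemma worst_pattern_c : noise_form_c S v <= 1.
Proof.
have [+ _] := inv_sqrt_sq (dform_c_ge0 HS u); congr (_ <= 1).
rewrite {2}/dform_c mulr_sumr; apply: eq_bigr => j _; have mO := mOmega HS j.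
have [c1 _] := dform_c_cclass j.
rewrite -[complex.Re _]/(\int[leb]_(t in Omega S j) _) -(RintegralZl _ mO c1).
apply: eq_Rintegral => t; rewrite inE => Ot.
by rewrite (scaled_inverse_form _ _ (Dc_posdef HS Ot)).
Qed.

Lemma normc2_real (a : R) : nrm (Complex a 0) ^+ 2 = a ^+ 2.
Proof. by rewrite normc2 /= expr0n/= addr0. Qed.

Lemma worst_eta_d : nrm (eta_d v u) ^+ 2 = dform_d S u.
Proof.
have [_ <-] := inv_sqrt_sq (dform_d_ge0 HS u); rewrite -exprMn -[RHS]normc2_real.
congr (nrm _ ^+ 2); transitivity (Complex kd 0 * \sum_i dot (invmx (Dd S i) *m u.1 i) (u.1 i)).
  by rewrite mulr_sumr; apply: eq_bigr => i _; rewrite dotZl.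
have I0 : complex.Im (\sum_i dot (invmx (Dd S i) *m u.1 i) (u.1 i)) = 0.
  rewrite cIm_sum big1// => i _.
  by have := posdef_ge0 (posdef_inv (Dd_posdef HS i)) (u.1 i); rewrite lecE => /andP[/eqP].
by apply: complex_ext; rewrite ?cReM ?cImM I0 /= ?cRe_sum ?mul0r ?mulr0 ?subr0 ?addr0.
Qed.

Lemma worst_eta_c : nrm (eta_c S v u) ^+ 2 = dform_c S u.
Proof.
have [_ <-] := inv_sqrt_sq (dform_c_ge0 HS u); rewrite -exprMn -[RHS]normc2_real.
pose I := \sum_j cint leb (Omega S j) (fun t => dot (invmx (Dc S j t) *m u.2 j t) (u.2 j t)).
congr (nrm _ ^+ 2); transitivity (Complex kc 0 * I).
  rewrite mulr_sumr; apply: eq_bigr => j _; have mO := mOmega HS j.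
  by rewrite -(cintZl mO _ (dform_c_cclass j)); apply: eq_cint => t _; rewrite dotZl.
have I0 : complex.Im I = 0.
  rewrite cIm_sum big1// => j _.
  have : 0 <= cint leb (Omega S j) (fun t => dot (invmx (Dc S j t) *m u.2 j t) (u.2 j t)).
    by apply: cint_ge0 => t Ot; exact/posdef_ge0/posdef_inv/(Dc_posdef HS Ot).
  by rewrite lecE => /andP[/eqP].
apply: complex_ext; rewrite ?cReM ?cImM I0 ?mul0r ?mulr0 ?subr0 ?addr0//.
by congr (_ * _); rewrite /I cRe_sum.
Qed.

End Pattern.

Section Data.
Variable X : R -> 'M[C]_n.
Hypotheses (HX : fundamental_matrix S X) (detX : \det (1%:M - X T) != 0).

(** Perturb [f0] by [s] times the equality case [h] of Cauchy-Schwarz, with [|s|] as large as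
    [in_G1] allows unless [qform S z] vanishes. The sign of [s] makes the mixed term with the real
    part of [c_hat S z - c] nonnegative, so the two squares add up. *)
Lemma worst_f z c : entrywise bm z -> exists2 f, in_G1 S f &
  nrm (c_hat S z - c) ^+ 2 + qform S z <= nrm (bias S f z - c) ^+ 2.
Proof.
move=> bz; pose q := qform S z; have q0 : 0 <= q by exact: qform_ge0.
have [k1 k2] := inv_sqrt_sq q0.
pose k : R := (Num.sqrt q)^-1.
have k0 : 0 <= k by rewrite invr_ge0 sqrtr_ge0.
have [s [s2 sge]] : exists s : R, s ^+ 2 = k ^+ 2 /\ 0 <= s * complex.Re (c_hat S z - c).
  case: (leP 0 (complex.Re (c_hat S z - c))) => h; first by exists k; rewrite mulr_ge0.
  by exists (- k); rewrite sqrrN mulNr -mulrN mulr_ge0// oppr_ge0 ltW.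
have hB := ewM_LI (Bt_LI HS) (bm_LI bz).
pose h t := invmx (Q S t) *m ((B S t)^t* *m z t).
have hh : entrywise Lsq h by exact (LI_Lsq_IT (ewM_LI (Qinv_LI HS) hB)).
have hsh : entrywise Lsq (fun t => Complex s 0 *: h t) by exact (ewZ_Lsq (mIT S) _ hh).
pose f t := Complex s 0 *: h t + f0 S t.
have bh : complex.Re (bias S h z) = q /\ complex.Im (bias S h z) = 0.
  split; first exact: bias_qform.
  have : 0 <= bias S h z.
    by apply: cint_ge0 => t It; exact/posdef_ge0/posdef_inv/(Q_posdef HS It).
  by rewrite lecE => /andP[/eqP].
have hq : cint leb I0T (fun t => dot (Q S t *m h t) (h t)) = Complex q 0.
  transitivity ((bias S h z)^*); last by apply: complex_ext; rewrite ?cRe_conj ?cIm_conj ?bh.1 ?bh.2 ?oppr0.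
  rewrite -(cint_conj mI (Lint_I0T (bias_Lint HS hh bz))); apply: eq_cint => t It.
  by rewrite -dotC mulKVmx//; exact/posdef_unit/(Q_posdef HS It).
exists f.
  split; first by apply/(entrywise_LsqP _ mI); exact (Lsq_I0T (ewD_Lsq (mIT S) hsh (f0_Lsq HS))).
  have E : cint leb I0T (fun t => dot (Q S t *m (f t - f0 S t)) (f t - f0 S t)) =
      Complex (k ^+ 2 * q) 0.
    transitivity (Complex (s ^+ 2) 0 * cint leb I0T (fun t => dot (Q S t *m h t) (h t))).
      rewrite -(cintZl mI); last first.
        apply: Lint_I0T.
        exact (cdot_Lsq (mIT S) (ewM_LI_Lsq (mIT S) (Q_LI HS) hh) hh).
      apply: eq_cint => t _; rewrite /f addrK -scalemxAr dotZl dotZr mulrA; congr (_ * _).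
      by apply: complex_ext; rewrite ?cReM ?cImM ?cRe_conj ?cIm_conj /=; ring.
    by rewrite hq s2; apply: complex_ext; rewrite ?cReM ?cImM /=; ring.
  by rewrite E lecE /= eqxx.
have -> : bias S f z = Complex s 0 * bias S h z + c_hat S z.
  rewrite (biasD hsh (f0_Lsq HS) bz); congr (_ + _).
  rewrite /bias -(cintZl mI _ (Lint_I0T (bias_Lint HS hh bz))).
  by apply: eq_cint => t _; rewrite dotZl.
rewrite -addrA !normc2 !cReD !cImD cReM cImM bh.1 bh.2 /=.
have := k2; rewrite -/k -s2; move: sge; rewrite cReD.
move: (complex.Re (c_hat S z) + complex.Re (- c)) (complex.Im (c_hat S z) + complex.Im (- c)) => a b h1 h2.
rewrite -/q !mulr0 mul0r subr0 !add0r.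
(* The mixed term, the only difference between the two sides. *)
have h3 : 0 <= q * (s * a) by exact: mulr_ge0.
by rewrite -{1}h2; lra.
Qed.

(** The extremal [f] and the random-sign noise are admissible together, and for them the three terms
    of the error reach their bounds simultaneously. *)
Theorem sigma_ge u z c : in_H S u -> adjoint_of S u z ->
  ((nrm (c_hat S z - c) ^+ 2 + qform S z + dform_d S u + dform_c S u)%:E <= sigma S u c)%E.
Proof.
move=> hu hz; have [bz _ _] := hz.
have [f G1f fge] := worst_f c bz; have hf := L2_I0T HS G1f.1.
have [x [bx cx xT]] := state_exists HS HX detX (Lsq_Lint_IT (Bf_Lsq HS hf)).
have hx := csol_is_state HS hf bx cx xT.
have hv := worst_pattern_in_H hu.
have HG := sign_noise_G2 HS hv (worst_pattern_d u) (worst_pattern_c hu).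
apply: le_ereal_sup_tmp; eexists; first by exists f, x, _, _, (@two_coins R), (sign_noise (worst_pattern u)); split.
rewrite (estimate_error HS HG c hf hx hu hz) lee_fin.
have Pc (a : R) : \int[@two_coins R]_w (fun=> a) w = a by rewrite Rintegral_two_coins; field.
rewrite (eq_Rintegral _ (fun w _ => eta_d_sign _ _ w)) (eq_Rintegral _ (fun w _ => eta_c_sign HS w hv hu)).
by rewrite !Pc worst_eta_d (worst_eta_c hu) !lerD2r.
Qed.

End Data.
End WorstCase.

(** * Optimality of the weights and the form of the estimate *)

Section Minimax.
Context {R : realType} {n r m l N M : nat}.
Variable S : setting R n r m l N M.
Hypothesis HS : standing S.
Notation C := R[i].
Notation leb := (@lebesgue_measure R).
Notation T := (period S).
Notation tk := (knot S).
Notation IT := (`[0, T]%classic : set R).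
Notation I0T := (`]0, T[%classic : set R).
Notation Lsq := (sq_integrable leb IT).
Notation Lint := (integrableR leb IT).
Notation bm := (bounded_meas T).
Notation fam := (@obs_family R m l N M).
Notation nrm := Normc.normc.
Variable X : R -> 'M[C]_n.
Hypotheses (HX : fundamental_matrix S X) (detX : \det (1%:M - X T) != 0).
Variables z p : R -> 'cV[C]_n.
Hypothesis Hzp : system_zp S z p.
Notation uh := (u_hat S p).
Notation ch := (c_hat S z).
Notation risk := (qform S z + dform_d S uh + dform_c S uh).

Let az : adjoint_of S uh z. Proof. by have [] := system_zp_parts HS Hzp. Qed.
Let bz : entrywise bm z. Proof. by have [] := system_zp_parts HS Hzp. Qed.
Let huh : in_H S uh. Proof. exact (u_hat_in_H HS Hzp). Qed.

(** Every competitor in [H] has an adjoint state, so the lower bound by the quadratic functional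
    applies to all of them. *)
Lemma adjoint_of_exists u : in_H S u -> exists zu, adjoint_of S u zu.
Proof.
move=> hu; have i := Lsq_Lint_IT (ewB_Lsq (mIT S) (backload_Lsq HS hu) (l0_Lsq HS)).
have [zu [bzu cz zT]] := adjoint_exists HS HX detX (fun i => (Hd S i)^t* *m u.1 i) i.
by exists zu; split; [exact bzu|exact cz|exact zT].
Qed.

Lemma sigma_ge_gap u zu c : in_H S u -> adjoint_of S u zu ->
  ((nrm (c_hat S zu - c) ^+ 2 + (risk + (dform_d S (famB u uh) + dform_c S (famB u uh))))%:E
    <= sigma S u c)%E.
Proof.
move=> hu hz; apply: le_trans (sigma_ge HS HX detX c hu hz); rewrite lee_fin.
by rewrite -[leRHS]addrA -[leRHS]addrA lerD2l [leRHS]addrA; exact (quadratic_gap HS Hzp hu hz).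
Qed.

Lemma sigma_hat : sigma S uh ch = risk%:E.
Proof.
apply/eqP; rewrite eq_le (sigma_le HS huh az)/=.
apply: le_trans (sigma_ge HS HX detX ch huh az).
by rewrite lee_fin -!addrA lerDr sqr_ge0.
Qed.

Lemma inf_sigma : ereal_inf [set v | exists (u' : fam) (c' : C), in_H S u' /\ v = sigma S u' c'] =
  risk%:E.
Proof.
apply/eqP; rewrite eq_le; apply/andP; split.
  by apply: ereal_inf_lbound; exists uh, ch; rewrite sigma_hat.
apply: le_ereal_inf_tmp => _ [u [c [hu ->]]]; have [zu hz] := adjoint_of_exists hu.
apply: le_trans (sigma_ge_gap c hu hz); rewrite lee_fin.
have := sqr_ge0 (nrm (c_hat S zu - c)); have := dform_d_ge0 HS (famB u uh).
have := dform_c_ge0 HS (famB u uh).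
move: (_ ^+ 2) (dform_c S (famB u uh)) (dform_d S (famB u uh)) => a b e.
move: (qform S z) (dform_d S uh) (dform_c S uh) => q1 q2 q3; lra.
Qed.

Lemma hat_minimax : is_minimax S uh ch.
Proof. by split; [exact huh|rewrite inf_sigma sigma_hat]. Qed.

(** For a second optimum both the gap and the distance of [c] from its best value vanish. The gap
    identifies the weights almost everywhere; then [z] is an adjoint state of [u] as well, which
    identifies [c]. *)
Lemma minimax_unique u c : is_minimax S u c -> eq_H S u uh /\ c = ch.
Proof.
move=> [hu]; rewrite inf_sigma => su; have [zu hz] := adjoint_of_exists hu.
(* Stated for an arbitrary adjoint state of [u]: it is used first with [zu], then with [z]. *)
have gap zu' : adjoint_of S u zu' -> nrm (c_hat S zu' - c) ^+ 2 = 0 /\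
    dform_d S (famB u uh) = 0 /\ dform_c S (famB u uh) = 0.
  move=> /(sigma_ge_gap c hu); rewrite su lee_fin.
  have := sqr_ge0 (nrm (c_hat S zu' - c)); have := dform_d_ge0 HS (famB u uh).
  have := dform_c_ge0 HS (famB u uh).
  move: (_ ^+ 2) (dform_c S (famB u uh)) (dform_d S (famB u uh)) => a b e.
  move: (qform S z) (dform_d S uh) (dform_c S uh) => q1 q2 q3 *.
  by split; [|split]; lra.
have [_ [d0 c0]] := gap zu hz.
have eqH := eq_H_of_dform HS hu huh d0 c0; split; first exact eqH.
have [/eqP + _] := gap z (adjoint_of_eq_H HS hu huh eqH az).
by rewrite sqrf_eq0 => /eqP /Normc.eq0_normc /eqP; rewrite subr_eq0 => /eqP.
Qed.

Lemma ell_p_ge0 : 0 <= ell S p.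
Proof.
rewrite (ell_p HS Hzp) lecE /= eqxx/=.
by rewrite !addr_ge0 ?qform_ge0 ?dform_d_ge0 ?dform_c_ge0.
Qed.

Lemma error_hat : estimation_error S uh ch = (Num.sqrt (complex.Re (ell S p)))%:E.
Proof. by rewrite /estimation_error sigma_hat (ell_p HS Hzp). Qed.

(** The equation for [p'] is an adjoint equation driven by the weighted residual of [x'] against the
    data [y], without the term [l0]. *)
Lemma system_px_parts y p' x' : in_H S y -> system_px S y p' x' ->
  let v := weigh S (famB (obs_of S x') y) in
  [/\ in_H S v, entrywise bm x' /\ entrywise bm p',
    csol tk T (fun t => - (A S t)^t* *m p' t + backload S v t)
      (fun i => (Hd S i)^t* *m v.1 i) p' /\ p' T = p' 0,
    csol tk T (fun t => A S t *m x' t + (Qtilde S t *m p' t + B S t *m f0 S t))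
      (fun _ : 'I_N => 0) x' & x' T = x' 0].
Proof.
move=> hy [hp hx] v; have bp := pjs_bm HS hp; have bx := pjs_bm HS hx.
have hv : in_H S v by exact (weigh_in_H HS (famD_in_H HS (obs_of_in_H HS bx) (famN_in_H HS hy))).
have mT := mIT S; have hQ := LI_Lsq_IT (ewM_LI (Qtilde_LI HS) (bm_LI bp)).
have i1 := ewD_Lint mT (LI_bm_Lint (adjA_LI HS) bp) (Lsq_Lint_IT (backload_Lsq HS hv)).
have i2 := ewD_Lint mT (LI_bm_Lint (A_LI HS) bx)
  (Lsq_Lint_IT (ewD_Lsq mT hQ (Bf_Lsq HS (f0_Lsq HS)))).
have hp' : periodic_jump_solution S (fun t => - (A S t)^t* *m p' t + backload S v t)
    (fun i => (Hd S i)^t* *m v.1 i) p'.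
  move: hp; congr (periodic_jump_solution S _ _ p').
    apply/funext => t; rewrite opprB addrC mulNmx; congr (_ + _).
    by apply: eq_bigr => j _; rewrite -mulmxA.
  by apply/funext => i; rewrite -mulmxA.
have hx' : periodic_jump_solution S (fun t => A S t *m x' t + (Qtilde S t *m p' t + B S t *m f0 S t))
    (fun=> 0) x'.
  move: hx; congr (periodic_jump_solution S _ _ x').
  by apply/funext => t; rewrite addrA.
have [cx xT] := (pjs_csol HS _ _ i2).1 hx'.
by split; [exact hv|split|exact: (pjs_csol HS _ _ i1).1 hp'|exact cx|exact xT].
Qed.

(** Duality of [x'] with [z] gives [ell S x'] as [obs_pair S y uh + ch] plus two terms: the residual
    [e] paired with [uh], and the integral of [Qtilde p'] against [z]. Pairing [p] with [p'] shows
    that these two terms cancel. *)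
Theorem estimate_ell y p' x' : in_H S y -> system_px S y p' x' ->
  estimate S y uh ch = ell S x'.
Proof.
move=> hy hpx; have [hv [bx bp'] [cp' p'T] cx xT] := system_px_parts hy hpx.
set v := weigh S _ in hv cp'; pose e := famB (obs_of S x') y.
have [_ bp _ cp pT] := system_zp_parts HS Hzp.
have mT := mIT S.
have hQp := LI_Lsq_IT (ewM_LI (Qtilde_LI HS) (bm_LI bp')).
have hQz := LI_Lsq_IT (ewM_LI (Qtilde_LI HS) (bm_LI bz)).
have hBf := Bf_Lsq HS (f0_Lsq HS).
have he : in_H S e by exact (famD_in_H HS (obs_of_in_H HS bx) (famN_in_H HS hy)).
have Pr := pairing HS hQz (backload_Lsq HS hv) bp bp' cp pT cp' p'T.
rewrite -addrA (obs_pair_backload HS bp hv) in Pr.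
have E1 : cint leb IT (fun t => dot (Qtilde S t *m z t) (p' t)) =
    (cint leb IT (fun t => dot (Qtilde S t *m p' t) (z t)))^*.
  rewrite -(cint_conj mT (Qtilde_dot_Lint HS bp' bz)).
  rewrite -(cint_I0T_IT (Qtilde_dot_Lint HS bz bp')) -(cint_I0T_IT (cclass_conj_Lint mT (Qtilde_dot_Lint HS bp' bz))).
  by apply: eq_cint => t It; rewrite -dotC (Qtilde_herm HS).
have E2 : obs_pair S (obs_of S p) v = (obs_pair S e uh)^*.
  rewrite /obs_pair rmorphD /= !rmorph_sum; congr (_ + _).
    apply: eq_bigr => i _; apply: etrans _ (dotC _ _); rewrite -mulmxA.
    by rewrite [LHS]dot_adjl (Dd_posdef HS i).1.
  apply: eq_bigr => j _; have mO := mOmega HS j.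
  apply: etrans _ (cint_conj mO (obs_dot_Lint HS j he huh)); apply: eq_cint => t Ot.
  rewrite -dotC /= -mulmxA.
  by rewrite [LHS]dot_adjl (Dc_posdef HS Ot).1.
(* Symmetry of [Qtilde] and of the noise weights turns the identity [Pr] into its complex conjugate
   with the two systems interchanged. *)
have E3 : cint leb IT (fun t => dot (Qtilde S t *m p' t) (z t)) + obs_pair S e uh = 0.
  by rewrite -[LHS]conjCK rmorphD /= -E1 -E2 Pr rmorph0.
have hb := ewD_Lsq mT hQp hBf.
rewrite (ell_duality HS huh hb bx cx xT az).
have -> : cint leb IT (fun t => dot (Qtilde S t *m p' t + B S t *m f0 S t) (z t)) =
    cint leb IT (fun t => dot (Qtilde S t *m p' t) (z t)) + ch.
  rewrite -[ch]/(bias S (f0 S) z) -(bias_IT HS (f0_Lsq HS) bz).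
  rewrite -(cintD mT (Qtilde_dot_Lint HS bp' bz) (cdot_Lsq mT hBf (bm_Lsq bz))).
  by apply: eq_cint => t _; rewrite dotDl.
have -> : obs_pair S (obs_of S x') uh = obs_pair S e uh + obs_pair S y uh.
  rewrite -(obs_pairDl HS he hy huh); congr (obs_pair S _ uh).
  by congr pair; [apply/funext => i|apply/funext => j; apply/funext => t]; rewrite /= subrK.
rewrite -[estimate S y uh ch]/(obs_pair S y uh + ch).
by rewrite addrACA [obs_pair S e uh + _]addrC E3 add0r.
Qed.

End Minimax.

Theorem theorem1 (R : realType) (n r m l N M : nat)
    (S : setting R n r m l N M) (X : R -> 'M[R[i]]_n) :
  standing S -> fundamental_matrix S X ->
  \det (1%:M - X (period S)) != 0 ->
  uniquely_solvable S (system_zp S) /\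
  (forall z p : R -> 'cV[R[i]]_n, system_zp S z p ->
    [/\ is_minimax S (u_hat S p) (c_hat S z),
        forall (u : obs_family) (c : R[i]), is_minimax S u c ->
          eq_H S u (u_hat S p) /\ c = c_hat S z,
        0 <= ell S p &
        estimation_error S (u_hat S p) (c_hat S z) =
          (Num.sqrt (complex.Re (ell S p)))%:E]) /\
  (forall (f : R -> 'cV[R[i]]_r) (x : R -> 'cV[R[i]]_n)
      (d : measure_display) (W : measurableType d) (P : probability W R)
      (xi : W -> obs_family),
    in_G1 S f -> is_state S f x -> in_G2 S P xi ->
    {ae P, forall w,
      uniquely_solvable S (system_px S (observe S x (xi w))) /\
      forall z p p' x' : R -> 'cV[R[i]]_n,
        system_zp S z p -> system_px S (observe S x (xi w)) p' x' ->
        estimate S (observe S x (xi w)) (u_hat S p) (c_hat S z) = ell S x'}).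
Proof.
move=> HS HX detX; split; first exact (system_zp_solvable HS HX detX).
split=> [z p Hzp|f x d W P xi hf hx HG].
  split.
  - exact (hat_minimax HS HX detX Hzp).
  - by move=> u c; exact: (minimax_unique HS HX detX Hzp).
  - exact: (ell_p_ge0 HS Hzp).
  - exact: (error_hat HS HX detX Hzp).
(* Almost every realization of the noise lies in [H]; for such a realization both claims are
   deterministic. *)
apply: aeS (noise_in_H HS HG) => w hw.
have hy := observe_in_H HS (L2_I0T HS hf.1) hx hw.
split; first exact (system_px_solvable HS HX detX hy).
by move=> z p p' x' Hzp hpx; exact: (estimate_ell HS Hzp hy hpx).
Qed.
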